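(* Let $A$ be a recursively enumerable set of integers. Then there is a finitely presented $A$-torsion-free group $G$ such that for every finitely presented group $H$, $H$ embeds in $G$ if and only if $H$ is $A$-torsion-free.
   Context: For a group $G$ and set of integers $A$, $G$ is $A$-torsion-free if there is no $g \neq e$ in $G$ with $g^{n} = e$ for some $n \in A$. *)

(* Defs.v *)
From Stdlib Require Import ZArith List Relations Arith.
Import ListNotations.
Open Scope nat_scope.

Inductive prog : Type :=
| PZero : prog
| PSucc : prog
| PProj : nat -> prog
| PComp : prog -> list prog -> prog
| PRec  : prog -> prog -> prog
| PMu   : prog -> prog.

Inductive eval : prog -> list nat -> nat -> Prop :=
| ev_zero v : eval PZero v 0
| ev_succ x v : eval PSucc (x :: v) (S x)
| ev_proj i v : i < length v -> eval (PProj i) v (nth i v 0)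
| ev_comp f gs v ws y : evals gs v ws -> eval f ws y -> eval (PComp f gs) v y
| ev_rec0 f g v y : eval f v y -> eval (PRec f g) (0 :: v) y
| ev_recS f g n v r y : eval (PRec f g) (n :: v) r -> eval g (n :: r :: v) y ->
    eval (PRec f g) (S n :: v) y
| ev_mu f v n : eval f (n :: v) 0 ->
    (forall m, m < n -> exists k, eval f (m :: v) (S k)) -> eval (PMu f) v n
with evals : list prog -> list nat -> list nat -> Prop :=
| evs_nil v : evals [] v []
| evs_cons g gs v w ws : eval g v w -> evals gs v ws -> evals (g :: gs) v (w :: ws).

Definition encZ (z : Z) : nat :=
  if (0 <=? z)%Z then Z.to_nat (2 * z) else Z.to_nat (- 2 * z - 1).

Definition re_set (A : Z -> Prop) : Prop :=
  exists p : prog, forall z : Z, A z <-> exists y, eval p [encZ z] y.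

(* letter (i, true) = generator x_i, (i, false) = x_i^{-1} *)
Definition letter := (nat * bool)%type.
Definition word := list letter.
Definition inv_letter (a : letter) : letter := (fst a, negb (snd a)).
Definition winv (w : word) : word := rev (map inv_letter w).

Record pres := Pres { ngen : nat; rels : list word }.

Definition wf_word (P : pres) (w : word) : Prop :=
  Forall (fun a : letter => fst a < ngen P) w.
Definition wf_pres (P : pres) : Prop := Forall (wf_word P) (rels P).

Inductive step (P : pres) : word -> word -> Prop :=
| step_free u v a : step P (u ++ a :: inv_letter a :: v) (u ++ v)
| step_rel u v r : In r (rels P) -> step P (u ++ r ++ v) (u ++ v).

Definition weq (P : pres) : word -> word -> Prop := clos_refl_sym_trans word (step P).

Fixpoint wpow (w : word) (n : nat) : word :=
  match n with 0 => [] | S k => w ++ wpow w k end.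
Definition wzpow (w : word) (z : Z) : word :=
  if (0 <=? z)%Z then wpow w (Z.to_nat z) else wpow (winv w) (Z.to_nat (- z)).

Definition torsion_free (A : Z -> Prop) (P : pres) : Prop :=
  forall (w : word) (n : Z), wf_word P w -> A n -> weq P (wzpow w n) [] -> weq P w [].

Definition wmap (phi : nat -> word) (w : word) : word :=
  flat_map (fun a : letter => if snd a then phi (fst a) else winv (phi (fst a))) w.

Definition is_hom (H G : pres) (phi : nat -> word) : Prop :=
  (forall i, i < ngen H -> wf_word G (phi i)) /\
  (forall r, In r (rels H) -> weq G (wmap phi r) []).

Definition embeds (H G : pres) : Prop :=
  exists phi : nat -> word, is_hom H G phi /\
    forall w, wf_word H w -> weq G (wmap phi w) [] -> weq H w [].

(* Main.v *)
(** If [0] is in [A], only the trivial group is [A]-torsion-free.  Otherwise let [C] be the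
    largest [A]-torsion-free quotient of the free product of all finitely presented groups
    [H_j].  If [H_j] is [A]-torsion-free then it is a retract of [C], because killing the other
    factors respects the relations of [C].  The relators of [C] are the range of a computable
    function, and [C] embeds into a group [C+] with three generators, adjoining a letter [s]
    with [a_k ^ s = a_k c_k], where [a_k = y^-k a y^k].

    To make [C+] a subgroup of a finitely presented group, run a register machine that prints
    the relators.  A configuration is a point [x] of a lattice, with the registers stored as
    powers of 2 so that the instructions are partial affine maps between cosets; it is
    represented by the conjugate [t ^ x] in a free product with the free group on [t], and
    [u * t ^ x] represents [x] reached with output [u].  Each instruction becomes the stable
    letter of an HNN extension.  A last stable letter [l] commutes with these letters and with
    the initial configuration, and sends an output letter [f] to [f * f'], where [f'] is the
    corresponding generator of [C+].  Along a run [u * t ^ x] keeps commuting with [l], hence so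
    does every printed relator [r]; as [l] sends [r(f)] to [r(f) r(f')], this forces
    [r(f') = 1], so finitely many relations imply all those of [C+].  Conversely the tower of
    HNN extensions exists by Britton's lemma, contains [C+], and is [A]-torsion-free since an
    element of finite order in an HNN extension is conjugate into the base. *)


Require Import Defs.
From Stdlib Require Import ZArith List.
From Stdlib Require Import Arith Lia Bool Relations.
From Stdlib Require Cantor.
From Stdlib Require Import Classical ClassicalEpsilon FunctionalExtensionality
  PropExtensionality ProofIrrelevance.
Import ListNotations.

(** * Codes of words *)

(** The delicate point is that [l] defines an isomorphism of subgroups: a word in the rule letters,
    the initial configuration and the [f] that is trivial before [l] is adjoined must have a trivial
    [f'] part in [C+]. For this each configuration gets a value in [C+], that of the output still to
    be printed. Determinism makes the value unique, and it is compatible with the rules read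
    forwards and backwards. Lattice points that are no configurations get arbitrary values, and only
    quantities independent of that choice are used. Wreath products turn such assignments of values
    into homomorphisms.

    The machine guesses its input by incrementing a register in state 0. With the other registers
    empty, all these configurations have value 1, exactly because every printed word is trivial in
    [C+]. All complete runs end in the same configuration, which can therefore be cancelled to leave
    the bare output.

    Powers of 2 serve because parity separates the register value 0 (coordinate 1) from all others;
    this makes decrement and zero test affine on cosets of the even numbers. *)

Fixpoint lpow {A : Type} (s : list A) (n : nat) : list A :=
  match n with 0 => [] | S k => s ++ lpow s k end.

Definition cp (a b : nat) := Cantor.to_nat (a, b).
Definition c1 (n : nat) := fst (Cantor.of_nat n).
Definition c2 (n : nat) := snd (Cantor.of_nat n).

Lemma c1_cp a b : c1 (cp a b) = a.
Proof. unfold c1, cp. now rewrite Cantor.cancel_of_to. Qed.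
Lemma c2_cp a b : c2 (cp a b) = b.
Proof. unfold c2, cp. now rewrite Cantor.cancel_of_to. Qed.
Lemma cp_c n : cp (c1 n) (c2 n) = n.
Proof. unfold c1, c2, cp. now rewrite <- surjective_pairing, Cantor.cancel_to_of. Qed.
Lemma cp_le a b : a + b <= cp a b.
Proof. unfold cp. generalize (Cantor.to_nat_non_decreasing a b). lia. Qed.

Fixpoint lenc (l : list nat) : nat :=
  match l with [] => 0 | a :: l' => S (cp a (lenc l')) end.

Lemma lenc_inj l l' : lenc l = lenc l' -> l = l'.
Proof.
  revert l'; induction l as [|a l IH]; intros [|b l'] E; simpl in E; try discriminate; auto.
  injection E as E. rewrite <- (c1_cp a (lenc l)), <- (c1_cp b (lenc l')), E. f_equal.
  apply IH. now rewrite <- (c2_cp a (lenc l)), <- (c2_cp b (lenc l')), E.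
Qed.

Lemma lenc_surj n : exists l, lenc l = n.
Proof.
  induction n as [[|n] IH] using lt_wf_ind; [now exists []|].
  destruct (IH (c2 n)) as [l E].
  - generalize (cp_le (c1 n) (c2 n)). rewrite cp_c. lia.
  - exists (c1 n :: l). simpl. now rewrite E, cp_c.
Qed.

(** Generators carry even numbers and their inverses odd ones, so this exchanges a letter with its
    inverse. *)
Definition flip (k : nat) := if Nat.even k then S k else pred k.

Lemma flip_even i : flip (2 * i) = S (2 * i).
Proof. unfold flip. now rewrite Nat.even_mul. Qed.
Lemma flip_odd i : flip (S (2 * i)) = (2 * i)%nat.
Proof. unfold flip. rewrite Nat.even_succ, Nat.odd_mul. reflexivity. Qed.
Lemma flipK k : flip (flip k) = k.
Proof.
  destruct (Nat.Even_or_Odd k) as [[i ->]|[i ->]].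
  - now rewrite flip_even, flip_odd.
  - rewrite Nat.add_1_r. now rewrite flip_odd, flip_even.
Qed.

Lemma div2_even i : (2 * i / 2 = i)%nat.
Proof. now rewrite Nat.mul_comm, Nat.div_mul. Qed.
Lemma div2_odd i : (S (2 * i) / 2 = i)%nat.
Proof. rewrite <- Nat.add_1_r, Nat.add_comm, Nat.mul_comm. now rewrite Nat.div_add. Qed.

Definition bar (k : nat) := cp (c1 k) (flip (c2 k)).
Lemma barK k : bar (bar k) = k.
Proof. unfold bar. rewrite c1_cp, c2_cp, flipK. apply cp_c. Qed.

Definition ninv (w : list nat) := rev (map bar w).

Lemma ninvK w : ninv (ninv w) = w.
Proof.
  unfold ninv. rewrite map_rev, rev_involutive, map_map. erewrite map_ext, map_id; auto.
  apply barK.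
Qed.

Lemma ninv_app u v : ninv (u ++ v) = ninv v ++ ninv u.
Proof. unfold ninv. now rewrite map_app, rev_app_distr. Qed.

(* Letter [cp j (2 * i)] is the generator [x_i] of the presentation with code [j], and
   [cp j (2 * i + 1)] its inverse.  [Ntriv T w] says that [w] is trivial in the largest
   [T]-torsion-free quotient of the free product of all finitely presented groups. *)
Inductive Ntriv (T : nat -> Prop) : list nat -> Prop :=
| N_nil : Ntriv T []
| N_inv j i : Ntriv T [cp j (2 * i); cp j (S (2 * i))]
| N_rel L w : In w L -> Ntriv T (map (cp (lenc (map lenc L))) w)
| N_app x y : Ntriv T x -> Ntriv T y -> Ntriv T (x ++ y)
| N_rot a u : Ntriv T (a :: u) -> Ntriv T (u ++ [a])
| N_strip x z : Ntriv T x -> Ntriv T (x ++ z) -> Ntriv T z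
| N_root w n : T n -> 0 < n -> Ntriv T (lpow w n) -> Ntriv T w.

Arguments N_nil {T}. Arguments N_inv {T}. Arguments N_rel {T}. Arguments N_app {T}.
Arguments N_rot {T}. Arguments N_strip {T}. Arguments N_root {T}.

(** * Computable functions *)

(** Primitive recursion with de Bruijn variables; a variable beyond the environment reads 0. Binding
    by [ELet] takes the place of composition with a list of functions, so that the translation to
    register machines goes by plain structural induction. *)
Inductive ex : Type :=
| EV (i : nat) | EZ | ES (e : ex) | ELet (e1 e2 : ex) | ERec (e b s : ex).

Fixpoint den (e : ex) (v : list nat) : nat :=
  match e with
  | EV i => nth i v 0
  | EZ => 0
  | ES e => S (den e v)
  | ELet e1 e2 => den e2 (den e1 v :: v)
  | ERec e b s => nat_rect (fun _ => nat) (den b v) (fun n r => den s (n :: r :: v)) (den e v)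
  end.

Definition pc (F : list nat -> nat) := exists e, forall v, den e v = F v.

Lemma pc_ext F G : pc F -> (forall v, F v = G v) -> pc G.
Proof. intros [e E] h. exists e. intros v. now rewrite E. Qed.

Lemma pc_var i : pc (fun v => nth i v 0).
Proof. now exists (EV i). Qed.

Lemma pc_S F : pc F -> pc (fun v => S (F v)).
Proof. intros [e E]. exists (ES e). intros v; simpl. now rewrite E. Qed.

Lemma pc_const n : pc (fun _ => n).
Proof. induction n; [now exists EZ|now apply pc_S]. Qed.

Lemma pc_let F G : pc F -> pc G -> pc (fun v => F (G v :: v)).
Proof. intros [e E] [e' E']. exists (ELet e' e). intros v; simpl. now rewrite E', E. Qed.

Lemma pc_rec E B St : pc E -> pc B -> pc St ->
  pc (fun v => nat_rect (fun _ => nat) (B v) (fun n r => St (n :: r :: v)) (E v)).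
Proof.
  intros [e Ee] [b Eb] [s Es]. exists (ERec e b s). intros v; simpl. rewrite Ee.
  induction (E v) as [|n IH]; simpl; auto. now rewrite IH, Es.
Qed.

Definition upr (r : nat -> nat) (i : nat) := match i with 0 => 0 | S j => S (r j) end.

Fixpoint ren (r : nat -> nat) (e : ex) : ex :=
  match e with
  | EV i => EV (r i)
  | EZ => EZ
  | ES e => ES (ren r e)
  | ELet e1 e2 => ELet (ren r e1) (ren (upr r) e2)
  | ERec e b s => ERec (ren r e) (ren r b) (ren (upr (upr r)) s)
  end.

Lemma den_ren e : forall r v v', (forall i, nth i v' 0 = nth (r i) v 0) ->
  den (ren r e) v = den e v'.
Proof.
  induction e as [i| |e IH|e1 IH1 e2 IH2|e IHe b IHb s IHs]; intros r v v' h; simpl.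
  - now rewrite h.
  - reflexivity.
  - now rewrite (IH r v v' h).
  - rewrite (IH1 r v v' h). apply IH2. intros [|i]; simpl; auto.
  - rewrite (IHe r v v' h), (IHb r v v' h). induction (den e v') as [|n IH]; simpl; auto.
    rewrite IH. apply IHs. intros [|[|i]]; simpl; auto.
Qed.

Lemma pc_ren F (r : nat -> nat) (g : list nat -> list nat) : pc F ->
  (forall v i, nth i (g v) 0 = nth (r i) v 0) -> pc (fun v => F (g v)).
Proof.
  intros [e E] h. exists (ren r e). intros v. rewrite <- E. apply den_ren. intros; apply h.
Qed.

Lemma nth_skipn k (v : list nat) i : nth i (skipn k v) 0 = nth (k + i) v 0.
Proof.
  revert v; induction k as [|k IH]; intros v; auto. destruct v; simpl; auto.
  now destruct i.
Qed.

Lemma pc_skip k F : pc F -> pc (fun v => F (skipn k v)).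
Proof. intros h. apply (pc_ren F (fun i => k + i) (skipn k) h). intros; apply nth_skipn. Qed.

Definition pc1 (f : nat -> nat) := pc (fun v => f (nth 0 v 0)).
Definition pc2 (f : nat -> nat -> nat) := pc (fun v => f (nth 0 v 0) (nth 1 v 0)).
Definition pc3 (f : nat -> nat -> nat -> nat) :=
  pc (fun v => f (nth 0 v 0) (nth 1 v 0) (nth 2 v 0)).

Lemma pc_app1 f G : pc1 f -> pc G -> pc (fun v => f (G v)).
Proof. intros hf hG. exact (pc_let _ _ hf hG). Qed.

Lemma pc_app2 f G1 G2 : pc2 f -> pc G1 -> pc G2 -> pc (fun v => f (G1 v) (G2 v)).
Proof.
  intros hf h1 h2.
  exact (pc_let _ _ (pc_let _ _ hf (pc_skip 1 _ h1)) h2).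
Qed.

Lemma pc_app3 f G1 G2 G3 : pc3 f -> pc G1 -> pc G2 -> pc G3 ->
  pc (fun v => f (G1 v) (G2 v) (G3 v)).
Proof.
  intros hf h1 h2 h3.
  exact (pc_let _ _ (pc_let _ _ (pc_let _ _ hf (pc_skip 2 _ h1)) (pc_skip 1 _ h2)) h3).
Qed.

Lemma pc_iter1 f E B : pc1 f -> pc E -> pc B ->
  pc (fun v => nat_rect (fun _ => nat) (B v) (fun _ r => f r) (E v)).
Proof.
  intros hf hE hB. apply (pc_rec E B (fun v => f (nth 1 v 0))); auto.
  apply pc_app1; auto. apply pc_var.
Qed.

Definition ifz (c a b : nat) := match c with 0 => a | S _ => b end.

Lemma pc3_ifz : pc3 ifz.
Proof.
  apply pc_ext with (fun v => nat_rect (fun _ => nat) (nth 1 v 0) (fun _ _ => nth 2 v 0) (nth 0 v 0)).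
  - apply (pc_rec _ _ (fun v => nth 4 v 0)); apply pc_var.
  - intros v. unfold ifz. destruct (nth 0 v 0); reflexivity.
Qed.

Lemma pc1_pred : pc1 pred.
Proof.
  apply pc_ext with (fun v => nat_rect (fun _ => nat) 0 (fun n _ => n) (nth 0 v 0)).
  - apply (pc_rec _ (fun _ => 0) (fun v => nth 0 v 0)); [apply pc_var|apply pc_const|apply pc_var].
  - intros v. destruct (nth 0 v 0); reflexivity.
Qed.

Lemma pc2_add : pc2 Nat.add.
Proof.
  apply pc_ext with (fun v => nat_rect (fun _ => nat) (nth 1 v 0) (fun _ r => S r) (nth 0 v 0)).
  - apply pc_iter1; [apply pc_S|..]; apply pc_var.
  - intros v. induction (nth 0 v 0); simpl; congruence.
Qed.

Lemma pc2_sub : pc2 Nat.sub.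
Proof.
  apply pc_ext with (fun v => nat_rect (fun _ => nat) (nth 0 v 0) (fun _ r => pred r) (nth 1 v 0)).
  - apply pc_iter1; [apply pc1_pred|..]; apply pc_var.
  - intros v. induction (nth 1 v 0); simpl; lia.
Qed.

Definition neqb (x y : nat) := (x - y) + (y - x).

Lemma neqb_0 x y : neqb x y = 0 <-> x = y.
Proof. unfold neqb. lia. Qed.

Lemma pc2_neqb : pc2 neqb.
Proof.
  apply (pc_app2 Nat.add (fun v => nth 0 v 0 - nth 1 v 0) (fun v => nth 1 v 0 - nth 0 v 0));
    [apply pc2_add|apply pc2_sub|]. apply (pc_app2 Nat.sub); [apply pc2_sub|..]; apply pc_var.
Qed.

(** * Cantor's pairing is primitive recursive *)

Definition tri (n : nat) := nat_rect (fun _ => nat) 0 (fun i m => S i + m) n.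

Lemma pc1_tri : pc1 tri.
Proof.
  apply (pc_rec _ (fun _ => 0) (fun v => S (nth 0 v 0) + nth 1 v 0)); [apply pc_var|apply pc_const|].
  apply (pc_app2 Nat.add); [apply pc2_add|apply pc_S|]; apply pc_var.
Qed.

(** Holds by computation because [tri] repeats the recursion in the definition of
    [Cantor.to_nat]. *)
Lemma cp_tri a b : cp a b = b + tri (b + a).
Proof. reflexivity. Qed.

Lemma pc2_cp : pc2 cp.
Proof.
  apply (pc_ext (fun v => nth 1 v 0 + tri (nth 1 v 0 + nth 0 v 0))); [|reflexivity].
  apply (pc_app2 Nat.add); [apply pc2_add|apply pc_var|].
  apply (pc_app1 tri); [apply pc1_tri|]. apply (pc_app2 Nat.add); [apply pc2_add|..]; apply pc_var.
Qed.

(* The number of the diagonal on which Cantor's enumeration has its [n]-th pair. *)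
Definition diag (n : nat) :=
  nat_rect (fun _ => nat) 0 (fun n s => ifz (neqb (S n) (tri (S s))) (S s) s) n.

Lemma pc1_diag : pc1 diag.
Proof.
  apply (pc_rec _ (fun _ => 0)
    (fun v => ifz (neqb (S (nth 0 v 0)) (tri (S (nth 1 v 0)))) (S (nth 1 v 0)) (nth 1 v 0)));
    [apply pc_var|apply pc_const|].
  apply (pc_app3 ifz); [apply pc3_ifz| |apply pc_S, pc_var|apply pc_var].
  apply (pc_app2 neqb); [apply pc2_neqb|apply pc_S, pc_var|].
  apply (pc_app1 tri); [apply pc1_tri|apply pc_S, pc_var].
Qed.

Lemma tri_S n : tri (S n) = S n + tri n.
Proof. reflexivity. Qed.

Lemma diag_spec n : tri (diag n) <= n < tri (S (diag n)).
Proof.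
  induction n as [|n IH]; [simpl; lia|].
  change (diag (S n)) with (ifz (neqb (S n) (tri (S (diag n)))) (S (diag n)) (diag n)).
  destruct (neqb (S n) (tri (S (diag n)))) eqn:E; simpl ifz.
  - apply (proj1 (neqb_0 _ _)) in E. rewrite (tri_S (S (diag n))). lia.
  - assert (S n <> tri (S (diag n))) by (intros X; apply (proj2 (neqb_0 _ _)) in X; congruence). lia.
Qed.

Lemma tri_mono a b : a <= b -> tri a <= tri b.
Proof. induction 1; auto. rewrite tri_S. lia. Qed.

Lemma diag_cp a b : diag (cp a b) = b + a.
Proof.
  assert (H := diag_spec (cp a b)). rewrite cp_tri in *.
  destruct (lt_eq_lt_dec (diag (b + tri (b + a))) (b + a)) as [[h|h]|h]; auto; exfalso.
  - apply (tri_mono (S _)) in h. lia.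
  - apply (tri_mono (S _)) in h. rewrite tri_S in h. lia.
Qed.

Lemma diag_c n : diag n = c2 n + c1 n.
Proof. rewrite <- (cp_c n) at 1. apply diag_cp. Qed.

Lemma c2_diag n : c2 n = n - tri (diag n).
Proof. rewrite diag_c. generalize (cp_tri (c1 n) (c2 n)). rewrite cp_c. intros E. rewrite E at 2. lia. Qed.

Lemma c1_diag n : c1 n = diag n - c2 n.
Proof. rewrite diag_c. lia. Qed.

Lemma pc1_c2 : pc1 c2.
Proof.
  apply (pc_ext (fun v => nth 0 v 0 - tri (diag (nth 0 v 0)))).
  - apply (pc_app2 Nat.sub); [apply pc2_sub|apply pc_var|]. apply (pc_app1 tri); [apply pc1_tri|].
    apply pc1_diag.
  - intros v. simpl. symmetry. apply c2_diag.
Qed.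

Lemma pc1_c1 : pc1 c1.
Proof.
  apply (pc_ext (fun v => diag (nth 0 v 0) - c2 (nth 0 v 0))).
  - apply (pc_app2 Nat.sub); [apply pc2_sub|apply pc1_diag|apply pc1_c2].
  - intros v. symmetry. apply c1_diag.
Qed.

Create HintDb pc.
#[global] Hint Resolve pc_var pc_const pc1_pred pc1_c1 pc1_c2 pc2_cp pc2_add pc2_sub pc2_neqb
  pc3_ifz : pc.
Ltac pc_tac := repeat lazymatch goal with
  | |- pc (fun v => nth ?i v 0) => apply pc_var
  | |- pc (fun _ => ?c) => apply pc_const
  | |- pc (fun v => S (@?F v)) => apply (pc_S F)
  | |- pc (fun v => ?f (@?A v) (@?B v) (@?C v)) =>
      apply (pc_app3 f A B C); [solve [auto with pc nocore]| | |]
  | |- pc (fun v => ?f (@?A v) (@?B v)) => apply (pc_app2 f A B); [solve [auto with pc nocore]| |]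
  | |- pc (fun v => ?f (@?A v)) => apply (pc_app1 f A); [solve [auto with pc nocore]|]
  end.

(** * List operations on codes *)

Definition nhd (x : nat) := c1 (pred x).
Definition ntl (x : nat) := c2 (pred x).
Definition ncons (a l : nat) := S (cp a l).

Lemma nhd_cons a l : nhd (lenc (a :: l)) = a.
Proof. unfold nhd; simpl. apply c1_cp. Qed.
Lemma ntl_lenc l : ntl (lenc l) = lenc (tl l).
Proof. destruct l; unfold ntl; simpl; [reflexivity|]. apply c2_cp. Qed.
Lemma lenc_cons a l : lenc (a :: l) = ncons a (lenc l).
Proof. reflexivity. Qed.

Lemma pc1_nhd : pc1 nhd. Proof. unfold nhd, pc1. pc_tac. Qed.
Lemma pc1_ntl : pc1 ntl. Proof. unfold ntl, pc1. pc_tac. Qed.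
Lemma pc2_ncons : pc2 ncons. Proof. unfold ncons, pc2. pc_tac. Qed.
#[global] Hint Resolve pc1_nhd pc1_ntl pc2_ncons : pc.

(* One step of reversing the list [c1 p] onto the list [c2 p], applying [g j] to the
   elements. *)
Definition rmstep (g : nat -> nat -> nat) (j p : nat) :=
  ifz (c1 p) p (cp (ntl (c1 p)) (ncons (g j (nhd (c1 p))) (c2 p))).
(** The code [x] itself serves as the number of steps, since it bounds the length of the list
    ([lenc_length]); surplus steps leave the pair unchanged. *)
Definition rmap (g : nat -> nat -> nat) (j x acc : nat) :=
  c2 (nat_rect (fun _ => nat) (cp x acc) (fun _ p => rmstep g j p) x).

Lemma pc3_rmap g : pc2 g -> pc3 (rmap g).
Proof.
  intros hg. unfold rmap, pc3. apply (pc_app1 c2); auto with pc.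
  apply (pc_rec _ _ (fun v => rmstep g (nth 2 v 0) (nth 1 v 0))); unfold rmstep; pc_tac.
Qed.

Lemma lenc_length l : length l <= lenc l.
Proof.
  induction l as [|a l IH]; simpl; auto. generalize (cp_le a (lenc l)). lia.
Qed.

Lemma rmap_spec g j l acc :
  rmap g j (lenc l) (lenc acc) = lenc (rev (map (g j) l) ++ acc).
Proof.
  unfold rmap.
  assert (X : forall n, length l <= n ->
    nat_rect (fun _ => nat) (cp (lenc l) (lenc acc)) (fun _ p => rmstep g j p) n
     = cp 0 (lenc (rev (map (g j) l) ++ acc))).
  { intros n. revert acc n. induction l as [|a l IH]; intros acc n h.
    - clear h. induction n as [|n IH]; [reflexivity|]. cbn [nat_rect]. rewrite IH.
      unfold rmstep. now rewrite c1_cp.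
    - destruct n as [|n]; [simpl in h; lia|]. simpl in h.
      (* [nat_rect] unfolds at its last step, whereas the list is consumed from the first one; [Y]
         splits off the first step. *)
      assert (Y : forall x, nat_rect (fun _ => nat) x (fun _ p => rmstep g j p) (S n)
        = nat_rect (fun _ => nat) (rmstep g j x) (fun _ p => rmstep g j p) n).
      { intros x. clear. induction n as [|n IH]; [reflexivity|]. cbn [nat_rect] in *. now rewrite IH. }
      rewrite Y. unfold rmstep at 1. rewrite c1_cp, c2_cp, nhd_cons, ntl_lenc.
      rewrite <- lenc_cons. change (tl (a :: l)) with l. match goal with |- context [ifz (lenc (a :: l)) ?p ?q] => change (ifz (lenc (a :: l)) p q) with q end.
      rewrite IH by lia.
      simpl rev. now rewrite <- app_assoc. }
  rewrite X by apply lenc_length. apply c2_cp.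
Qed.

Definition napp (x y : nat) := rmap (fun _ a => a) 0 (rmap (fun _ a => a) 0 x 0) y.
Definition nmap (j x : nat) := rmap (fun _ a => a) 0 (rmap cp j x 0) 0.
Definition npow (w n : nat) := nat_rect (fun _ => nat) 0 (fun _ r => napp w r) n.
Definition nnth (l i : nat) := nhd (nat_rect (fun _ => nat) l (fun _ r => ntl r) i).

Lemma pc3_rev : pc3 (rmap (fun _ a => a)).
Proof. apply pc3_rmap. apply pc_var. Qed.
Lemma pc3_rmapcp : pc3 (rmap cp).
Proof. apply pc3_rmap, pc2_cp. Qed.
#[global] Hint Resolve pc3_rev pc3_rmapcp : pc.
Lemma pc2_napp : pc2 napp. Proof. unfold napp, pc2. pc_tac. Qed.
Lemma pc2_nmap : pc2 nmap. Proof. unfold nmap, pc2. pc_tac. Qed.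
#[global] Hint Resolve pc2_napp pc2_nmap : pc.
Lemma pc2_npow : pc2 npow.
Proof.
  unfold npow, pc2. apply (pc_rec _ (fun _ => 0) (fun v => napp (nth 2 v 0) (nth 1 v 0))); pc_tac.
Qed.
Lemma pc2_nnth : pc2 nnth.
Proof.
  unfold nnth, pc2. apply (pc_app1 nhd); auto with pc. apply (pc_iter1 ntl); auto with pc.
Qed.
#[global] Hint Resolve pc2_npow pc2_nnth : pc.

Lemma napp_spec x y : napp (lenc x) (lenc y) = lenc (x ++ y).
Proof.
  unfold napp. change (rmap (fun _ a => a) 0 (lenc x) 0) with (rmap (fun _ a => a) 0 (lenc x) (lenc [])).
  now rewrite !rmap_spec, app_nil_r, !map_id, rev_involutive.
Qed.

Lemma nmap_spec j x : nmap j (lenc x) = lenc (map (cp j) x).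
Proof.
  unfold nmap. change (rmap cp j (lenc x) 0) with (rmap cp j (lenc x) (lenc [])).
  rewrite rmap_spec.
  match goal with |- rmap ?g 0 ?x 0 = _ => change (rmap g 0 x 0) with (rmap g 0 x (lenc [])) end.
  rewrite rmap_spec. now rewrite !app_nil_r, !map_id, rev_involutive.
Qed.

Lemma npow_spec w n : npow (lenc w) n = lenc (lpow w n).
Proof. induction n as [|n IH]; simpl; auto. unfold npow in *; simpl. now rewrite IH, napp_spec. Qed.

Lemma nnth_spec l i : nnth (lenc l) i = nth i l 0.
Proof.
  unfold nnth. assert (X : nat_rect (fun _ => nat) (lenc l) (fun _ r => ntl r) i = lenc (skipn i l)).
  { induction i as [|i IH]; simpl; [reflexivity|]. rewrite IH, ntl_lenc. f_equal.
    clear. revert l; induction i as [|i IH]; intros [|a l]; try reflexivity.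
    simpl skipn. rewrite <- IH. now destruct l. }
  rewrite X. assert (Y := nth_skipn i l 0). rewrite Nat.add_0_r in Y. rewrite <- Y.
  destruct (skipn i l); [reflexivity|]. apply nhd_cons.
Qed.

(* The least set containing [0] and closed under [g o] for all [o] is the range of a
   computable function. *)
Section Enumeration.
Variable g : nat -> nat -> nat -> nat.
Hypothesis pcg : pc3 g.

(** The number [m] codes an operation and two earlier indices. The history lists the values newest
    first, so after step [m] the value with index [i] is at position [m - i]. *)
Definition histstep (m h : nat) : nat :=
  ncons (g (c1 m) (nnth h (m - c1 (c2 m))) (nnth h (m - c2 (c2 m)))) h.
Definition hist (m : nat) : nat := nat_rect (fun _ => nat) (ncons 0 0) histstep m.
Definition enum (m : nat) : nat := nhd (hist m).

Lemma pc1_enum : pc1 enum.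
Proof.
  unfold enum, pc1. apply (pc_app1 nhd); auto with pc. unfold hist.
  apply (pc_rec _ (fun _ => ncons 0 0) (fun v => histstep (nth 0 v 0) (nth 1 v 0)));
    unfold histstep; pc_tac.

Qed.

Lemma hist_spec m : hist m = lenc (map enum (rev (seq 0 (S m)))).
Proof.
  induction m as [|m IH]; [cbn [seq rev app map]; change (enum 0) with (nhd (lenc [0])); now rewrite nhd_cons|].
  rewrite seq_S, rev_app_distr. simpl rev at 1. rewrite map_app. cbn [map app]. rewrite lenc_cons, <- IH.
  unfold enum. replace (nhd (hist (S m))) with
    (g (c1 m) (nnth (hist m) (m - c1 (c2 m))) (nnth (hist m) (m - c2 (c2 m)))); [reflexivity|].
  change (hist (S m)) with (histstep m (hist m)). unfold histstep. rewrite IH, <- lenc_cons.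
  now rewrite nhd_cons.
Qed.

Lemma hist_nth m i : i <= m -> nnth (hist m) (m - i) = enum i.
Proof.
  intros h. rewrite hist_spec, nnth_spec. rewrite (nth_indep _ 0 (enum 0)).
  2:{ rewrite length_map, length_rev, length_seq. lia. }
  rewrite map_nth, rev_nth by (rewrite length_seq; lia).
  rewrite length_seq, seq_nth by lia. f_equal. lia.
Qed.

Lemma enum_0 : enum 0 = 0.
Proof. change (enum 0) with (nhd (lenc [0])). apply nhd_cons. Qed.

Lemma c_le m : c1 m <= m /\ c2 m <= m.
Proof. generalize (cp_le (c1 m) (c2 m)). rewrite cp_c. lia. Qed.

Lemma enum_S m : enum (S m) = g (c1 m) (enum (c1 (c2 m))) (enum (c2 (c2 m))).
Proof.
  unfold enum at 1. change (hist (S m)) with (histstep m (hist m)). unfold histstep.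
  assert (h := c_le m). assert (h' := c_le (c2 m)).
  rewrite !hist_nth by lia. unfold ncons, nhd. simpl. apply c1_cp.
Qed.

Lemma enum_closed o x y : exists m, enum m = g o (enum x) (enum y).
Proof. exists (S (cp o (cp x y))). rewrite enum_S, c2_cp, !c1_cp, c2_cp. reflexivity. Qed.

Lemma enum_ind (P : nat -> Prop) : P 0 -> (forall o x y, P x -> P y -> P (g o x y)) ->
  forall m, P (enum m).
Proof.
  intros h0 h m. induction m as [[|m] IH] using lt_wf_ind; [now rewrite enum_0|].
  assert (a := c_le m). assert (b := c_le (c2 m)). rewrite enum_S. apply h; apply IH; lia.
Qed.
End Enumeration.

(** * Enumerating the trivial words *)

(** The automatically generated principle has no induction hypothesis for the programs in the list
    of a [PComp]. *)
Fixpoint prog_nested_ind (P : prog -> Prop) (h0 : P PZero) (h1 : P PSucc)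
  (h2 : forall i, P (PProj i)) (h3 : forall f gs, P f -> Forall P gs -> P (PComp f gs))
  (h4 : forall f g, P f -> P g -> P (PRec f g)) (h5 : forall f, P f -> P (PMu f))
  (p : prog) : P p :=
  let rec := prog_nested_ind P h0 h1 h2 h3 h4 h5 in
  match p with
  | PZero => h0
  | PSucc => h1
  | PProj i => h2 i
  | PComp f gs => h3 f gs (rec f)
      ((fix all gs : Forall P gs :=
          match gs with
          | [] => Forall_nil P
          | g :: gs' => Forall_cons g (rec g) (all gs')
          end) gs)
  | PRec f g => h4 f g (rec f) (rec g)
  | PMu f => h5 f (rec f)
  end.

(* [F (k :: v)] evaluates [p] on [v] with time bound [k]: it is [S y] if the value [y] is
   found and [0] otherwise. The extra elements [rest] must not matter. *)
Definition bounded_eval (p : prog) (l : nat) (F : list nat -> nat) :=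
  pc F /\ forall v, length v = l ->
  (forall k rest y, F (k :: v ++ rest) = S y -> eval p v y) /\
  (forall y, eval p v y -> exists K, forall k rest, K <= k -> F (k :: v ++ rest) = S y).

Lemma ifz_S c a b y : ifz c a b = y -> (c = 0 /\ a = y) \/ (exists c', c = S c' /\ b = y).
Proof. destruct c; simpl; eauto. Qed.

(** The last function is bound first; each earlier one must then skip the values already put in
    front of the environment. *)
Lemma pc_lets Gs Phi : Forall pc Gs -> pc Phi ->
  pc (fun v => Phi (map (fun G => G v) Gs ++ v)).
Proof.
  intros h. revert Phi. induction h as [|G Gs hG _ IH]; intros Phi hPhi; [exact hPhi|].
  apply pc_ext with (fun v => (fun w => Phi (G (skipn (length Gs) w) :: w))
                       (map (fun G => G v) Gs ++ v)).
  - apply (IH (fun w => Phi (G (skipn (length Gs) w) :: w))).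
    apply (pc_let Phi (fun w => G (skipn (length Gs) w))); auto. now apply pc_skip.
  - intros v. simpl. do 3 f_equal. rewrite skipn_app, length_map, Nat.sub_diag, skipn_all2; auto.
    rewrite length_map; auto.
Qed.

Fixpoint close (d : nat) (e : ex) : ex :=
  match e with
  | EV i => if i <? d then EV i else EZ
  | EZ => EZ
  | ES e => ES (close d e)
  | ELet e1 e2 => ELet (close d e1) (close (S d) e2)
  | ERec e b s => ERec (close d e) (close d b) (close (S (S d)) s)
  end.

Lemma den_close e : forall d v, den (close d e) v = den e (firstn d v).
Proof.
  induction e as [i| |e IH|e1 IH1 e2 IH2|e IHe b IHb s IHs]; intros d v; simpl.
  - rewrite nth_firstn. now destruct (i <? d).
  - reflexivity.
  - now rewrite IH.
  - now rewrite IH1, IH2.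
  - rewrite IHe, IHb. induction (den e (firstn d v)) as [|n IH]; simpl; auto. now rewrite IHs, IH.
Qed.

(** A [pc] function may read its whole environment; truncation makes it a function of its first [d]
    arguments, as [pc2] demands. *)
Lemma pc_firstn d F : pc F -> pc (fun v => F (firstn d v)).
Proof. intros [e E]. exists (close d e). intros v. now rewrite <- E, den_close. Qed.

Fixpoint nzall (m : nat) (u : list nat) : nat :=
  match m with 0 => 1 | S m' => ifz (nth m' u 0) 0 (nzall m' u) end.

Lemma pc_nzall m : pc (nzall m).
Proof.
  induction m as [|m IH]; [apply pc_const|].
  apply (pc_app3 ifz (fun u => nth m u 0) (fun _ => 0) (nzall m)); auto with pc.
Qed.

Lemma nzall_spec m u : nzall m u <> 0 <-> forall i, i < m -> nth i u 0 <> 0.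
Proof.
  induction m as [|m IH]; simpl; [split; intros; lia|].
  destruct (nth m u 0) as [|c] eqn:E; simpl.
  - split; [lia|]. intros h. exfalso. apply (h m); [lia|exact E].
  - rewrite IH. split; intros h i hi; [|apply h; lia].
    destruct (Nat.eq_dec i m) as [->|]; [lia|apply h; lia].
Qed.

Lemma map_nth_pred es rest :
  map (fun H => H (es ++ rest)) (map (fun i (u : list nat) => pred (nth i u 0)) (seq 0 (length es)))
  = map pred es.
Proof.
  rewrite map_map. revert rest. induction es as [|e es IH] using rev_ind; intros rest; auto.
  rewrite length_app, Nat.add_1_r, seq_S, !map_app, <- app_assoc, IH. f_equal. simpl.
  f_equal. now rewrite nth_middle.
Qed.

Lemma bounded_eval_comp f gs l : (forall l, exists F, bounded_eval f l F) ->
  Forall (fun g => forall l, exists F, bounded_eval g l F) gs ->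
  exists F, bounded_eval (PComp f gs) l F.
Proof.
  intros hf hgs. destruct (hf (length gs)) as [Ff [pf sf]].
  assert (X : exists Fs, Forall2 (fun g F => bounded_eval g l F) gs Fs).
  { clear - hgs. induction hgs as [|g gs hg _ [Fs hFs]]; [now exists []|].
    destruct (hg l) as [F hF]. exists (F :: Fs). now constructor. }
  destruct X as [Fs hFs]. set (m := length gs) in *.
  (* The environment for [Ff], rebuilt behind the [m] results: the time bound, now at index [m],
     then each result with its successor removed. *)
  set (Hs := (fun u : list nat => nth m u 0) ::
             map (fun i (u : list nat) => pred (nth i u 0)) (seq 0 m)).
  exists (fun v => (fun u => ifz (nzall m u) 0 (Ff (map (fun H => H u) Hs ++ u)))
                     (map (fun G => G v) Fs ++ v)).
  assert (lFs : length Fs = m) by (symmetry; exact (Forall2_length hFs)).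
  split.
  { apply (pc_lets Fs (fun u => ifz (nzall m u) 0 (Ff (map (fun H => H u) Hs ++ u)))).
    - clear - hFs. induction hFs as [|? ? ? ? [h _]]; constructor; auto.
    - apply (pc_app3 ifz); auto with pc; [apply pc_nzall|]. apply pc_lets; auto.
      constructor; [apply pc_var|]. apply Forall_forall. intros H hH.
      apply in_map_iff in hH as [i [<- _]]. apply pc_app1; auto with pc. }
  assert (key : forall env, map (fun H => H (map (fun G => G env) Fs ++ env)) Hs =
            nth 0 env 0 :: map pred (map (fun G => G env) Fs)).
  { intros env. unfold Hs. cbn [map]. f_equal.
    - rewrite app_nth2; rewrite length_map, lFs; [f_equal; lia|lia].
    - rewrite <- lFs. rewrite <- (length_map (fun G => G env) Fs). apply map_nth_pred. }
  intros v lv. split.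
  - intros k rest y E. cbv beta in E. rewrite key in E. apply ifz_S in E as [[_ E]|[c [E1 E2]]]; [discriminate|].
    assert (nz : forall i, i < m -> nth i (map (fun G => G (k :: v ++ rest)) Fs) 0 <> 0).
    { assert (h : nzall m (map (fun G => G (k :: v ++ rest)) Fs ++ k :: v ++ rest) <> 0) by lia.
      intros i hi. rewrite nzall_spec in h. specialize (h i hi).
      rewrite app_nth1 in h; auto. rewrite length_map; lia. }
    simpl nth in E2. cbn [app] in E2.
    apply ev_comp with (map pred (map (fun G => G (k :: v ++ rest)) Fs)).
    + clear - hFs nz lv lFs m. subst m. clear lFs. induction hFs as [|g F gs Fs hF _ IH]; [constructor|].
      simpl. constructor.
      * destruct hF as [_ h]. destruct (h v lv) as [s _]. apply (s k rest).
        specialize (nz 0 ltac:(simpl; lia)). simpl in nz. lia.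
      * apply IH. intros i hi. apply (nz (S i)). simpl; lia.
    + destruct (sf (map pred (map (fun G => G (k :: v ++ rest)) Fs))) as [s _].
      { now rewrite !length_map. } eapply s. exact E2.
  - intros y E. inversion E as [| | |f' gs' v' ws y' Egs Ef| | |]; subst.
    assert (lw : length ws = m).
    { clear - Egs m. subst m. induction Egs; simpl; auto. }
    destruct (sf ws lw) as [_ cf]. destruct (cf y Ef) as [K1 H1].
    assert (X : exists K, forall k rest, K <= k -> map (fun G => G (k :: v ++ rest)) Fs = map S ws).
    { clear - hFs Egs. revert Fs hFs. induction Egs as [v|g gs v w ws Eg _ IH]; intros Fs hFs.
      - inversion hFs. now exists 0.
      - inversion hFs as [|? F ? Fs' hF hFs']; subst. destruct (IH _ hFs') as [K HK].
        destruct hF as [_ h]. destruct (h v eq_refl) as [_ c]. destruct (c w Eg) as [K' HK'].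
        exists (K + K'). intros k rest hk. simpl. rewrite HK by lia. now rewrite HK' by lia. }
    destruct X as [K HK]. exists (K + K1). intros k rest hk. cbv beta. rewrite key, HK by lia.
    rewrite map_map. simpl map. rewrite map_id. cbn [app nth].
    destruct (nzall m _) eqn:Z.
    + exfalso. revert Z. change (nzall m (map S ws ++ k :: v ++ rest) <> 0). apply nzall_spec.
      intros i hi. rewrite app_nth1 by (rewrite length_map; lia).
      rewrite (nth_indep _ 0 (S 0)) by (rewrite length_map; lia). rewrite map_nth. lia.
    + simpl. apply H1. lia.
Qed.

Lemma bounded_eval_rec f g l : (forall l, exists F, bounded_eval f l F) ->
  (forall l, exists F, bounded_eval g l F) -> exists F, bounded_eval (PRec f g) l F.
Proof.
  intros hf hg. destruct l as [|l].
  { exists (fun _ => 0). split; [apply pc_const|]. intros v lv. destruct v; [|discriminate].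
    split; [discriminate|]. intros y E. inversion E. }
  destruct (hf l) as [Ff [pf sf]], (hg (S (S l))) as [Fg [pg sg]].
  (* Here [u] consists of the counter, the previous result, the bound, the recursion argument and
     the parameters. Behind the unpacked result the bound has index 3 and the parameters start at
     index 5. *)
  set (St := fun u => ifz (nth 1 u 0) 0 ((fun w => Fg (nth 3 w 0 :: nth 1 w 0 :: nth 0 w 0 :: skipn 5 w))
                      (pred (nth 1 u 0) :: u))).
  exists (fun v => nat_rect (fun _ => nat) (Ff (nth 0 v 0 :: skipn 2 v))
                     (fun i r => St (i :: r :: v)) (nth 1 v 0)).
  split.
  { apply pc_rec; [apply pc_var| |].
    - apply (pc_ren Ff (fun i => match i with 0 => 0 | S j => 2 + j end)); auto.
      intros v [|i]; simpl nth; auto. apply (nth_skipn 2).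
    - apply (pc_app3 ifz); auto with pc.
      apply (pc_let (fun w => Fg (nth 3 w 0 :: nth 1 w 0 :: nth 0 w 0 :: skipn 5 w))); pc_tac.
      apply (pc_ren Fg (fun i => match i with 0 => 3 | 1 => 1 | 2 => 0 | S (S (S j)) => 5 + j end)); auto.
      intros v [|[|[|i]]]; cbn [nth]; auto. apply nth_skipn. }
  intros v lv. destruct v as [|n v]; [discriminate|]. injection lv as lv.
  assert (step : forall k rest i r n0, St (i :: r :: k :: n0 :: v ++ rest) =
    ifz r 0 (Fg (k :: i :: pred r :: v ++ rest))) by reflexivity.
  clearbody St. split.
  - intros k rest. cbn [nth app skipn]. revert n.
    (* The environment keeps the original recursion argument [n0] while the induction runs over the
       counter [n]. *)
    assert (X : forall n0 n y, nat_rect (fun _ => nat) (Ff (k :: v ++ rest))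
       (fun i r => St (i :: r :: k :: n0 :: v ++ rest)) n = S y -> eval (PRec f g) (n :: v) y).
    { intros n0 n; induction n as [|n IH]; intros y E; simpl in E.
      - constructor. destruct (sf v lv) as [s _]. eapply s, E.
      - rewrite step in E. apply ifz_S in E as [[_ E]|[r [E1 E2]]]; [discriminate|].
        apply IH in E1 as E3.
        apply ev_recS with r; auto. destruct (sg (n :: r :: v)) as [s _]; [simpl; auto|].
        apply (s k rest). rewrite E1 in E2. exact E2. }
    intros n y. apply X.
  - cbn [nth app skipn].
    assert (X : forall n y, eval (PRec f g) (n :: v) y -> exists K, forall k rest n0, K <= k ->
       nat_rect (fun _ => nat) (Ff (k :: v ++ rest))
       (fun i r => St (i :: r :: k :: n0 :: v ++ rest)) n = S y).
    { clear n. induction n as [|n IH]; intros y E.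
      - inversion E as [| | | |? ? ? ? E'| |]; subst. destruct (sf v eq_refl) as [_ c].
        destruct (c y E') as [K HK]. exists K. intros; simpl; auto.
      - inversion E as [| | | | |? ? ? ? r ? E1 E2|]; subst. destruct (IH r E1) as [K1 H1].
        destruct (sg (n :: r :: v)) as [_ c]; [simpl; auto|]. destruct (c y E2) as [K2 H2].
        exists (K1 + K2). intros k rest n0 hk. cbn [nat_rect]. rewrite H1 by lia.
        rewrite step. apply (H2 k rest). lia. }
    intros y E. destruct (X n y E) as [K HK]. exists K. intros; now apply HK.
Qed.

Lemma bounded_eval_mu f l : (forall l, exists F, bounded_eval f l F) ->
  exists F, bounded_eval (PMu f) l F.
Proof.
  intros hf. destruct (hf (S l)) as [Ff [pf sf]].
  (* search state: 0 = still searching, 1 = stuck, [S (S y)] = found [y] *)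
  set (St := fun u => ifz (nth 1 u 0)
     ((fun w => ifz (nth 0 w 0) 1 (ifz (pred (nth 0 w 0)) (S (S (nth 1 w 0))) 0))
        ((fun x => Ff (nth 2 x 0 :: nth 0 x 0 :: skipn 3 x)) u :: u)) (nth 1 u 0)).
  set (Sr := fun v => nat_rect (fun _ => nat) 0 (fun i r => St (i :: r :: v))).
  exists (fun v => pred (Sr v (nth 0 v 0))).
  split.
  { apply (pc_app1 pred); auto with pc. apply (pc_rec _ (fun _ => 0) St); pc_tac.
    apply (pc_app3 ifz); auto with pc.
    apply (pc_let (fun w => ifz (nth 0 w 0) 1 (ifz (pred (nth 0 w 0)) (S (S (nth 1 w 0))) 0))); pc_tac.
    apply (pc_ren Ff (fun i => match i with 0 => 2 | 1 => 0 | S (S j) => 3 + j end)); auto.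
    intros v [|[|i]]; cbn [nth]; auto. apply nth_skipn. }
  intros v lv.
  assert (step : forall k rest i r, St (i :: r :: k :: v ++ rest) =
    ifz r (ifz (Ff (k :: i :: v ++ rest)) 1 (ifz (pred (Ff (k :: i :: v ++ rest))) (S (S i)) 0)) r)
    by reflexivity.
  clearbody St.
  assert (stay : forall k rest n r d, Sr (k :: v ++ rest) n = S r -> Sr (k :: v ++ rest) (d + n) = S r).
  { intros k rest n r d E. induction d as [|d IH]; auto. simpl. unfold Sr in *; simpl.
    now rewrite step, IH. }
  split.
  - intros k rest y E. cbn [nth] in E.
    assert (X : forall n, (Sr (k :: v ++ rest) n = 0 ->
                 forall m, m < n -> exists z, eval f (m :: v) (S z)) /\
              (forall y, Sr (k :: v ++ rest) n = S (S y) -> eval (PMu f) v y)).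
    { clear y E. induction n as [|n [IH1 IH2]]; [split; [lia|discriminate]|].
      unfold Sr; simpl. rewrite step. fold (Sr (k :: v ++ rest)). fold (Sr (k :: v ++ rest) n).
      destruct (sf (n :: v)) as [s _]; [simpl; auto|]. specialize (s k rest). simpl app in s.
      destruct (Sr (k :: v ++ rest) n) as [|r]; simpl; [|split; [discriminate|auto]].
      destruct (Ff (k :: n :: v ++ rest)) as [|[|t]]; simpl.
      - split; discriminate.
      - split; [discriminate|]. intros y E. injection E as <-. constructor; auto.
      - split; [|discriminate]. intros _ m hm. destruct (Nat.eq_dec m n) as [->|]; eauto.
        apply IH1; auto; lia. }
    apply (proj2 (X k)). destruct (Sr (k :: v ++ rest) k) as [|[|]]; simpl in *; congruence.
  - intros y E. inversion E as [| | | | | |? ? ? E0 E1]; subst.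
    assert (X : forall n, n <= y -> exists K, forall k rest, K <= k -> Sr (k :: v ++ rest) n = 0).
    { induction n as [|n IH]; intros hn; [now exists 0|]. destruct IH as [K1 H1]; [lia|].
      destruct (E1 n hn) as [z Ez]. destruct (sf (n :: v)) as [_ c]; [simpl; auto|].
      destruct (c _ Ez) as [K2 H2]. exists (K1 + K2). intros k rest hk.
      unfold Sr; simpl. rewrite step. fold (Sr (k :: v ++ rest)). fold (Sr (k :: v ++ rest) n).
      rewrite H1 by lia. specialize (H2 k rest ltac:(lia)). simpl app in H2. now rewrite H2. }
    destruct (X y (le_n y)) as [K1 H1]. destruct (sf (y :: v)) as [_ c]; [simpl; auto|].
    (* The bound is also the number of search steps, so it has to reach [S y] besides being large
       enough for the evaluations. *)
    destruct (c _ E0) as [K2 H2]. exists (K1 + K2 + S y). intros k rest hk. cbn [nth].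
    replace (Sr (k :: v ++ rest) k) with (S (S y)); auto. symmetry.
    replace k with ((k - S y) + S y) at 2 by lia. apply stay.
    unfold Sr; simpl. rewrite step. fold (Sr (k :: v ++ rest)). fold (Sr (k :: v ++ rest) y).
    rewrite H1 by lia. specialize (H2 k rest ltac:(lia)). simpl app in H2. now rewrite H2.
Qed.

Lemma bounded_eval_exists p : forall l, exists F, bounded_eval p l F.
Proof.
  induction p as [| |i|f gs IHf IHgs|f g IHf IHg|f IHf] using prog_nested_ind; intros l.
  - exists (fun _ => 1). split; [apply pc_const|]. intros v lv. split.
    + intros k rest y E. injection E as <-. constructor.
    + intros y E. inversion E; subst. now exists 0.
  - destruct l as [|l].
    + exists (fun _ => 0). split; [apply pc_const|]. intros [|x v] lv; [|discriminate].
      split; [discriminate|]. intros y E; inversion E.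
    + exists (fun v => S (S (nth 1 v 0))). split; [pc_tac|]. intros [|x v] lv; [discriminate|].
      split.
      * intros k rest y E. simpl in E. injection E as <-. constructor.
      * intros y E. inversion E; subst. now exists 0.
  - destruct (lt_dec i l) as [h|h].
    + exists (fun v => S (nth (S i) v 0)). split; [pc_tac|]. intros v lv. simpl nth. split.
      * intros k rest y E. rewrite app_nth1 in E by lia. injection E as <-. constructor. lia.
      * intros y E. inversion E; subst. exists 0. intros. now rewrite app_nth1.
    + exists (fun _ => 0). split; [apply pc_const|]. intros v lv. split; [discriminate|].
      intros y E; inversion E; lia.
  - now apply bounded_eval_comp.
  - now apply bounded_eval_rec.
  - now apply bounded_eval_mu.
Qed.

(** An integer of absolute value [n > 0] has code [2 * n] or [2 * n - 1]. Both are tried with the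
    same bound, and the sum of the two answers is nonzero when one of them is. *)
Lemma absset_search A : re_set A -> exists chk, pc2 chk /\
  forall n, 0 < n -> ((exists z, A z /\ Z.abs_nat z = n) <-> exists k, chk k n <> 0).
Proof.
  intros [p hp]. destruct (bounded_eval_exists p 1) as [F [pF sF]].
  set (G := fun k m => F [k; m]).
  assert (pG : pc2 G).
  { apply (pc_let (fun v => F (firstn 2 (nth 1 v 0 :: v))) (fun v => nth 1 v 0)); auto with pc.
    apply (pc_let (fun v => F (firstn 2 v)) (fun v => nth 1 v 0)); auto with pc.
    now apply pc_firstn. }
  assert (X : forall m, (exists y, eval p [m] y) <-> exists k, G k m <> 0).
  { intros m. destruct (sF [m] eq_refl) as [s c]. split.
    - intros [y Ey]. destruct (c y Ey) as [K HK]. exists K. unfold G.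
      specialize (HK K [] (le_n K)). simpl in HK. lia.
    - intros [k Hk]. unfold G in Hk. destruct (F [k; m]) as [|y] eqn:E; [easy|].
      exists y. apply (s k []). exact E. }
  exists (fun k n => G k (n + n) + G k (pred (n + n))). split.
  { unfold pc2. apply (pc_app2 Nat.add); auto with pc; apply (pc_app2 G); auto; pc_tac. }
  intros n n0. split.
  - intros [z [Az Ez]]. apply hp, X in Az as [k Hk]. exists k. unfold encZ in Hk.
    destruct (Z.leb_spec 0 z).
    + replace (Z.to_nat (2 * z)) with (n + n) in Hk by lia. lia.
    + replace (Z.to_nat (- 2 * z - 1)) with (pred (n + n)) in Hk by lia. lia.
  - intros [k Hk]. assert (H : G k (n + n) <> 0 \/ G k (pred (n + n)) <> 0) by lia.
    destruct H as [H|H].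
    + exists (Z.of_nat n). split; [|lia]. apply hp, X. exists k. unfold encZ.
      destruct (Z.leb_spec 0 (Z.of_nat n)); [|lia].
      now replace (Z.to_nat (2 * Z.of_nat n)) with (n + n) by lia.
    + exists (- Z.of_nat n)%Z. split; [|lia]. apply hp, X. exists k. unfold encZ.
      destruct (Z.leb_spec 0 (- Z.of_nat n)); [lia|].
      now replace (Z.to_nat (- 2 * - Z.of_nat n - 1)) with (pred (n + n)) by lia.
Qed.

Section Rules.
Variables (T : nat -> Prop) (chk : nat -> nat -> nat).
Hypothesis pchk : pc2 chk.
Hypothesis Tchk : forall n, 0 < n -> (T n <-> exists k, chk k n <> 0).

(** The constructors of [Ntriv] as operations on codes [x], [y] of words already known to be
    trivial; [c1 o] selects the constructor. When a side condition fails the value is 0, the code of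
    the empty word, which is trivial anyway. For [N_root], [c1 q] is the exponent and [c2 q] the
    bound for checking that it is allowed. *)
Definition rule (o x y : nat) : nat :=
  let p := c1 (c2 o) in let q := c2 (c2 o) in
  ifz (c1 o) (ncons (cp p (q + q)) (ncons (cp p (S (q + q))) 0))
 (ifz (c1 o - 1) (nmap p (nnth p q))
 (ifz (c1 o - 2) (napp x y)
 (ifz (c1 o - 3) (ifz x 0 (napp (ntl x) (ncons (nhd x) 0)))
 (ifz (c1 o - 4) (ifz (neqb y (napp x p)) p 0)
 (ifz (c1 q) 0 (ifz (neqb x (npow p (c1 q))) (ifz (chk (c2 q) (c1 q)) 0 p) 0)))))).

Lemma pc3_rule : pc3 rule.
Proof. unfold rule, pc3. cbv zeta. pc_tac. Qed.

Lemma rule_sound m : exists w, Ntriv T w /\ enum rule m = lenc w.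
Proof.
  apply (enum_ind rule (fun c => exists w, Ntriv T w /\ c = lenc w)).
  - exists []; split; auto. apply N_nil.
  - assert (N0 : exists w, Ntriv T w /\ 0 = lenc w) by (exists []; split; [apply N_nil|auto]).
    intros o x y [u [Nu ->]] [v [Nv ->]]. unfold rule. cbv zeta.
    set (p := c1 (c2 o)). set (q := c2 (c2 o)).
    generalize (c1 o) as t. intros [|[|[|[|[|t]]]]]; cbn [Nat.sub ifz].
    { exists [cp p (2 * q); cp p (S (2 * q))]. split; [apply N_inv|].
      replace (q + q) with (2 * q) by lia. reflexivity. }
    { destruct (lenc_surj p) as [L E].
      assert (HL : exists L', L = map lenc L').
      { clear. induction L as [|a L [L' ->]]; [now exists []|].
        destruct (lenc_surj a) as [w <-]. now exists (w :: L'). }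
      destruct HL as [L' ->]. rewrite <- E, nnth_spec.
      rewrite (map_nth lenc L' [] q : nth q (map lenc L') 0 = _), nmap_spec.
      eexists; split; [|reflexivity].
      destruct (nth_in_or_default q L' []) as [h| ->]; [now apply N_rel|apply N_nil]. }
    { exists (u ++ v). split; [now apply N_app|apply napp_spec]. }
    { destruct u as [|a u]; [exact N0|]. exists (u ++ [a]). split; [now apply N_rot|].
      rewrite ntl_lenc, nhd_cons, <- napp_spec. reflexivity. }
    { destruct (lenc_surj p) as [z <-]. rewrite napp_spec.
      destruct (neqb _ _) eqn:E; simpl; auto. apply (proj1 (neqb_0 _ _)) in E.
      apply lenc_inj in E. subst v. exists z. split; auto. now apply N_strip with u. }
    destruct (c1 q) as [|k] eqn:Eq; cbn [ifz]; auto.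
    destruct (lenc_surj p) as [z <-]. rewrite npow_spec.
    destruct (neqb _ _) eqn:E; simpl; auto. apply (proj1 (neqb_0 _ _)) in E.
    destruct (chk _ _) eqn:Ec; simpl; auto.
    apply lenc_inj in E. subst u. exists z. split; auto. apply N_root with (S k); auto; [|lia].
    apply Tchk; [lia|]. exists (c2 q). lia.
Qed.

Lemma rule_complete w : Ntriv T w -> exists m, enum rule m = lenc w.
Proof.
  assert (N0 : exists m, enum rule m = 0) by (exists 0; apply enum_0).
  assert (cl := enum_closed rule).
  induction 1 as [|j i|L w h|x y _ [m1 E1] _ [m2 E2]|a u _ [m E]|x z _ [m1 E1] _ [m2 E2]
    |w n Tn n0 _ [m E]]; auto.
  - destruct (cl (cp 0 (cp j i)) 0 0) as [m E]. exists m. rewrite E. unfold rule.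
    rewrite !c2_cp, !c1_cp. cbn [Nat.sub ifz]. now replace (i + i) with (2 * i) by lia.
  - apply (In_nth _ _ []) in h as [q [_ h]].
    destruct (cl (cp 1 (cp (lenc (map lenc L)) q)) 0 0) as [m E]. exists m. rewrite E. unfold rule.
    rewrite !c2_cp, !c1_cp. cbn [Nat.sub ifz].
    now rewrite nnth_spec, (map_nth lenc L [] q : nth q (map lenc L) 0 = _), nmap_spec, h.
  - destruct (cl (cp 2 (cp 0 0)) m1 m2) as [m E]. exists m. rewrite E, E1, E2. unfold rule.
    rewrite !c2_cp, !c1_cp. cbn [Nat.sub ifz]. apply napp_spec.
  - destruct (cl (cp 3 (cp 0 0)) m m) as [m' E']. exists m'. rewrite E', E. unfold rule.
    rewrite !c2_cp, !c1_cp. cbn [Nat.sub ifz]. rewrite ntl_lenc, nhd_cons.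
    change (ncons a 0) with (lenc [a]). now rewrite napp_spec.
  - destruct (cl (cp 4 (cp (lenc z) 0)) m1 m2) as [m E]. exists m. rewrite E, E1, E2. unfold rule.
    rewrite !c2_cp, !c1_cp. cbn [Nat.sub ifz]. rewrite napp_spec.
    now rewrite (proj2 (neqb_0 _ _) eq_refl).
  - apply Tchk in Tn as [k Hk]; auto.
    destruct (cl (cp 5 (cp (lenc w) (cp n k))) m m) as [m' E']. exists m'. rewrite E', E. unfold rule.
    rewrite !c2_cp, !c1_cp. cbn [Nat.sub ifz]. rewrite npow_spec.
    rewrite (proj2 (neqb_0 _ _) eq_refl). destruct n; [lia|]. cbn [ifz].
    destruct (chk k (S n)); [easy|reflexivity].
Qed.
End Rules.

Theorem Ntriv_enumerable A T : re_set A ->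
  (forall n, T n <-> exists z, A z /\ Z.abs_nat z = n) ->
  exists E, pc1 E /\ E 0 = 0 /\ (forall m, exists w, Ntriv T w /\ E m = lenc w) /\
    (forall w, Ntriv T w -> exists m, E m = lenc w).
Proof.
  intros hA hT. destruct (absset_search A hA) as [chk [pchk Hchk]].
  assert (Tchk : forall n, 0 < n -> (T n <-> exists k, chk k n <> 0)).
  { intros n h. rewrite hT. now apply Hchk. }
  exists (enum (rule chk)). split; [|split; [|split]].
  - apply pc1_enum, pc3_rule, pchk.
  - apply enum_0.
  - now apply rule_sound.
  - now apply rule_complete.
Qed.

(** * A register machine with output *)

(* [Loop r c] is [while r > 0 do (r := r - 1; c)]; [Asrt r] blocks unless [r = 0]. *)
Inductive cmd : Type :=
| Nop | Inc (r : nat) | Emit (a : letter) | Asrt (r : nat)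
| Sq (c d : cmd) | Loop (r : nat) (c : cmd).

Definition st := nat -> nat.
Definition upd (s : st) (r x : nat) : st := fun r' => if r' =? r then x else s r'.

Inductive mstep : list cmd -> st -> word -> list cmd -> st -> Prop :=
| ms_nop k s : mstep (Nop :: k) s [] k s
| ms_inc r k s : mstep (Inc r :: k) s [] k (upd s r (S (s r)))
| ms_emit a k s : mstep (Emit a :: k) s [a] k s
| ms_asrt r k s : s r = 0 -> mstep (Asrt r :: k) s [] k s
| ms_sq c d k s : mstep (Sq c d :: k) s [] (c :: d :: k) s
| ms_loop0 r c k s : s r = 0 -> mstep (Loop r c :: k) s [] k s
| ms_loopS r c k s n : s r = S n -> mstep (Loop r c :: k) s [] (c :: Loop r c :: k) (upd s r n).

Inductive msteps : list cmd -> st -> word -> list cmd -> st -> Prop :=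
| mss_refl k s : msteps k s [] k s
| mss_step k s o k1 s1 o' k2 s2 :
    mstep k s o k1 s1 -> msteps k1 s1 o' k2 s2 -> msteps k s (o ++ o') k2 s2.

Lemma mstep_det k s o1 k1 s1 o2 k2 s2 :
  mstep k s o1 k1 s1 -> mstep k s o2 k2 s2 -> o1 = o2 /\ k1 = k2 /\ s1 = s2.
Proof.
  intros h1 h2. destruct h1; inversion h2; subst; try (repeat split; congruence).
Qed.

(** Steps are deterministic and the empty continuation admits none, so a complete run is determined
    by its start. *)
Lemma msteps_end s0 k s o o' :
  msteps k s o [] s0 -> msteps k s o' [] s0 -> o = o'.
Proof.
  intros h. remember [] as ke eqn:Ek. revert o' Ek. induction h as [k s|k s o1 k1 s1 o2 k2 s2 h h' IH]; intros o' -> h2.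
  - inversion h2 as [|? ? ? ? ? ? ? ? X]; subst; auto. inversion X.
  - inversion h2 as [|? ? ? ? ? ? ? ? X Y]; subst; [inversion h|].
    destruct (mstep_det _ _ _ _ _ _ _ _ h X) as [-> [-> ->]]. f_equal. auto.
Qed.

Lemma msteps_trans k s o k1 s1 o' k2 s2 :
  msteps k s o k1 s1 -> msteps k1 s1 o' k2 s2 -> msteps k s (o ++ o') k2 s2.
Proof.
  induction 1; auto. intros h. rewrite <- app_assoc. econstructor; eauto.
Qed.

(** The continuation is arbitrary, which is what lets runs be put in sequence. *)
Definition run (c : cmd) (s : st) (o : word) (s' : st) := forall k, msteps (c :: k) s o k s'.

Lemma mstep_run c s o s' : (forall k, mstep (c :: k) s o k s') -> run c s o s'.
Proof. intros h k. rewrite <- (app_nil_r o). econstructor; [apply h|constructor]. Qed.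

Lemma run_sq c d s o s1 o' s2 : run c s o s1 -> run d s1 o' s2 -> run (Sq c d) s (o ++ o') s2.
Proof.
  intros h h' k. change (o ++ o') with ([] ++ o ++ o'). econstructor; [constructor|].
  eapply msteps_trans; [apply h|apply h'].
Qed.

Lemma run_sq0 c d s s1 o' s2 : run c s [] s1 -> run d s1 o' s2 -> run (Sq c d) s o' s2.
Proof. apply (run_sq c d s []). Qed.

Lemma run_nop s : run Nop s [] s.
Proof. apply mstep_run; intros; constructor. Qed.
Lemma run_inc r s : run (Inc r) s [] (upd s r (S (s r))).
Proof. apply mstep_run; intros; constructor. Qed.
Lemma run_loop0 r c s : s r = 0 -> run (Loop r c) s [] s.
Proof. intros; apply mstep_run; intros; now constructor. Qed.
Lemma run_loopS r c s n o s1 o' s2 : s r = S n -> run c (upd s r n) o s1 ->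
  run (Loop r c) s1 o' s2 -> run (Loop r c) s (o ++ o') s2.
Proof.
  intros E h h' k. change (o ++ o') with ([] ++ o ++ o'). econstructor; [constructor; exact E|].
  eapply msteps_trans; [apply h|apply h'].
Qed.

Lemma run_eq c s o s' s'' : run c s o s' -> (forall x, s' x = s'' x) -> run c s o s''.
Proof. intros h E. now replace s'' with s' by now apply functional_extensionality. Qed.

Lemma run_eq' c s o s' o' s'' : run c s o s' -> o = o' -> (forall x, s' x = s'' x) -> run c s o' s''.
Proof. intros h <- E. now apply run_eq with s'. Qed.

Ltac upd := intros; unfold upd; cbv beta;
  repeat match goal with |- context [?x =? ?y] => destruct (Nat.eqb_spec x y); subst end;
  try lia; auto.

Lemma run_clear r : forall s, run (Loop r Nop) s [] (upd s r 0).
Proof.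
  intros s. remember (s r) as n eqn:E. symmetry in E. revert s E.
  induction n as [|n IH]; intros s E.
  - eapply run_eq; [now apply run_loop0|upd].
  - apply (run_loopS _ _ _ n [] (upd s r n) []); auto; [apply run_nop|].
    eapply run_eq; [apply IH; upd|upd].
Qed.

Lemma run_move r a : r <> a -> forall s, run (Loop r (Inc a)) s [] (upd (upd s r 0) a (s a + s r)).
Proof.
  intros h s. remember (s r) as n eqn:E. symmetry in E. revert s E.
  induction n as [|n IH]; intros s E.
  - eapply run_eq; [now apply run_loop0|upd].
  - eapply (run_loopS _ _ _ n [] _ []); auto; [apply run_inc|].
    eapply run_eq; [apply IH; upd|upd].
Qed.

Lemma run_move2 r a b : r <> a -> r <> b -> a <> b -> forall s,
  run (Loop r (Sq (Inc a) (Inc b))) s [] (upd (upd (upd s r 0) a (s a + s r)) b (s b + s r)).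
Proof.
  intros h1 h2 h3 s. remember (s r) as n eqn:E. symmetry in E. revert s E.
  induction n as [|n IH]; intros s E.
  - eapply run_eq; [now apply run_loop0|upd].
  - eapply (run_loopS _ _ _ n [] _ []); auto; [eapply run_sq0; apply run_inc|].
    eapply run_eq; [apply IH; upd|upd].
Qed.

Lemma run_emit_loop r a : forall s, run (Loop r (Emit a)) s (repeat a (s r)) (upd s r 0).
Proof.
  intros s. remember (s r) as n eqn:E. symmetry in E. revert s E.
  induction n as [|n IH]; intros s E.
  - eapply run_eq; [now apply run_loop0|upd].
  - apply (run_loopS _ _ _ n [a] (upd s r n) (repeat a n)); auto; [apply mstep_run; constructor|].
    eapply run_eq; [apply IH; upd|upd].
Qed.

(** * Compiling expressions *)

(** Registers are read destructively, so a variable is moved to both [n] and [S n] and then restored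
    from the latter. In a recursion [n] counts down, [S n] holds the intermediate result, [n + 2]
    counts up and [n + 3] receives the result of one step. *)
Fixpoint comp (e : ex) (env : list nat) (n : nat) : cmd :=
  match e with
  | EZ => Nop
  | EV i =>
      match nth_error env i with
      | Some r => Sq (Loop r (Sq (Inc n) (Inc (S n)))) (Loop (S n) (Inc r))
      | None => Nop
      end
  | ES e => Sq (comp e env n) (Inc n)
  | ELet e1 e2 =>
      Sq (comp e1 env n) (Sq (comp e2 (n :: env) (S n)) (Sq (Loop n Nop) (Loop (S n) (Inc n))))
  | ERec e b s =>
      Sq (comp e env n) (Sq (comp b env (S n)) (Sq
        (Loop n (Sq (comp s (n + 2 :: S n :: env) (n + 3))
           (Sq (Loop (S n) Nop) (Sq (Loop (n + 3) (Inc (S n))) (Inc (n + 2))))))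
        (Sq (Loop (n + 2) Nop) (Loop (S n) (Inc n)))))
  end.

Lemma map_upd s n x env : Forall (fun r => r < n) env -> forall m, n <= m ->
  map (upd s m x) env = map s env.
Proof. induction 1; intros; simpl; f_equal; auto. upd. Qed.

Lemma Forall_lt_weaken n m env : n <= m -> Forall (fun r => r < n) env -> Forall (fun r => r < m) env.
Proof. intros h. apply Forall_impl. intros; lia. Qed.

(* Register [n] receives the value; registers from [n] on are free. *)
Lemma run_comp e : forall env n s, Forall (fun r => r < n) env -> (forall r, n <= r -> s r = 0) ->
  run (comp e env n) s [] (upd s n (den e (map s env))).
Proof.
  induction e as [i| |e IH|e1 IH1 e2 IH2|e IHe b IHb c IHc]; intros env n s henv hs.
  - simpl. destruct (nth_error env i) as [r|] eqn:Ei.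
    + assert (hr : r < n) by (rewrite Forall_forall in henv; apply henv; eapply nth_error_In; eauto).
      assert (Ev : nth i (map s env) 0 = s r).
      { apply nth_error_nth. now rewrite nth_error_map, Ei. }
      eapply run_eq; [eapply run_sq0; [apply run_move2; lia|apply run_move; lia]|].
      rewrite Ev. assert (h1 := hs n). assert (h2 := hs (S n)). upd.
    + rewrite nth_overflow by (rewrite length_map; now apply nth_error_None).
      assert (h1 := hs n). eapply run_eq; [apply run_nop|upd; rewrite h1; lia].
  - simpl. assert (h1 := hs n). eapply run_eq; [apply run_nop|upd; rewrite h1; lia].
  - simpl. eapply run_eq; [eapply run_sq0; [apply IH; auto|apply run_inc]|upd].
  - simpl. assert (henv' := Forall_lt_weaken n (S n) _ ltac:(lia) henv).
    eapply run_eq; [eapply run_sq0; [apply IH1; auto|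
      eapply run_sq0; [apply IH2|eapply run_sq0; [apply run_clear|apply run_move; lia]]]|].
    + constructor; auto.
    + intros r hr. assert (h := hs r). upd.
    + assert (h := hs (S n)). simpl map. rewrite (map_upd s n _ env henv n) by lia.
      replace (upd s n (den e1 (map s env)) n) with (den e1 (map s env)) by upd.
      set (v := den e2 _). upd.
  - simpl. set (f := fun i => nat_rect (fun _ => nat) (den b (map s env))
             (fun i r => den c (i :: r :: map s env)) i).
    (* The registers with [t] iterations left and [i] iterations done. *)
    set (tau := fun t i => upd (upd (upd s n t) (S n) (f i)) (n + 2) i).
    assert (hz0 := hs n). assert (hz1 := hs (S n)). assert (hz2 := hs (n + 2)). assert (hz3 := hs (n + 3)).
    assert (L : forall t i, run (Loop n (Sq (comp c (n + 2 :: S n :: env) (n + 3))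
           (Sq (Loop (S n) Nop) (Sq (Loop (n + 3) (Inc (S n))) (Inc (n + 2)))))) (tau t i) []
           (tau 0 (i + t))).
    { induction t as [|t IHt]; intros i.
      - rewrite Nat.add_0_r. apply run_loop0. unfold tau. upd.
      - replace (i + S t) with (S i + t) by lia.
        apply (run_loopS _ _ _ t [] (tau t (S i)) []); auto; [unfold tau; upd|].
        replace (upd (tau (S t) i) n t) with (tau t i)
          by (apply functional_extensionality; unfold tau; upd).
        eapply run_eq; [eapply run_sq0; [apply IHc|eapply run_sq0; [apply run_clear|
          eapply run_sq0; [apply run_move; lia|apply run_inc]]]|].
        + constructor; [lia|constructor; [lia|]]. apply (Forall_lt_weaken n); auto; lia.
        + intros r hr. assert (h := hs r). unfold tau. upd.
        + assert (Ht : map (tau t i) env = map s env)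
            by (unfold tau; now rewrite !(map_upd _ n _ env henv) by lia).
          cbn [map]. rewrite Ht.
          replace (tau t i (n + 2)) with i by (unfold tau; upd).
          replace (tau t i (S n)) with (f i) by (unfold tau; upd).
          change (den c (i :: f i :: map s env)) with (f (S i)).
          intros x. unfold tau. assert (hx := hs x). generalize (f (S i)) (f i). intros fa fb. upd. }
    eapply run_eq; [eapply run_sq0; [apply IHe; auto|eapply run_sq0; [apply IHb|
      eapply run_sq0; [|eapply run_sq0; [apply run_clear|apply run_move; lia]]]]|].
    + apply (Forall_lt_weaken n); auto.
    + intros r hr. assert (h := hs r). upd.
    + rewrite !(map_upd _ n _ env henv) by lia. change (den b (map s env)) with (f 0).
      eapply run_eq' with (o := []); [|reflexivity|intros; reflexivity].
      replace (upd (upd s n (den e (map s env))) (S n) (f 0)) with (tau (den e (map s env)) 0).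
      * apply L.
      * apply functional_extensionality; unfold tau; upd.
    + intros x. unfold tau. simpl. fold f. change (f (den e (map s env))) with (f (0 + den e (map s env))).
      set (v := f _). assert (hx := hs x). clearbody v. upd.
Qed.

(* The letters 0, 1, 2 stand for [a], [y], [s]; [spell k] is [a_k^-1 s^-1 a_k s] with
   [a_k = y^-k a y^k]. *)
Definition spell (k : nat) : word :=
  repeat (1, false) k ++ [(0, false)] ++ repeat (1, true) k ++ [(2, false)] ++
  repeat (1, false) k ++ [(0, true)] ++ repeat (1, true) k ++ [(2, true)].

Lemma run_emit a s : run (Emit a) s [a] s.
Proof. apply mstep_run; constructor. Qed.

(** [spell k] needs [k] four times, so register 2 is copied to register 3 and only the copy is
    consumed. *)
Definition emit_pow (a : letter) : cmd := Sq (comp (EV 0) [2] 3) (Loop 3 (Emit a)).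

Lemma run_emit_pow a s : (forall r, 3 <= r -> s r = 0) -> run (emit_pow a) s (repeat a (s 2)) s.
Proof.
  intros hs. eapply run_eq'; [eapply run_sq; [apply run_comp; [repeat constructor|exact hs]|
    apply run_emit_loop]|reflexivity|].
  assert (h := hs 3). intros x; upd; rewrite h; lia.
Qed.

Definition emit_spell : cmd :=
  Sq (emit_pow (1, false)) (Sq (Emit (0, false)) (Sq (emit_pow (1, true)) (Sq (Emit (2, false))
 (Sq (emit_pow (1, false)) (Sq (Emit (0, true)) (Sq (emit_pow (1, true)) (Emit (2, true)))))))).

Lemma run_emit_spell s : (forall r, 3 <= r -> s r = 0) -> run emit_spell s (spell (s 2)) s.
Proof.
  intros hs. unfold emit_spell, spell.
  repeat (eapply run_sq; [first [apply run_emit|now apply run_emit_pow]|]). apply run_emit.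
Qed.

Lemma pc1_comp f : pc1 f -> exists e, forall r n s, r < n -> (forall r, n <= r -> s r = 0) ->
  run (comp e [r] n) s [] (upd s n (f (s r))).
Proof.
  intros [e E]. exists e. intros r n s hr hs.
  replace (f (s r)) with (den e (map s [r])) by apply E. apply run_comp; auto.
Qed.

(** The input is erased at the end so that all runs share one final state, which [output_comm]
    depends on. *)
Theorem emitter E : pc1 E -> exists p, forall m w, E m = lenc w ->
  run p (upd (fun _ => 0) 0 m) (flat_map spell w) (fun _ => 0).
Proof.
  intros hE. destruct (pc1_comp _ hE) as [eE HE], (pc1_comp _ pc1_c1) as [e1 H1],
    (pc1_comp _ pc1_c2) as [e2 H2].
  (* Register 1 holds the code of the letters still to be spelled. Entering the loop decrements it,
     which turns the code [S (cp k (lenc w))] of a nonempty list into the pair of its head and tail;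
     the head goes to register 2, the tail back to register 1. *)
  set (body := Sq (comp e1 [1] 2) (Sq (comp e2 [1] 3) (Sq (Loop 1 Nop) (Sq (Loop 3 (Inc 1))
                 (Sq emit_spell (Loop 2 Nop)))))).
  assert (L : forall m w, run (Loop 1 body) (upd (upd (fun _ => 0) 0 m) 1 (lenc w))
                (flat_map spell w) (upd (fun _ => 0) 0 m)).
  { intros m w. induction w as [|k w IH].
    - eapply run_eq; [apply run_loop0; reflexivity|upd].
    - simpl flat_map. eapply run_loopS; [reflexivity| |exact IH]. unfold body.
      rewrite <- (app_nil_r (spell k)). set (s := upd _ _ _).
      assert (s1 : s 1 = cp k (lenc w)) by reflexivity.
      assert (s0 : s 0 = m) by reflexivity.
      assert (sr : forall r, 2 <= r -> s r = 0) by (intros [|[|r]] ?; [lia|lia|reflexivity]).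
      clearbody s.
      eapply run_eq.
      + eapply run_sq0; [apply H1; auto|]. rewrite s1, c1_cp.
        eapply run_sq0; [apply H2; [lia|intros r hr; assert (h := sr r); upd]|].
        replace (upd s 2 k 1) with (s 1) by upd. rewrite s1, c2_cp.
        eapply run_sq0; [apply run_clear|]. eapply run_sq0; [apply run_move; lia|].
        set (s' := upd _ _ _). replace k with (s' 2) at 2 by reflexivity.
        eapply run_sq; [apply run_emit_spell|apply run_clear].
        intros r hr. unfold s'. assert (h := sr r). upd.
      + intros x. generalize (lenc w). intros z. assert (h := sr x). upd. }
  exists (Sq (comp eE [0] 1) (Sq (Loop 1 body) (Loop 0 Nop))). intros m w Em.
  rewrite <- (app_nil_r (flat_map spell w)).
  eapply run_eq.
  - eapply run_sq0; [apply HE; [lia|intros [|r] hr; [lia|reflexivity]]|].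
    replace (upd (fun _ => 0) 0 m 0) with m by reflexivity. rewrite Em.
    eapply run_sq; [apply L|apply run_clear].
  - upd.
Qed.

(** * Transition rules of the machine *)

Inductive op : Type := OInc (r : nat) | ODec (r : nat) | OZero (r : nat) | OEmit (a : letter) | ONop.

Inductive opstep : op -> st -> word -> st -> Prop :=
| os_inc r s : opstep (OInc r) s [] (upd s r (S (s r)))
| os_dec r s n : s r = S n -> opstep (ODec r) s [] (upd s r n)
| os_zero r s : s r = 0 -> opstep (OZero r) s [] s
| os_emit a s : opstep (OEmit a) s [a] s
| os_nop s : opstep ONop s [] s.

Definition mrule := (list cmd * op * list cmd)%type.

(** Only finitely many continuations occur in the runs of a command, as a loop puts itself back
    below its body. Continuations can therefore serve as the states of a finite machine. *)
Fixpoint crules (c : cmd) (k : list cmd) : list mrule :=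
  match c with
  | Nop => [(c :: k, ONop, k)]
  | Inc r => [(c :: k, OInc r, k)]
  | Emit a => [(c :: k, OEmit a, k)]
  | Asrt r => [(c :: k, OZero r, k)]
  | Sq c1 c2 => (c :: k, ONop, c1 :: c2 :: k) :: crules c1 (c2 :: k) ++ crules c2 k
  | Loop r c1 => (c :: k, OZero r, k) :: (c :: k, ODec r, c1 :: c :: k) :: crules c1 (c :: k)
  end.

Fixpoint krules (k : list cmd) : list mrule :=
  match k with [] => [] | c :: k' => crules c k' ++ krules k' end.

(** The inclusion keeps a whole run within the rules of its first continuation. *)
Lemma krules_step k s o k' s' : mstep k s o k' s' ->
  exists p, In (k, p, k') (krules k) /\ opstep p s o s' /\ incl (krules k') (krules k).
Proof.
  intros h.
  assert (X : exists p, In (k, p, k') (krules k) /\ opstep p s o s').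
  { destruct h; cbn [krules crules app]; eexists.
    - split; [left; reflexivity|apply os_nop].
    - split; [left; reflexivity|apply os_inc].
    - split; [left; reflexivity|apply os_emit].
    - split; [left; reflexivity|now apply os_zero].
    - split; [left; reflexivity|apply os_nop].
    - split; [left; reflexivity|now apply os_zero].
    - split; [right; left; reflexivity|now apply os_dec]. }
  destruct X as [p [X1 X2]]. exists p. repeat split; auto. clear - h.
  destruct h; intros x hx; simpl in *;
    repeat (rewrite in_app_iff in * || simpl in *); tauto.
Qed.

Lemma crules_mstep c : forall k k1 p k2 s o s', In (k1, p, k2) (crules c k) -> opstep p s o s' ->
  mstep k1 s o k2 s'.
Proof.
  induction c as [|r|a|r|c1 IH1 c2 IH2|r c1 IH1]; intros k k1 p k2 s o s' h hp; simpl in h.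
  - destruct h as [[= <- <- <-]|[]]. inversion hp; constructor.
  - destruct h as [[= <- <- <-]|[]]. inversion hp; constructor.
  - destruct h as [[= <- <- <-]|[]]. inversion hp; constructor.
  - destruct h as [[= <- <- <-]|[]]. inversion hp; subst; now constructor.
  - destruct h as [[= <- <- <-]|h]; [inversion hp; constructor|].
    apply in_app_iff in h as [h|h]; eauto.
  - destruct h as [[= <- <- <-]|[[= <- <- <-]|h]]; [inversion hp; subst; now constructor..|eauto].
Qed.

Lemma krules_mstep k k1 p k2 s o s' : In (k1, p, k2) (krules k) -> opstep p s o s' ->
  mstep k1 s o k2 s'.
Proof.
  induction k as [|c k IH]; simpl; [tauto|]. intros h hp. apply in_app_iff in h as [h|h]; auto.
  eapply crules_mstep; eauto.
Qed.

Fixpoint ccode (c : cmd) : nat :=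
  match c with
  | Nop => cp 0 0
  | Inc r => cp 1 r
  | Emit a => cp 2 (cp (fst a) (if snd a then 1 else 0))
  | Asrt r => cp 3 r
  | Sq c d => cp 4 (cp (ccode c) (ccode d))
  | Loop r c => cp 5 (cp r (ccode c))
  end.

Lemma cp_inj a b a' b' : cp a b = cp a' b' -> a = a' /\ b = b'.
Proof.
  intros h. split; [rewrite <- (c1_cp a b), h; apply c1_cp|rewrite <- (c2_cp a b), h; apply c2_cp].
Qed.

Lemma ccode_inj c : forall d, ccode c = ccode d -> c = d.
Proof.
  induction c as [|r|[i x]|r|c1 IH1 c2 IH2|r c1 IH1]; intros [|r'|[i' x']|r'|d1 d2|r' d1] h;
    simpl in h; apply cp_inj in h as [h0 h]; try discriminate; try congruence.
  - apply cp_inj in h as [-> h]. destruct x, x'; congruence.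
  - apply cp_inj in h as [h1 h2]. f_equal; auto.
  - apply cp_inj in h as [h1 h2]. f_equal; auto.
Qed.

Definition kcode (k : list cmd) : nat := lenc (map ccode k).

Lemma kcode_inj k k' : kcode k = kcode k' -> k = k'.
Proof.
  intros h. apply lenc_inj in h. revert k' h. induction k as [|c k IH]; intros [|d k'] h; try discriminate; auto.
  injection h as h1 h2. apply ccode_inj in h1. f_equal; auto.
Qed.

(** * Groups *)

Record group := Group {
  car :> Type;
  mul : car -> car -> car;
  one : car;
  inv : car -> car;
  mulA : forall x y z, mul (mul x y) z = mul x (mul y z);
  mul1g : forall x, mul one x = x;
  mulVg : forall x, mul (inv x) x = one }.
Arguments mul {g} : simpl never. Arguments one {g} : simpl never.
Arguments inv {g} : simpl never.
Declare Scope grp_scope.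
Delimit Scope grp_scope with G.
Notation "x * y" := (mul x y) : grp_scope.
Notation "1" := one : grp_scope.
Notation "x ^-1" := (inv x) (at level 3, left associativity, format "x ^-1") : grp_scope.
Open Scope grp_scope.

Lemma mulKg (G : group) (x y : G) : x^-1 * (x * y) = y.
Proof. now rewrite <- mulA, mulVg, mul1g. Qed.

Lemma mulgV (G : group) (x : G) : x * x^-1 = 1.
Proof.
  rewrite <- (mulKg G x^-1 (x * x^-1)). now rewrite (mulKg G x), mulVg.
Qed.

Lemma mulg1 (G : group) (x : G) : x * 1 = x.
Proof. now rewrite <- (mulVg G x), <- mulA, mulgV, mul1g. Qed.

Lemma mulKVg (G : group) (x y : G) : x * (x^-1 * y) = y.
Proof. now rewrite <- mulA, mulgV, mul1g. Qed.

Lemma mulgI (G : group) (x y z : G) : x * y = x * z -> y = z.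
Proof. intros E. now rewrite <- (mulKg G x y), E, mulKg. Qed.

Lemma mulIg (G : group) (x y z : G) : y * x = z * x -> y = z.
Proof.
  intros E. rewrite <- (mulg1 G y), <- (mulg1 G z), <- (mulgV G x), <- !mulA.
  now rewrite E.
Qed.

Lemma invgK (G : group) (x : G) : x^-1^-1 = x.
Proof. apply (mulgI G x^-1). now rewrite mulgV, mulVg. Qed.

Lemma invg1 (G : group) : 1^-1 = 1 :> G.
Proof. apply (mulgI G 1). now rewrite mulgV, mul1g. Qed.

Lemma invMg (G : group) (x y : G) : (x * y)^-1 = y^-1 * x^-1.
Proof.
  apply (mulgI G (x * y)). rewrite mulgV, mulA, (mulKVg G y), mulgV. reflexivity.
Qed.

#[global] Hint Rewrite mulA mul1g mulg1 mulVg mulgV mulKg mulKVg invgK invg1 invMg : grp.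
Ltac grp := autorewrite with grp; try reflexivity.

Lemma eq_divg1 (G : group) (x y : G) : x * y^-1 = 1 -> x = y.
Proof. intros E. apply (mulIg G y^-1). now rewrite mulgV. Qed.

Definition comm {G : group} (x y : G) := x * y = y * x.

Lemma comm_inv (G : group) (x y : G) : comm x y -> comm x^-1 y.
Proof.
  unfold comm; intros E. apply (mulgI G x). rewrite mulKVg, <- mulA, E. grp.
Qed.

Lemma comm_sym (G : group) (x y : G) : comm x y -> comm y x.
Proof. unfold comm; congruence. Qed.

Lemma comm_mul (G : group) (x y z : G) : comm x z -> comm y z -> comm (x * y) z.
Proof. unfold comm; intros E1 E2. now rewrite mulA, E2, <- mulA, E1, mulA. Qed.

Lemma comm_one (G : group) (z : G) : comm 1 z.
Proof. unfold comm; now grp. Qed.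

Definition conj {G : group} (x y : G) := y^-1 * (x * y).
Notation "x ^ y" := (conj x y) : grp_scope.

Lemma conj_mul (G : group) (x y z : G) : (x * y) ^ z = x ^ z * y ^ z.
Proof. unfold conj; now grp. Qed.

Lemma conj_inv (G : group) (x z : G) : (x^-1) ^ z = (x ^ z)^-1.
Proof. unfold conj; now grp. Qed.

Lemma conj_one (G : group) (z : G) : 1 ^ z = 1.
Proof. unfold conj; now grp. Qed.

Lemma conj_conj (G : group) (x y z : G) : (x ^ y) ^ z = x ^ (y * z).
Proof. unfold conj; now grp. Qed.

Lemma conjg1 (G : group) (x : G) : x ^ 1 = x.
Proof. unfold conj; now grp. Qed.

Lemma conj_comm (G : group) (x y : G) : comm x y -> x ^ y = x.
Proof. unfold conj, comm; intros E. rewrite E. now grp. Qed.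

Definition ghom {G H : group} (f : G -> H) := forall x y, f (x * y) = f x * f y.

Lemma ghom1 (G H : group) (f : G -> H) : ghom f -> f 1 = 1.
Proof. intros Hf. apply (mulgI H (f 1)). rewrite <- Hf. now grp. Qed.

Lemma ghomV (G H : group) (f : G -> H) (x : G) : ghom f -> f x^-1 = (f x)^-1.
Proof.
  intros Hf. apply (mulgI H (f x)). rewrite <- Hf, !mulgV. now apply ghom1.
Qed.

Lemma ghomJ (G H : group) (f : G -> H) (x y : G) : ghom f -> f (x ^ y) = f x ^ f y.
Proof. intros Hf. unfold conj. now rewrite !Hf, ghomV. Qed.

Fixpoint gpow {G : group} (x : G) (n : nat) : G :=
  match n with 0 => 1 | S k => x * gpow x k end.

Lemma ghomX (G H : group) (f : G -> H) (x : G) n : ghom f -> f (gpow x n) = gpow (f x) n.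
Proof.
  intros Hf; induction n; simpl; [now apply ghom1|]. now rewrite Hf, IHn.
Qed.

Lemma gpow_conj (G : group) (x y : G) n : gpow (x ^ y) n = (gpow x n) ^ y.
Proof.
  induction n; simpl; [now rewrite conj_one|]. now rewrite IHn, conj_mul.
Qed.

Lemma comm_gpow (G : group) (x y : G) n : comm x y -> comm (gpow x n) y.
Proof.
  intros E; induction n; simpl; [apply comm_one|now apply comm_mul].
Qed.

Lemma gpow_inv (G : group) (x : G) n : gpow x^-1 n = (gpow x n)^-1.
Proof.
  induction n; simpl; [now grp|]. rewrite IHn, <- invMg. f_equal.
  symmetry. apply comm_sym, comm_gpow. reflexivity.
Qed.

Definition tfree (T : nat -> Prop) (G : group) :=
  forall (x : G) n, T n -> 0 < n -> gpow x n = 1 -> x = 1.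

Definition prodg (G H : group) : group.
Proof.
  refine (Group (G * H)%type (fun a b => (fst a * fst b, snd a * snd b)) (1, 1)
            (fun a => ((fst a)^-1, (snd a)^-1)) _ _ _).
  - intros [] [] []; simpl; now grp.
  - intros []; simpl; now grp.
  - intros []; simpl; now grp.
Defined.

Lemma gpow_prod (G H : group) (x : prodg G H) n :
  gpow x n = (gpow (fst x) n, gpow (snd x) n).
Proof. induction n; simpl; [reflexivity|]. rewrite IHn. reflexivity. Qed.

Lemma tfree_prod T (G H : group) : tfree T G -> tfree T H -> tfree T (prodg G H).
Proof.
  intros TG TH [x y] n Tn n0 E. rewrite gpow_prod in E. injection E as E1 E2.
  now rewrite (TG x n), (TH y n).
Qed.

Section SubgroupOfProduct.
Variables G H : group.

(** A homomorphism defined on a subgroup is handled through its graph, a subgroup of the product;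
    being well defined then means that 1 is related to 1 only ([subrel_fun]). *)
Definition subrel (R : G -> H -> Prop) :=
  R 1 1 /\ (forall a b c d, R a b -> R c d -> R (a * c) (b * d)) /\
  (forall a b, R a b -> R a^-1 b^-1).

Inductive pgen (P : G -> H -> Prop) : G -> H -> Prop :=
| pg_in a b : P a b -> pgen P a b
| pg_1 : pgen P 1 1
| pg_mul a b c d : pgen P a b -> pgen P c d -> pgen P (a * c) (b * d)
| pg_inv a b : pgen P a b -> pgen P a^-1 b^-1.

Lemma subrel_pgen P : subrel (pgen P).
Proof. repeat split; [apply pg_1|intros; now apply pg_mul|intros; now apply pg_inv]. Qed.

Lemma pgen_min P (R : G -> H -> Prop) :
  subrel R -> (forall a b, P a b -> R a b) -> forall a b, pgen P a b -> R a b.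
Proof.
  intros [R1 [RM RV]] PR a b; induction 1; auto.
Qed.

Lemma subrel_fun R : subrel R -> (forall b, R 1 b -> b = 1) ->
  forall a b b', R a b -> R a b' -> b = b'.
Proof.
  intros [R1 [RM RV]] inj a b b' r r'. apply eq_divg1, inj.
  rewrite <- (mulgV G a). now apply RM; [|apply RV].
Qed.
End SubgroupOfProduct.
Arguments subrel {G H}. Arguments pgen {G H}.
Arguments subrel_fun {G H}.

Lemma pgen_conj (G H : group) (f : G -> H) (t : H) (P : G -> G -> Prop) : ghom f ->
  (forall a b, P a b -> (f a) ^ t = f b) -> forall a b, pgen P a b -> (f a) ^ t = f b.
Proof.
  intros hf hP. apply (pgen_min _ _ _ (fun a b => (f a) ^ t = f b)); auto. split; [|split].
  - rewrite ghom1 by auto. apply conj_one.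
  - intros a b c d E1 E2. now rewrite !hf, conj_mul, E1, E2.
  - intros a b E. now rewrite !ghomV, conj_inv, E by auto.
Qed.

Lemma ghom_pair (G H K : group) (f : G -> K) (h : H -> K) : ghom f -> ghom h ->
  (forall x y, comm (f x) (h y)) -> ghom (fun a : prodg G H => f (fst a) * h (snd a)).
Proof.
  intros hf hh C [x1 y1] [x2 y2]. 
  change (f (x1 * x2) * h (y1 * y2) = f x1 * h y1 * (f x2 * h y2)). rewrite hf, hh, !mulA. f_equal.
  rewrite <- !mulA. f_equal. apply C.
Qed.

(** * Quotients by a congruence *)

Section Quotient.
Variables (W : Type) (E : W -> W -> Prop) (m : W -> W -> W) (e : W) (i : W -> W).
Hypothesis Erefl : forall x, E x x.
Hypothesis Esym : forall x y, E x y -> E y x.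
Hypothesis Etrans : forall x y z, E x y -> E y z -> E x z.
Hypothesis Em : forall x x' y y', E x x' -> E y y' -> E (m x y) (m x' y').
Hypothesis Ei : forall x x', E x x' -> E (i x) (i x').
Hypothesis EA : forall x y z, E (m (m x y) z) (m x (m y z)).
Hypothesis E1 : forall x, E (m e x) x.
Hypothesis EV : forall x, E (m (i x) x) e.

(** Classes are predicates, so equivalent elements have equal classes by extensionality and the
    group laws are genuine equations. *)
Definition qcar := {P : W -> Prop | exists w, P = E w}.
Definition qcls0 (w : W) : qcar := exist _ (E w) (ex_intro _ w eq_refl).
Definition qrep (q : qcar) : W :=
  proj1_sig (constructive_indefinite_description _ (proj2_sig q)).

Lemma qrepK q : qcls0 (qrep q) = q.
Proof.
  unfold qrep. destruct q as [P HP]; simpl.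
  destruct (constructive_indefinite_description _ HP) as [w Hw]; simpl.
  unfold qcls0. subst P. f_equal. apply proof_irrelevance.
Qed.

Lemma qcls0_eq w w' : E w w' -> qcls0 w = qcls0 w'.
Proof.
  intros H. assert (X : E w = E w').
  { apply functional_extensionality; intros x. apply propositional_extensionality.
    split; eauto. }
  unfold qcls0. revert X. generalize (ex_intro (fun w0 => E w = E w0) w eq_refl).
  generalize (ex_intro (fun w0 => E w' = E w0) w' eq_refl).
  intros p p' X. revert p'. rewrite X. intros p'. f_equal. apply proof_irrelevance.
Qed.

Lemma qcls0_inj w w' : qcls0 w = qcls0 w' -> E w w'.
Proof. intros H. injection H as H. rewrite H. apply Erefl. Qed.

Lemma qrep_cls w : E (qrep (qcls0 w)) w.
Proof. apply qcls0_inj, qrepK. Qed.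

Definition quotg : group.
Proof.
  refine (Group qcar (fun x y => qcls0 (m (qrep x) (qrep y))) (qcls0 e)
            (fun x => qcls0 (i (qrep x))) _ _ _).
  - intros x y z. apply qcls0_eq.
    apply Etrans with (m (m (qrep x) (qrep y)) (qrep z)); [now apply Em; [apply qrep_cls|]|].
    eapply Etrans; [apply EA|]. apply Em; [apply Erefl|]. apply Esym, qrep_cls.
  - intros x. rewrite <- (qrepK x) at 2. apply qcls0_eq.
    apply Etrans with (m e (qrep x)); [|apply E1]. apply Em; [apply qrep_cls|apply Erefl].
  - intros x. apply qcls0_eq.
    apply Etrans with (m (i (qrep x)) (qrep x)); [|apply EV].
    apply Em; [apply qrep_cls|apply Erefl].
Defined.

Definition qcls (w : W) : quotg := qcls0 w.

Lemma qcls_eq w w' : E w w' -> qcls w = qcls w'.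
Proof. exact (qcls0_eq w w'). Qed.

Lemma qcls_inj w w' : qcls w = qcls w' -> E w w'.
Proof. exact (qcls0_inj w w'). Qed.

Lemma qcls_surj (q : quotg) : exists w, q = qcls w.
Proof. exists (qrep q). symmetry; apply qrepK. Qed.

Lemma qcls_mul w w' : qcls (m w w') = qcls w * qcls w'.
Proof. apply qcls0_eq. apply Em; apply Esym, qrep_cls. Qed.

Lemma qcls_inv w : qcls (i w) = (qcls w)^-1.
Proof. apply qcls0_eq. apply Ei; apply Esym, qrep_cls. Qed.

Section Lift.
Variables (H : group) (f : W -> H).
Hypothesis fE : forall w w', E w w' -> f w = f w'.
Hypothesis fm : forall w w', f (m w w') = f w * f w'.

Definition qlift (q : quotg) : H := f (qrep q).

Lemma qlift_cls w : qlift (qcls w) = f w.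
Proof. apply fE, qrep_cls. Qed.

Lemma qlift_hom : ghom qlift.
Proof.
  intros x y. destruct (qcls_surj x) as [w ->], (qcls_surj y) as [w' ->].
  rewrite <- qcls_mul, !qlift_cls. apply fm.
Qed.
End Lift.
End Quotient.

(** * HNN extensions *)

Section HNN.
Variables (B : group) (I : Type) (R : I -> B -> B -> Prop).

(* [R i] is an isomorphism between two subgroups of [B], and [t_i^-1 b t_i = b']
   when [R i b b']. *)
Definition assoc_ok := forall i, subrel (R i) /\
  (forall b, R i 1 b -> b = 1) /\ (forall b, R i b 1 -> b = 1).
Hypothesis Rok : assoc_ok.

Definition lett := (I * bool)%type.
Definition opp (l : lett) : lett := (fst l, negb (snd l)).

Lemma oppK l : opp (opp l) = l.
Proof. destruct l as [i []]; reflexivity. Qed.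

Lemma opp_neq l : l <> opp l.
Proof. destruct l as [i []]; discriminate. Qed.

(* [pass l a a'] means [t a = a' t] for the letter [t = t_l]. *)
Definition pass (l : lett) (a a' : B) : Prop :=
  if snd l then R (fst l) a' a else R (fst l) a a'.
Definition dom (l : lett) (a : B) := exists a', pass l a a'.

Lemma pass_opp l a a' : pass l a a' -> pass (opp l) a' a.
Proof. destruct l as [i []]; exact (fun h => h). Qed.

Lemma pass1 l : pass l 1 1.
Proof. destruct l as [i []]; destruct (Rok i) as [[h _] _]; exact h. Qed.

Lemma passM l a a' b b' : pass l a a' -> pass l b b' -> pass l (a * b) (a' * b').
Proof. destruct l as [i []]; destruct (Rok i) as [[_ [h _]] _]; unfold pass; simpl; auto. Qed.

Lemma passV l a a' : pass l a a' -> pass l a^-1 a'^-1.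
Proof. destruct l as [i []]; destruct (Rok i) as [[_ [_ h]] _]; unfold pass; simpl; auto. Qed.

Lemma pass_fun l a b b' : pass l a b -> pass l a b' -> b = b'.
Proof.
  intros h h'. apply eq_divg1. assert (X : pass l 1 (b * b'^-1)).
  { rewrite <- (mulgV B a). now apply passM, passV. }
  destruct l as [i []]; destruct (Rok i) as [_ [h1 h2]]; auto.
Qed.

Lemma dom1 l : dom l 1.
Proof. exists 1; apply pass1. Qed.

Lemma domM l a b : dom l a -> dom l b -> dom l (a * b).
Proof. intros [a' h] [b' h']. exists (a' * b'). now apply passM. Qed.

Lemma domV l a : dom l a -> dom l a^-1.
Proof. intros [a' h]. exists a'^-1. now apply passV. Qed.

Lemma dom_div l a b : dom l a -> dom l (a * b) -> dom l b.
Proof. intros h h'. rewrite <- (mulKg B a b). now apply domM; [apply domV|]. Qed.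

Definition phi (l : lett) (a : B) : B := epsilon (inhabits 1) (pass l a).

Lemma phiP l a : dom l a -> pass l a (phi l a).
Proof. intros h. unfold phi. now apply epsilon_spec. Qed.

Lemma phi_eq l a a' : pass l a a' -> phi l a = a'.
Proof. intros h. apply (pass_fun l a); [apply phiP; now exists a'|exact h]. Qed.

(** A chosen representative of the right coset of [b] modulo the domain of [l], forced to be 1 on
    the domain. It depends on the coset only, because all its elements hand the same predicate to
    [epsilon]. *)
Definition rep (l : lett) (b : B) : B :=
  if excluded_middle_informative (dom l b) then 1
  else epsilon (inhabits 1) (fun r => dom l (b * r^-1)).

Lemma repP l b : dom l (b * (rep l b)^-1).
Proof.
  unfold rep. destruct (excluded_middle_informative _) as [h|h].
  - now rewrite invg1, mulg1.
  - apply (epsilon_spec (inhabits 1) (fun r => dom l (b * r^-1))). exists b. rewrite mulgV. apply dom1.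
Qed.

Lemma rep_mul l a b : dom l a -> rep l (a * b) = rep l b.
Proof.
  intros h. unfold rep.
  destruct (excluded_middle_informative (dom l (a * b))) as [h1|h1];
  destruct (excluded_middle_informative (dom l b)) as [h2|h2]; auto.
  - destruct h2. now apply dom_div with a.
  - destruct h1. now apply domM.
  - f_equal. apply functional_extensionality; intros r. apply propositional_extensionality.
    rewrite mulA. split; [now apply dom_div|now apply domM].
Qed.

Lemma rep_dom l b : dom l b -> rep l b = 1.
Proof. intros h. unfold rep. now destruct (excluded_middle_informative _). Qed.

Lemma dom_rep l b : rep l b = 1 -> dom l b.
Proof. intros h. rewrite <- (mulg1 B b), <- (invg1 B), <- h. apply repP. Qed.

Lemma rep_idem l b : rep l (rep l b) = rep l b.
Proof.
  rewrite <- (rep_mul l (b * (rep l b)^-1)) by apply repP. f_equal. grp.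
Qed.

Definition nstate := (B * list (lett * B))%type.

(** A representative lying in the domain is 1, so forbidding the pattern [l], 1, [opp l] forbids
    every pinch. *)
Fixpoint nf (s : list (lett * B)) : Prop :=
  match s with
  | [] => True
  | (l, r) :: s' => rep l r = r /\
      (match s' with (l', _) :: _ => ~ (r = 1 /\ l' = opp l) | [] => True end) /\ nf s'
  end.

(* Left multiplication of the normal form [b s] by the letter [l], using
   [t b = t a r = a' t r] where [r] is the chosen representative. *)
Definition actl (l : lett) (w : nstate) : nstate :=
  let (b, s) := w in
  let r := rep l b in
  let a' := phi l (b * r^-1) in
  match s with
  | (l', r') :: s' =>
      if excluded_middle_informative (r = 1 /\ l' = opp l) then (a' * r', s')
      else (a', (l, r) :: s)
  | [] => (a', [(l, r)])
  end.

Definition actb (a : B) (w : nstate) : nstate := (a * fst w, snd w).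

Lemma actl_nf l w : nf (snd w) -> nf (snd (actl l w)).
Proof.
  destruct w as [b [|[l' r'] s]]; simpl.
  - intros _. repeat split. apply rep_idem.
  - intros [h1 [h2 h3]]. destruct (excluded_middle_informative _) as [h|h]; simpl; auto.
    repeat split; auto. apply rep_idem.
Qed.

Lemma actl_pass l a a' w : pass l a a' -> actl l (actb a w) = actb a' (actl l w).
Proof.
  intros h. assert (d : dom l a) by now exists a'.
  destruct w as [b s]; unfold actb; simpl. rewrite rep_mul by auto.
  assert (E : phi l (a * b * (rep l b)^-1) = a' * phi l (b * (rep l b)^-1)).
  { apply phi_eq. rewrite mulA. apply passM; auto. apply phiP, repP. }
  rewrite E. destruct s as [|[l' r'] s]; simpl; auto.
  destruct (excluded_middle_informative _) as [h'|h']; simpl; auto. f_equal. grp.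
Qed.

(** Letters act by permutations of the normal forms. If [l] cancels a leading [opp l], the normal
    form condition guarantees that [opp l] is pushed back afterwards instead of cancelling with the
    next letter. *)
Lemma actl_opp l w : nf (snd w) -> actl (opp l) (actl l w) = w.
Proof.
  destruct w as [b s]. intros N. simpl in N.
  assert (D := repP l b). assert (P := phiP l _ D). assert (P' := pass_opp _ _ _ P).
  assert (D' : dom (opp l) (phi l (b * (rep l b)^-1))) by (eexists; eassumption).
  assert (back : actl (opp l) (phi l (b * (rep l b)^-1), (l, rep l b) :: s) = (b, s)).
  { simpl. rewrite (rep_dom _ _ D'), invg1, mulg1, (phi_eq _ _ _ P').
    destruct (excluded_middle_informative _) as [h|h].
    - f_equal. grp.
    - destruct h. split; [reflexivity|]. now rewrite oppK. }
  destruct s as [|[l' r'] s']; [exact back|].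
  unfold actl at 2. destruct (excluded_middle_informative _) as [[h1 ->]|h]; [|exact back].
  destruct N as [N1 [N2 N3]].
  simpl. rewrite rep_mul by auto. rewrite N1.
  replace (phi l (b * (rep l b)^-1) * r' * r'^-1) with (phi l (b * (rep l b)^-1)) by grp.
  rewrite (phi_eq _ _ _ P').
  assert (Eb : b * (rep l b)^-1 = b) by (rewrite h1; grp). rewrite Eb.
  destruct s' as [|[l2 r2] s2]; auto.
  destruct (excluded_middle_informative _) as [h|h]; auto. contradiction.
Qed.

Definition hword := list (B + lett).
Definition act1 (x : B + lett) : nstate -> nstate :=
  match x with inl b => actb b | inr l => actl l end.
Fixpoint act (w : hword) (v : nstate) : nstate :=
  match w with [] => v | x :: w' => act1 x (act w' v) end.
Definition hinv1 (x : B + lett) : B + lett :=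
  match x with inl b => inl b^-1 | inr l => inr (opp l) end.
Definition hwinv (w : hword) : hword := rev (map hinv1 w).

Lemma act_app w w' v : act (w ++ w') v = act w (act w' v).
Proof. induction w; simpl; congruence. Qed.

Lemma act1_nf x v : nf (snd v) -> nf (snd (act1 x v)).
Proof. destruct x; [exact (fun h => h)|apply actl_nf]. Qed.

Lemma act_nf w v : nf (snd v) -> nf (snd (act w v)).
Proof. intros h; induction w; simpl; auto using act1_nf. Qed.

Lemma act1_inv x v : nf (snd v) -> act1 (hinv1 x) (act1 x v) = v.
Proof.
  destruct x as [b|l]; simpl; [|apply actl_opp].
  destruct v as [c s]; unfold actb; simpl. intros _. f_equal. grp.
Qed.

Lemma act_inv w v : nf (snd v) -> act (hwinv w) (act w v) = v.
Proof.
  intros h; induction w as [|x w IH]; simpl; auto.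
  unfold hwinv; simpl. rewrite act_app. simpl.
  rewrite act1_inv by now apply act_nf. exact IH.
Qed.

(** The extension is defined by its action: words are identified when they act alike on normal
    forms. Injectivity of the base and Britton's lemma are then read off at the empty normal form,
    while the universal property takes an argument ([ev_heq]). *)
Definition heq (w w' : hword) := forall v, nf (snd v) -> act w v = act w' v.

Definition hnn : group.
Proof.
  refine (quotg hword heq (@app _) [] hwinv _ _ _ _ _ _ _).
  - intros w v _; reflexivity.
  - intros w w' h v N; symmetry; auto.
  - intros w1 w2 w3 h h' v N; rewrite h; auto.
  - intros w w' u u' h h' v N. rewrite !act_app, h' by auto. apply h, act_nf, N.
  - intros x y z v N; now rewrite app_assoc.
  - intros x v N; reflexivity.
  - intros x v N. rewrite act_app. now apply act_inv.
Defined.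

Definition hcls (w : hword) : hnn := qcls hword heq _ _ _ _ _ _ _ _ _ _ w.
Definition hb (b : B) : hnn := hcls [inl b].
Definition hl (l : lett) : hnn := hcls [inr l].
Definition ht (i : I) : hnn := hl (i, true).

Lemma hcls_eq w w' : heq w w' -> hcls w = hcls w'.
Proof. apply qcls_eq. Qed.
Lemma hcls_inj w w' : hcls w = hcls w' -> heq w w'.
Proof. apply qcls_inj. Qed.
Lemma hcls_surj q : exists w, q = hcls w.
Proof. apply qcls_surj. Qed.
Lemma hcls_app w w' : hcls (w ++ w') = hcls w * hcls w'.
Proof. exact (qcls_mul hword heq (@app _) [] hwinv _ _ _ _ _ _ _ w w'). Qed.

Lemma hcls_nil : hcls [] = 1.
Proof. reflexivity. Qed.

Lemma hb_hom : ghom hb.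
Proof.
  intros x y. unfold hb. rewrite <- hcls_app. apply hcls_eq. intros v N.
  simpl. unfold actb; simpl. f_equal; now grp.
Qed.

Lemma hb_inj b : hb b = 1 -> b = 1.
Proof.
  intros h. rewrite <- hcls_nil in h. apply hcls_inj in h. specialize (h (1, []) Logic.I).
  simpl in h. unfold actb in h. simpl in h. injection h as h. now rewrite mulg1 in h.
Qed.

Lemma hl_opp l : hl (opp l) = (hl l)^-1.
Proof.
  apply (mulgI _ (hl l)). rewrite mulgV. unfold hl. rewrite <- hcls_app. apply hcls_eq.
  intros v N. simpl. rewrite <- (oppK l) at 1. now apply actl_opp.
Qed.

Lemma hl_pass l a a' : pass l a a' -> hl l * hb a = hb a' * hl l.
Proof.
  intros h. unfold hl, hb. rewrite <- !hcls_app. apply hcls_eq. intros v N. simpl.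
  now apply actl_pass.
Qed.

Lemma ht_rel i b b' : R i b b' -> (hb b) ^ (ht i) = hb b'.
Proof.
  intros h. assert (E := hl_pass (i, true) b' b h). unfold conj, ht. rewrite <- E. now grp.
Qed.

Section Lift.
Variables (H : group) (psi : B -> H) (tau : I -> H).
Hypothesis psi_hom : ghom psi.
Hypothesis tau_rel : forall i b b', R i b b' -> (psi b) ^ (tau i) = psi b'.

Definition tl (l : lett) : H := if snd l then tau (fst l) else (tau (fst l))^-1.

Lemma tl_opp l : tl (opp l) = (tl l)^-1.
Proof. destruct l as [i []]; unfold tl; simpl; now grp. Qed.

Lemma tl_pass l a a' : pass l a a' -> tl l * psi a = psi a' * tl l.
Proof.
  destruct l as [i []]; unfold tl, pass; simpl; intros h; rewrite <- (tau_rel _ _ _ h);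
    unfold conj; now grp.
Qed.

Definition ev1 (x : B + lett) : H := match x with inl b => psi b | inr l => tl l end.
Fixpoint ev (w : hword) : H := match w with [] => 1 | x :: w' => ev1 x * ev w' end.
Fixpoint evs (s : list (lett * B)) : H :=
  match s with [] => 1 | (l, r) :: s' => tl l * (psi r * evs s') end.
Definition evn (v : nstate) : H := psi (fst v) * evs (snd v).

Lemma ev_app w w' : ev (w ++ w') = ev w * ev w'.
Proof. induction w; simpl; [now grp|]. rewrite IHw; now grp. Qed.

Lemma evn_act1 x v : evn (act1 x v) = ev1 x * evn v.
Proof.
  destruct x as [b|l]; destruct v as [c s]; unfold evn; simpl.
  - rewrite psi_hom; now grp.
  - assert (P := phiP l _ (repP l c)). apply tl_pass in P.
    assert (K : tl l * psi c = psi (phi l (c * (rep l c)^-1)) * (tl l * psi (rep l c))).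
    { rewrite <- mulA, <- P, mulA, <- psi_hom. do 2 f_equal. now grp. }
    assert (X : psi (phi l (c * (rep l c)^-1)) * (tl l * (psi (rep l c) * evs s))
                = tl l * (psi c * evs s)).
    { rewrite <- (mulA _ (tl l) (psi c)), K. now grp. }
    destruct s as [|[l' r'] s]; [exact X|].
    destruct (excluded_middle_informative _) as [[h1 ->]|h]; [|exact X].
    rewrite <- X. simpl. rewrite h1, (ghom1 _ _ _ psi_hom), tl_opp, psi_hom. now grp.
Qed.

Lemma evn_act w v : evn (act w v) = ev w * evn v.
Proof. induction w; simpl; [now grp|]. rewrite evn_act1, IHw; now grp. Qed.

(** [evn] turns the action into multiplication in [H], so the value of a word is determined by what
    it does to the empty normal form. *)
Lemma ev_heq w w' : heq w w' -> ev w = ev w'.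
Proof.
  intros h. specialize (h (1, []) Logic.I).
  apply (f_equal evn) in h. rewrite !evn_act in h. now apply mulIg in h.
Qed.

Definition hlift : hnn -> H := qlift hword heq (@app _) [] hwinv _ _ _ _ _ _ _ H ev.

Lemma hlift_cls w : hlift (hcls w) = ev w.
Proof. apply qlift_cls. exact ev_heq. Qed.

Lemma hlift_hom : ghom hlift.
Proof. apply qlift_hom; [exact ev_heq|exact ev_app]. Qed.

Lemma hlift_b b : hlift (hb b) = psi b.
Proof. unfold hb. rewrite hlift_cls. simpl. now grp. Qed.

Lemma hlift_t i : hlift (ht i) = tau i.
Proof. unfold ht, hl. rewrite hlift_cls. simpl. now grp. Qed.
End Lift.

Lemma hnn_ind (P : hnn -> Prop) :
  P 1 -> (forall b, P (hb b)) -> (forall i, P (ht i)) ->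
  (forall x y, P x -> P y -> P (x * y)) -> (forall x, P x -> P x^-1) -> forall q, P q.
Proof.
  intros P1 Pb Pt PM PV q. destruct (hcls_surj q) as [w ->].
  induction w as [|x w IH]; [exact P1|].
  change (P (hcls ([x] ++ w))). rewrite hcls_app. apply PM; auto.
  destruct x as [b|[i []]]; [apply Pb|apply Pt|].
  change (P (hl (opp (i, true)))). rewrite hl_opp. apply PV, Pt.
Qed.

(** * Britton's lemma and its consequences *)

Fixpoint reduced (s : list (lett * B)) : Prop :=
  match s with
  | [] => True
  | (l, b) :: s' =>
      (match s' with (l', _) :: _ => ~ (l' = opp l /\ dom l b) | [] => True end) /\ reduced s'
  end.

Fixpoint sw (s : list (lett * B)) : hword :=
  match s with [] => [] | (l, b) :: s' => inr l :: inl b :: sw s' end.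

(** The first letter survives: to cancel against the next one, [b * x] would have to lie in the
    domain of [l]. The claim on [x], carried along for the induction, puts [x] there, hence also
    [b], against reducedness. *)
Lemma reduced_act l b s : reduced ((l, b) :: s) ->
  exists x r s', act (sw ((l, b) :: s)) (1, []) = (x, (l, r) :: s') /\ dom (opp l) x.
Proof.
  revert l b; induction s as [|[l2 b2] s IH]; intros l b [H1 H2].
  - simpl. rewrite mulg1. eexists _, _, _; split; [reflexivity|].
    eexists. apply pass_opp, phiP, repP.
  - destruct (IH l2 b2 H2) as [x [r [s' [E D]]]].
    change (act (sw ((l, b) :: (l2, b2) :: s)) (1, []))
      with (actl l (actb b (act (sw ((l2, b2) :: s)) (1, [])))).
    rewrite E. unfold actb; simpl.
    destruct (excluded_middle_informative _) as [[h1 ->]|h].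
    + destruct H1. split; auto. rewrite oppK in D. apply dom_rep in h1.
      replace b with (b * x * x^-1) by now grp. apply domM; auto. now apply domV.
    + eexists _, _, _; split; [reflexivity|]. eexists. apply pass_opp, phiP, repP.
Qed.

Theorem britton s b : reduced s -> hcls (sw s) = hb b -> s = [].
Proof.
  intros Rs E. destruct s as [|[l c] s]; auto.
  apply hcls_inj in E. specialize (E (1, []) Logic.I).
  destruct (reduced_act _ _ _ Rs) as [x [r [s' [E' _]]]]. rewrite E' in E. discriminate.
Qed.

Lemma not_reduced s : ~ reduced s ->
  exists u l b b' v, s = u ++ (l, b) :: (opp l, b') :: v /\ dom l b.
Proof.
  induction s as [|[l b] s IH]; simpl; [tauto|]. intros h.
  destruct (classic (reduced s)) as [h'|h'].
  - destruct s as [|[l' b'] s]; [tauto|].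
    exists [], l, b, b', s. simpl. assert (h2 : l' = opp l /\ dom l b) by tauto.
    destruct h2 as [-> d]. auto.
  - destruct (IH h') as [u [l1 [b1 [b2 [v [-> d]]]]]].
    exists ((l, b) :: u), l1, b1, b2, v. auto.
Qed.

Fixpoint sv (s : list (lett * B)) : hnn :=
  match s with [] => 1 | (l, b) :: s' => hl l * (hb b * sv s') end.

Lemma sw_sv s : hcls (sw s) = sv s.
Proof.
  induction s as [|[l b] s IH]; auto. simpl.
  change (inr l :: inl b :: sw s) with ([inr l] ++ [inl b] ++ sw s).
  rewrite !hcls_app, IH. reflexivity.
Qed.

Lemma sv_app s s' : sv (s ++ s') = sv s * sv s'.
Proof. induction s as [|[l b] s IH]; simpl; [now grp|]. rewrite IH. now grp. Qed.

Lemma pinch l b a c : pass l b a -> hl l * (hb b * (hl (opp l) * hb c)) = hb (a * c).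
Proof.
  intros h. rewrite <- mulA, (hl_pass _ _ _ h), hl_opp, hb_hom. now grp.
Qed.

(* A homomorphism from a subgroup of the base, given by its graph [M], extends to the
   subgroup generated by that subgroup and the stable letters. *)
Section Extension.
Variables (H : group) (M : B -> H -> Prop) (tau : I -> H).
Hypothesis Msub : subrel M.
Hypothesis Mfun : forall h, M 1 h -> h = 1.
Hypothesis Mfwd : forall i b b' h, M b h -> R i b b' -> M b' (h ^ (tau i)).
Hypothesis Mbwd : forall i b b' h, M b' h -> R i b b' -> M b (h ^ (tau i)^-1).

Definition trip := (lett * (B * H))%type.
Fixpoint tk (s : list trip) : hnn :=
  match s with [] => 1 | (l, (b, _)) :: s' => hl l * (hb b * tk s') end.
Fixpoint tg (s : list trip) : H :=
  match s with [] => 1 | (l, (_, h)) :: s' => tl H tau l * (h * tg s') end.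
Definition tM (s : list trip) := Forall (fun x : trip => M (fst (snd x)) (snd (snd x))) s.

Lemma tk_app s s' : tk (s ++ s') = tk s * tk s'.
Proof. induction s as [|[l [b h]] s IH]; simpl; [now grp|]. rewrite IH. now grp. Qed.
Lemma tg_app s s' : tg (s ++ s') = tg s * tg s'.
Proof. induction s as [|[l [b h]] s IH]; simpl; [now grp|]. rewrite IH. now grp. Qed.

(** One word in the stable letters and the domain of [M], read in parallel in the extension as [k]
    and in [H] as [g]; the number [n] of stable letters is the induction measure of [tform_one]. *)
Definition tform (n : nat) (k : hnn) (g : H) := exists b h s,
  length s = n /\ M b h /\ tM s /\ k = hb b * tk s /\ g = h * tg s.

Lemma tform_base n k g b h : tform n k g -> M b h -> tform n (k * hb b) (g * h).
Proof.
  intros [b0 [h0 [s [E1 [E2 [E3 [-> ->]]]]]]] m. destruct Msub as [_ [MM _]].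
  destruct s as [|x s] using rev_ind.
  - exists (b0 * b), (h0 * h), []. simpl. rewrite hb_hom. repeat split; auto; now grp.
  - destruct x as [l [b1 h1]]. apply Forall_app in E3 as [E3 E4]. inversion E4; subst.
    exists b0, h0, (s ++ [(l, (b1 * b, h1 * h))]). repeat split; auto.
    + rewrite !length_app; reflexivity.
    + apply Forall_app; split; auto. constructor; auto. simpl. auto.
    + rewrite !tk_app; simpl. rewrite hb_hom. now grp.
    + rewrite !tg_app; simpl. now grp.
Qed.

Lemma tform_tail n k g s : tform n k g -> tM s -> tform (n + length s) (k * tk s) (g * tg s).
Proof.
  intros [b0 [h0 [s0 [E1 [E2 [E3 [-> ->]]]]]]] m.
  exists b0, h0, (s0 ++ s). repeat split; auto.
  - rewrite length_app; lia.
  - apply Forall_app; auto.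
  - rewrite tk_app; now grp.
  - rewrite tg_app; now grp.
Qed.

Lemma tform_mul n k g n' k' g' :
  tform n k g -> tform n' k' g' -> tform (n + n') (k * k') (g * g').
Proof.
  intros h [b0 [h0 [s0 [<- [E2 [E3 [-> ->]]]]]]].
  rewrite <- !mulA. apply tform_tail; auto. now apply tform_base.
Qed.

Lemma tform_l l : tform 1 (hl l) (tl H tau l).
Proof.
  destruct Msub as [M1 _].
  exists 1, 1, [(l, (1, 1))]. repeat split; auto.
  - constructor; auto.
  - simpl. rewrite !(ghom1 _ _ _ hb_hom). now grp.
  - simpl. now grp.
Qed.

Lemma tform_inv n k g : tform n k g -> exists n', tform n' k^-1 g^-1.
Proof.
  intros [b0 [h0 [s0 [<- [E2 [E3 [-> ->]]]]]]]. destruct Msub as [M1 [MM MV]].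
  assert (base : forall b h, M b h -> tform 0 (hb b) h).
  { intros b h m. exists b, h, []. repeat split; simpl; auto; try now grp. constructor. }
  assert (inv_tail : exists n, tform n (tk s0)^-1 (tg s0)^-1).
  { clear E2 b0 h0. induction s0 as [|[l [b h]] s IH].
    - exists 0. simpl. rewrite !invg1. rewrite <- (ghom1 _ _ _ hb_hom). auto.
    - inversion E3; subst. destruct IH as [n F]; auto. exists (n + 0 + 1). simpl.
      rewrite !invMg, <- hl_opp, <- (tl_opp H tau), <- (ghomV _ _ hb b hb_hom).
      apply tform_mul; [apply tform_mul; auto|apply tform_l]. }
  destruct inv_tail as [n F]. exists (n + 0). rewrite !invMg, <- (ghomV _ _ hb b0 hb_hom).
  apply tform_mul; auto.
Qed.

Definition tstrip (s : list trip) : list (lett * B) :=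
  map (fun x : trip => (fst x, fst (snd x))) s.

Lemma tk_strip s : tk s = sv (tstrip s).
Proof. induction s as [|[l [b h]] s IH]; simpl; congruence. Qed.

Lemma M_pass l b a h : M b h -> pass l b a -> M a (tl H tau l * (h * (tl H tau l)^-1)).
Proof.
  intros m p. destruct l as [i []]; unfold pass, tl in *; simpl in *.
  - generalize (Mbwd _ _ _ _ m p). unfold conj. now rewrite invgK.
  - generalize (Mfwd _ _ _ _ m p). unfold conj. now rewrite invgK.
Qed.

(** By Britton's lemma a trivial word with stable letters has a pinch. [M_pass] says that [M]
    respects its removal, so the same shortening is valid on the side of [H]; without stable letters
    [Mfun] applies. *)
Lemma tform_one n g : tform n 1 g -> g = 1.
Proof.
  revert g. induction n as [n IH] using lt_wf_ind. intros g [b0 [h0 [s [<- [E2 [E3 [E4 ->]]]]]]].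
  assert (Es : hcls (sw (tstrip s)) = hb b0^-1).
  { rewrite sw_sv, <- tk_strip, (ghomV _ _ hb b0 hb_hom). apply (mulgI _ (hb b0)).
    rewrite mulgV. now symmetry. }
  destruct s as [|x s'].
  { apply Mfun. simpl in *. rewrite mulg1 in *. symmetry in E4. apply hb_inj in E4. now subst. }
  destruct (classic (reduced (tstrip (x :: s')))) as [r|r].
  { apply britton in Es; auto. discriminate. }
  destruct (not_reduced _ r) as [u [l [b [b' [v [Eq [a pa]]]]]]].
  set (s := x :: s') in *. clearbody s. clear x s' r Es.
  unfold tstrip in Eq. apply map_eq_app in Eq as [u' [w [-> [Eu Ew]]]].
  destruct w as [|[l1 [b1 h1]] [|[l2 [b2 h2]] v']]; try discriminate.
  simpl in Ew. injection Ew as -> -> -> -> Ev. subst u v.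
  apply Forall_app in E3 as [E3 E5]. apply Forall_cons_iff in E5 as [m1 E5].
  apply Forall_cons_iff in E5 as [m2 E5]. simpl in *.
  apply (IH (length u' + 0 + length v')%nat).
  { rewrite length_app. simpl. lia. }
  assert (F : tform (length u') (hb b0 * tk u') (h0 * tg u')).
  { exists b0, h0, u'. repeat split; auto. }
  assert (F2 := M_pass _ _ _ _ m1 pa).
  destruct Msub as [M1 [MM MV]].
  assert (F3 := tform_base _ _ _ _ _ F (MM _ _ _ _ F2 m2)).
  assert (F4 := tform_tail _ _ _ v' F3 E5). rewrite Nat.add_0_r.
  replace (1 : hnn) with (hb b0 * tk u' * hb (a * b') * tk v').
  - rewrite tg_app. simpl. rewrite tl_opp.
    replace (h0 * (tg u' * (tl H tau l * (h1 * ((tl H tau l)^-1 * (h2 * tg v'))))))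
      with (h0 * tg u' * (tl H tau l * (h1 * (tl H tau l)^-1) * h2) * tg v') by now grp.
    exact F4.
  - rewrite E4, tk_app. simpl. rewrite <- (pinch l b a b' pa). now grp.
Qed.

Inductive ext_gen : hnn -> H -> Prop :=
| eg_b b h : M b h -> ext_gen (hb b) h
| eg_t i : ext_gen (ht i) (tau i).

Theorem extension k g : pgen ext_gen k g -> k = 1 -> g = 1.
Proof.
  intros p. assert (X : exists n, tform n k g).
  { apply (pgen_min _ _ ext_gen (fun k g => exists n, tform n k g)); auto.
    - destruct Msub as [M1 _]. split; [|split].
      + exists 0, 1, 1, []. repeat split; simpl; auto; [constructor| |]; rewrite ?(ghom1 _ _ _ hb_hom); now grp.
      + intros a b c d [n h] [n' h']. exists (n + n')%nat. now apply tform_mul.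
      + intros a b [n h]. now apply tform_inv with n.
    - intros a b [b0 h m|i].
      + exists 0, b0, h, []. repeat split; simpl; auto; [constructor| |]; now grp.
      + exists 1%nat. apply tform_l. }
  destruct X as [n h]. intros ->. now apply tform_one with n.
Qed.
End Extension.

(** * Torsion in HNN extensions *)

Lemma adjacent_in_power {A : Type} (s : list A) n u (x y : A) v :
  lpow s n = u ++ x :: y :: v ->
  (exists u' v', s = u' ++ x :: y :: v') \/ (exists m, s = y :: m ++ [x]) \/ (x = y /\ s = [x]).
Proof.
  revert u v. induction n as [|n IH]; intros u v E; simpl in E.
  - destruct u; discriminate.
  - apply app_eq_app in E as [w [[E1 E2]|[E1 E2]]].
    + destruct w as [|x1 [|y1 w]]; simpl in E2.
      * apply (IH [] v). now rewrite <- E2.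
      * injection E2 as -> E2.
        assert (Hs : exists m, s = y :: m).
        { destruct n; [discriminate|]. simpl in E2. destruct s as [|y0 m].
          - destruct u; discriminate.
          - injection E2 as -> _. now exists m. }
        destruct Hs as [m ->]. destruct u as [|z u].
        -- injection E1 as -> ->. right; right; auto.
        -- injection E1 as -> ->. right; left. now exists u.
      * injection E2 as -> -> E2. left. now exists u, w.
    + apply (IH w v). exact E2.
Qed.

Lemma sv_lpow s n : sv (lpow s n) = gpow (sv s) n.
Proof. induction n; simpl; auto. now rewrite sv_app, IHn. Qed.

Lemma sv_form q : exists b s, q = hb b * sv s.
Proof.
  destruct (hcls_surj q) as [w ->]. induction w as [|[b|l] w [b0 [s E]]].
  - exists 1, []. simpl. rewrite (ghom1 _ _ _ hb_hom). now grp.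
  - exists (b * b0), s. change (inl b :: w) with ([inl b] ++ w).
    rewrite hcls_app, E, hb_hom. change (hcls [inl b]) with (hb b). now grp.
  - exists 1, ((l, b0) :: s). change (inr l :: w) with ([inr l] ++ w).
    rewrite hcls_app, E, (ghom1 _ _ _ hb_hom). change (hcls [inr l]) with (hl l). simpl. now grp.
Qed.

(* Britton's lemma applied to [x ^ n] yields a pinch in the cyclic word of [x], hence a
   conjugate of [x] with fewer stable letters. *)
Lemma torsion_conj n : 0 < n -> forall k b s, length s = k ->
  gpow (hb b * sv s) n = 1 -> exists c g, hb b * sv s = (hb c) ^ g.
Proof.
  intros n0 k; induction k as [k IH] using lt_wf_ind.
  assert (short : forall b s, length s < k -> gpow (hb b * sv s) n = 1 ->
                   exists c g, hb b * sv s = (hb c) ^ g) by (intros; eapply IH; eauto).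
  clear IH. intros b s Es E.
  destruct s as [|x s0] using rev_ind.
  { exists b, 1. rewrite conjg1. simpl. now grp. }
  clear IHs0. destruct x as [l c].
  (* Conjugation moves the leading base element into the last entry, so that powers of the element
     become literal powers of the list. *)
  assert (Hc : (hb b * sv (s0 ++ [(l, c)])) ^ (hb b) = sv (s0 ++ [(l, c * b)])).
  { rewrite !sv_app. simpl. rewrite hb_hom. unfold conj. now grp. }
  set (s := s0 ++ [(l, c * b)]) in *.
  assert (Ls : length s = k).
  { subst s. rewrite length_app in *. exact Es. }
  assert (suff : exists c g, sv s = (hb c) ^ g).
  2:{ destruct suff as [c' [g E']]. exists c', (g * (hb b)^-1).
      rewrite <- conj_conj, <- E', <- Hc, conj_conj, mulgV. now rewrite conjg1. }
  assert (En : gpow (sv s) n = 1) by now rewrite <- Hc, gpow_conj, E, conj_one.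
  assert (nr : ~ reduced (lpow s n)).
  { intros r. apply (britton _ 1) in r.
    - destruct n; [lia|]. simpl in r. destruct s; [simpl in Ls; subst k; destruct s0; discriminate|discriminate].
    - now rewrite sw_sv, sv_lpow, (ghom1 _ _ _ hb_hom). }
  clearbody s. clear E Hc Es.
  destruct (not_reduced _ nr) as [u [l1 [b1 [b2 [v [Eq [a pa]]]]]]].
  (* A pinch inside the list shortens it; the base element left over is absorbed by the preceding
     entry, or becomes the leading factor if there is none. *)
  assert (main : forall u v, length (u ++ (l1, b1) :: (opp l1, b2) :: v) = k ->
     gpow (sv (u ++ (l1, b1) :: (opp l1, b2) :: v)) n = 1 ->
     exists c g, sv (u ++ (l1, b1) :: (opp l1, b2) :: v) = (hb c) ^ g).
  { clear - short pa. intros u v L E.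
    assert (X : exists b' s', length s' < k /\
              sv (u ++ (l1, b1) :: (opp l1, b2) :: v) = hb b' * sv s').
    { rewrite sv_app. simpl.
      replace (hl l1 * (hb b1 * (hl (opp l1) * (hb b2 * sv v)))) with (hb (a * b2) * sv v)
        by (rewrite <- (pinch _ _ _ b2 pa); now grp).
      rewrite length_app in L. simpl in L.
      destruct u as [|[l3 b3] u] using rev_ind.
      - exists (a * b2), v. split; [lia|]. simpl. now grp.
      - exists 1, (u ++ (l3, b3 * (a * b2)) :: v). rewrite length_app in *. simpl in *.
        split; [lia|]. rewrite !sv_app. simpl. rewrite (ghom1 _ _ _ hb_hom), !hb_hom. now grp. }
    destruct X as [b' [s' [L' X]]]. rewrite X in *. now apply short. }
  destruct (adjacent_in_power _ _ _ _ _ _ Eq) as [[u' [v' ->]]|[[m ->]|[E ->]]].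
  - now apply main.
  (* The pinch lies at the seam of two copies. Rotating the list, which is a conjugation, brings it
     to the front. *)
  - assert (Hr : sv ((opp l1, b2) :: m ++ [(l1, b1)]) =
       (sv ([] ++ (l1, b1) :: (opp l1, b2) :: m)) ^ (hl l1 * hb b1)).
    { simpl. rewrite sv_app. simpl. unfold conj. now grp. }
    destruct (main [] m) as [c' [g E']].
    + rewrite <- Ls. simpl. rewrite length_app. simpl. lia.
    + replace (sv ([] ++ (l1, b1) :: (opp l1, b2) :: m)) with
        ((sv ((opp l1, b2) :: m ++ [(l1, b1)])) ^ (hl l1 * hb b1)^-1).
      * rewrite gpow_conj, En. apply conj_one.
      * now rewrite Hr, conj_conj, mulgV, conjg1.
    + exists c', (g * (hl l1 * hb b1)). now rewrite Hr, E', conj_conj.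
  (* A list with a single entry would make a letter its own opposite. *)
  - injection E as E _. now apply opp_neq in E.
Qed.

Theorem tfree_hnn T : tfree T B -> tfree T hnn.
Proof.
  intros TB x n Tn n0 E. destruct (sv_form x) as [b [s ->]].
  destruct (torsion_conj n n0 _ b s eq_refl E) as [c [g Ec]]. rewrite Ec in *.
  assert (Ec1 : gpow c n = 1).
  { apply hb_inj. rewrite (ghomX _ _ _ _ _ hb_hom). rewrite gpow_conj in E.
    replace (gpow (hb c) n) with (((gpow (hb c) n) ^ g) ^ (g^-1))
      by (now rewrite conj_conj, mulgV, conjg1).
    rewrite E. apply conj_one. }
  rewrite (TB c n Tn n0 Ec1). rewrite (ghom1 _ _ _ hb_hom). apply conj_one.
Qed.
End HNN.

Arguments assoc_ok {B I}.
Arguments hb {B I R Rok}.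
Arguments hl {B I R Rok}.
Arguments ht {B I R Rok}.
Arguments hlift {B I R Rok H}.
Arguments hb_hom {B I R Rok}.
Arguments hb_inj {B I R Rok}.
Arguments ht_rel {B I R Rok}.
Arguments hlift_hom {B I R Rok H}.
Arguments hlift_b {B I R Rok H}.
Arguments hlift_t {B I R Rok H}.
Arguments hnn_ind {B I R Rok}.
Arguments extension {B I R Rok H}.

Definition triv_rel (B : group) (I : Type) (_ : I) (b b' : B) := b = 1 /\ b' = 1.

Lemma triv_ok B I : assoc_ok (triv_rel B I).
Proof.
  intros i. unfold triv_rel. split; [split; [tauto|split]|split; [tauto|tauto]].
  - intros a b c d [-> ->] [-> ->]. split; now grp.
  - intros a b [-> ->]. split; now grp.
Qed.

(* The free product of [B] and the free group on [I]. *)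
Definition fprod (B : group) (I : Type) : group := hnn B I (triv_rel B I) (triv_ok B I).

Lemma triv_lift {B : group} {I : Type} {H : group} (psi : B -> H) (tau : I -> H) :
  ghom psi -> forall i b b', triv_rel B I i b b' -> (psi b) ^ (tau i) = psi b'.
Proof. intros h i b b' [-> ->]. rewrite ghom1 by auto. apply conj_one. Qed.

Section ProductBase.
Variables (G H : group) (I : Type) (R : I -> prodg G H -> prodg G H -> Prop).
Hypothesis Rok : assoc_ok R.

Definition hin1 (x : G) : hnn (prodg G H) I R Rok := hb ((x, 1) : prodg G H).
Definition hin2 (y : H) : hnn (prodg G H) I R Rok := hb ((1, y) : prodg G H).

Lemma hin1_hom : ghom hin1.
Proof.
  intros x y. unfold hin1. rewrite <- hb_hom. f_equal. unfold mul at 2; simpl. now rewrite mulg1.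
Qed.
Lemma hin2_hom : ghom hin2.
Proof.
  intros x y. unfold hin2. rewrite <- hb_hom. f_equal. unfold mul at 2; simpl. now rewrite mulg1.
Qed.
Lemma hb_pair x y : (hb ((x, y) : prodg G H) : hnn (prodg G H) I R Rok) = hin1 x * hin2 y.
Proof.
  unfold hin1, hin2. rewrite <- hb_hom. f_equal. unfold mul; simpl. now rewrite mulg1, mul1g.
Qed.
Lemma hin_comm x y : comm (hin1 x) (hin2 y).
Proof.
  unfold comm. rewrite <- hb_pair. unfold hin1, hin2. rewrite <- hb_hom. f_equal.
  unfold mul; simpl. now rewrite mulg1, mul1g.
Qed.
End ProductBase.

(** * Presented groups and the universal quotient *)

Section Presented.
Variable P : pres.

Lemma weq_refl w : weq P w w.
Proof. apply rst_refl. Qed.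
Lemma weq_sym w w' : weq P w w' -> weq P w' w.
Proof. apply rst_sym. Qed.
Lemma weq_trans x y z : weq P x y -> weq P y z -> weq P x z.
Proof. apply rst_trans. Qed.

Lemma weq_ctx u v w w' : weq P w w' -> weq P (u ++ w ++ v) (u ++ w' ++ v).
Proof.
  induction 1 as [x y [a b c|a b r H]| | |]; eauto using weq_refl, weq_sym, weq_trans.
  - apply rst_step. rewrite <- !app_assoc, <- !app_comm_cons, !app_assoc.
    rewrite <- (app_assoc (u ++ a)). apply step_free.
  - apply rst_step. rewrite <- !app_assoc, !(app_assoc u a). now apply step_rel.
Qed.

Lemma weq_app w w' v v' : weq P w w' -> weq P v v' -> weq P (w ++ v) (w' ++ v').
Proof.
  intros h h'. apply weq_trans with (w' ++ v).
  - apply (weq_ctx [] v _ _ h).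
  - generalize (weq_ctx w' [] _ _ h'). now rewrite !app_nil_r.
Qed.

Lemma inv_letterK a : inv_letter (inv_letter a) = a.
Proof. destruct a as [i []]; reflexivity. Qed.

Lemma winv_app u v : winv (u ++ v) = winv v ++ winv u.
Proof. unfold winv. now rewrite map_app, rev_app_distr. Qed.

Lemma weq_invl w : weq P (winv w ++ w) [].
Proof.
  induction w as [|a w IH]; [apply weq_refl|].
  change (a :: w) with ([a] ++ w) at 1. rewrite winv_app. unfold winv at 2. simpl.
  rewrite <- app_assoc. simpl. apply weq_trans with (winv w ++ w); auto. apply rst_step.
  rewrite <- (inv_letterK a) at 2. apply step_free.
Qed.

Lemma weq_inv w w' : weq P w w' -> weq P (winv w) (winv w').
Proof.
  intros h. apply weq_trans with (winv w ++ w' ++ winv w').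
  - rewrite <- (app_nil_r (winv w)) at 1. apply weq_app; [apply weq_refl|]. apply weq_sym.
    assert (E : winv (winv w') = w').
    { unfold winv. rewrite map_rev, rev_involutive, map_map. erewrite map_ext, map_id; auto.
      apply inv_letterK. }
    rewrite <- E at 1. apply weq_invl.
  - rewrite app_assoc. rewrite <- (app_nil_l (winv w')) at 2.
    apply weq_app; [|apply weq_refl]. apply weq_trans with (winv w ++ w); [|apply weq_invl].
    apply weq_app; [apply weq_refl|now apply weq_sym].
Qed.

Definition pg : group.
Proof.
  refine (quotg word (weq P) (@app _) [] winv weq_refl weq_sym weq_trans _ _ _ _).
  - intros; now apply weq_app.
  - intros; rewrite app_assoc; apply weq_refl.
  - intros; apply weq_refl.
  - apply weq_invl.
Defined.

Definition pcls (w : word) : pg := qcls word (weq P) _ _ _ _ _ _ _ _ _ _ w.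
Lemma pcls_eq w w' : weq P w w' -> pcls w = pcls w'.
Proof. apply qcls_eq. Qed.
Lemma pcls_inj w w' : pcls w = pcls w' -> weq P w w'.
Proof. apply qcls_inj. Qed.
Lemma pcls_app w w' : pcls (w ++ w') = pcls w * pcls w'.
Proof. exact (qcls_mul word (weq P) (@app _) [] winv _ _ _ _ _ _ _ w w'). Qed.
Lemma pcls_inv w : pcls (winv w) = (pcls w)^-1.
Proof. exact (qcls_inv word (weq P) (@app _) [] winv _ _ _ _ weq_inv _ _ _ w). Qed.

Definition pgn (i : nat) : pg := pcls [(i, true)].
End Presented.

Section Evaluation.
Variables (H : group) (g : nat -> H).

Definition lev (a : letter) : H := if snd a then g (fst a) else (g (fst a))^-1.
Fixpoint wev (w : word) : H := match w with [] => 1 | a :: w' => lev a * wev w' end.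

Lemma wev_app u v : wev (u ++ v) = wev u * wev v.
Proof. induction u; simpl; [now grp|]. rewrite IHu; now grp. Qed.

Lemma lev_inv a : lev (inv_letter a) = (lev a)^-1.
Proof. destruct a as [i []]; unfold lev; simpl; now grp. Qed.

Lemma wev_inv u : wev (winv u) = (wev u)^-1.
Proof.
  induction u as [|a u IH]; simpl; [now grp|].
  change (a :: u) with ([a] ++ u). rewrite winv_app, wev_app, IH.
  unfold winv. simpl. rewrite lev_inv. now grp.
Qed.

Lemma wev_step P u v : (forall r, In r (rels P) -> wev r = 1) -> weq P u v -> wev u = wev v.
Proof.
  intros h; induction 1 as [x y [a b c|a b r Hr]| | |]; try congruence.
  - rewrite !wev_app. simpl. rewrite lev_inv. now grp.
  - rewrite !wev_app, (h r Hr). now grp.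
Qed.

Lemma wev_pow w n : wev (wpow w n) = gpow (wev w) n.
Proof. induction n; simpl; auto. now rewrite wev_app, IHn. Qed.

Lemma wev_zpow w z : wev (wzpow w z) =
  if (0 <=? z)%Z then gpow (wev w) (Z.abs_nat z) else (gpow (wev w) (Z.abs_nat z))^-1.
Proof.
  unfold wzpow. destruct (Z.leb_spec 0 z).
  - rewrite wev_pow. f_equal. lia.
  - rewrite wev_pow, wev_inv, gpow_inv. do 2 f_equal. lia.
Qed.
End Evaluation.

Lemma lev_ghom (G H : group) (f : G -> H) g a : ghom f -> f (lev G g a) = lev H (fun i => f (g i)) a.
Proof. intros h. destruct a as [i []]; unfold lev; simpl; auto. now apply ghomV. Qed.

Lemma wev_ghom (G H : group) (f : G -> H) g w : ghom f -> f (wev G g w) = wev H (fun i => f (g i)) w.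
Proof. intros h. induction w; simpl; [now apply ghom1|]. now rewrite h, lev_ghom, IHw. Qed.

Lemma wev_ext (G : group) g g' w P : wf_word P w -> (forall i, i < ngen P -> g i = g' i) ->
  wev G g w = wev G g' w.
Proof.
  intros h e. induction h as [|a w h _ IH]; simpl; auto. rewrite IH. f_equal.
  unfold lev. now rewrite e.
Qed.

Lemma wev_pgn P w : wev (pg P) (pgn P) w = pcls P w.
Proof.
  induction w as [|[i b] w IH]; simpl; [reflexivity|].
  change ((i, b) :: w) with ([(i, b)] ++ w). rewrite pcls_app, <- IH. f_equal.
  destruct b; [reflexivity|]. unfold lev, pgn; simpl. now rewrite <- pcls_inv.
Qed.

Lemma wev_wmap (G : group) (g : nat -> G) phi w :
  wev G g (wmap phi w) = wev G (fun i => wev G g (phi i)) w.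
Proof.
  induction w as [|[i []] w IH]; simpl; auto; rewrite wev_app, IH; unfold lev; simpl; auto.
  now rewrite wev_inv.
Qed.

(** The powers with exponents [z] and [-z] are trivial together, so only absolute values matter. *)
Definition absset (A : Z -> Prop) (n : nat) := exists z, A z /\ Z.abs_nat z = n.

Lemma wzpow_one P w z : weq P (wzpow w z) [] <-> gpow (pcls P w) (Z.abs_nat z) = 1.
Proof.
  split; intros h.
  - apply pcls_eq in h. rewrite <- !wev_pgn, wev_zpow, wev_pgn in h.
    destruct (0 <=? z)%Z; auto. rewrite <- (invgK _ (gpow _ _)), h. simpl. now grp.
  - apply pcls_inj. rewrite <- !wev_pgn, wev_zpow, wev_pgn, h. destruct (0 <=? z)%Z; simpl; now grp.
Qed.

(** * The universal torsion-free quotient *)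

Section Universal.
Variable T : nat -> Prop.
Local Notation Nw := (Ntriv T).

Lemma Nw_cyc u v : Nw (u ++ v) -> Nw (v ++ u).
Proof.
  revert v; induction u as [|a u IH]; intros v h; simpl in *.
  - now rewrite app_nil_r.
  - change (a :: u) with ([a] ++ u). rewrite app_assoc. apply IH.
    rewrite app_assoc. now apply N_rot.
Qed.

Lemma Nw_bar a : Nw [a; bar a].
Proof.
  rewrite <- (cp_c a). unfold bar. rewrite c1_cp, c2_cp.
  destruct (Nat.Even_or_Odd (c2 a)) as [[i ->]|[i ->]].
  - rewrite flip_even. apply N_inv.
  - rewrite Nat.add_1_r, flip_odd. apply (Nw_cyc [_] [_]), N_inv.
Qed.

Lemma Nw_ins u x v : Nw x -> Nw (u ++ v) -> Nw (u ++ x ++ v).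
Proof.
  intros h h'. apply (Nw_cyc (x ++ v) u). rewrite <- app_assoc.
  apply N_app; auto. now apply Nw_cyc.
Qed.

Lemma Nw_del u x v : Nw x -> Nw (u ++ x ++ v) -> Nw (u ++ v).
Proof.
  intros h h'. apply Nw_cyc. apply N_strip with x; auto.
  rewrite app_assoc. now apply Nw_cyc.
Qed.

Lemma Nw_invr w : Nw (w ++ ninv w).
Proof.
  induction w as [|a w IH]; [apply N_nil|].
  change (a :: w) with ([a] ++ w) at 2. rewrite ninv_app. simpl.
  apply (Nw_cyc (w ++ ninv w ++ [bar a]) [a]). rewrite <- !app_assoc. simpl.
  rewrite app_assoc. apply N_app; auto. rewrite <- (barK a) at 2. apply Nw_bar.
Qed.

Lemma Nw_invl w : Nw (ninv w ++ w).
Proof. rewrite <- (ninvK w) at 2. apply Nw_invr. Qed.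

Lemma Nw_inv w : Nw w -> Nw (ninv w).
Proof. intros h. apply N_strip with w; auto. apply Nw_invr. Qed.

Definition neq (w w' : list nat) := Nw (w ++ ninv w').

Definition CG : group.
Proof.
  refine (quotg (list nat) neq (@app _) [] ninv _ _ _ _ _ _ _); unfold neq.
  - exact Nw_invr.
  - intros x y h. apply Nw_inv in h. now rewrite ninv_app, ninvK in h.
  - intros x y z h h'. apply Nw_del with (ninv y ++ y); [apply Nw_invl|].
    rewrite <- !app_assoc, app_assoc. now apply N_app.
  - intros x x' y y' h h'. rewrite ninv_app, <- app_assoc, (app_assoc y).
    now apply Nw_ins.
  - intros x y z. rewrite <- (app_assoc x y z). apply Nw_invr.
  - intros; apply Nw_invr.
  - intros. rewrite app_nil_r. apply Nw_invl.
Defined.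

Definition ncls (w : list nat) : CG := qcls (list nat) neq _ _ _ _ _ _ _ _ _ _ w.
Lemma ncls_app w w' : ncls (w ++ w') = ncls w * ncls w'.
Proof. exact (qcls_mul (list nat) neq (@app _) [] ninv _ _ _ _ _ _ _ w w'). Qed.
Lemma ncls_one w : ncls w = 1 <-> Nw w.
Proof.
  split; intros h.
  - change 1 with (ncls []) in h. apply qcls_inj in h. unfold neq in h. now rewrite app_nil_r in h.
  - change 1 with (ncls []). apply qcls_eq. unfold neq. now rewrite app_nil_r.
Qed.
Lemma ncls_surj q : exists w, q = ncls w.
Proof. apply qcls_surj. Qed.

Definition cg (k : nat) : CG := ncls [k].

Fixpoint nev (H : group) (g : nat -> H) (w : list nat) : H :=
  match w with [] => 1 | k :: w' => g k * nev H g w' end.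

Lemma nev_app H g u v : nev H g (u ++ v) = nev H g u * nev H g v.
Proof. induction u; simpl; [now grp|]. rewrite IHu; now grp. Qed.

Lemma nev_ghom (G H : group) (f : G -> H) g w : ghom f -> f (nev G g w) = nev H (fun k => f (g k)) w.
Proof. intros h; induction w; simpl; [now apply ghom1|]. now rewrite h, IHw. Qed.

Lemma nev_cg w : nev CG cg w = ncls w.
Proof.
  induction w as [|k w IH]; simpl; auto. rewrite IH. unfold cg. now rewrite <- ncls_app.
Qed.

Lemma nev_pow H g w n : nev H g (lpow w n) = gpow (nev H g w) n.
Proof. induction n; simpl; auto. now rewrite nev_app, IHn. Qed.

Lemma tfree_CG : tfree T CG.
Proof.
  intros x n Tn n0 E. destruct (ncls_surj x) as [w ->]. apply ncls_one.
  apply N_root with n; auto. apply ncls_one. now rewrite <- nev_cg, nev_pow, nev_cg.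
Qed.

Section LiftC.
Variables (H : group) (g : nat -> H).
Hypothesis gN : forall w, Nw w -> nev H g w = 1.

Definition clift : CG -> H := qlift (list nat) neq (@app _) [] ninv _ _ _ _ _ _ _ H (nev H g).

Lemma nev_neq w w' : neq w w' -> nev H g w = nev H g w'.
Proof.
  intros h. assert (h1 := gN _ h). assert (h2 := gN _ (Nw_invl w')).
  rewrite nev_app in *. apply (mulIg H (nev H g (ninv w'))). rewrite h1.
  apply (mulgI H (nev H g (ninv w'))). rewrite <- mulA, h2. now grp.
Qed.

Lemma clift_cls w : clift (ncls w) = nev H g w.
Proof. apply qlift_cls. exact nev_neq. Qed.

Lemma clift_hom : ghom clift.
Proof. apply qlift_hom; [exact nev_neq|]. intros; apply nev_app. Qed.
End LiftC.

Definition lcode (a : letter) : nat := if snd a then (2 * fst a)%nat else S (2 * fst a).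
(** Only the relators are coded, not the number of generators: every factor has infinitely many
    generators, and [nuw] kills those from [ngen P] on. *)
Definition pcode (P : pres) : nat := lenc (map lenc (map (map lcode) (rels P))).
Definition cgen (P : pres) (i : nat) : CG := cg (cp (pcode P) (2 * i)).

Lemma cg_inv j i : cg (cp j (S (2 * i))) = (cg (cp j (2 * i)))^-1.
Proof.
  apply (mulgI CG (cg (cp j (2 * i)))). rewrite mulgV. unfold cg.
  rewrite <- ncls_app. apply ncls_one. apply N_inv.
Qed.

Lemma cg_lev P a : cg (cp (pcode P) (lcode a)) = lev CG (cgen P) a.
Proof. destruct a as [i []]; unfold lcode, lev; simpl fst; simpl snd; cbv iota; auto. apply cg_inv. Qed.

Lemma cgen_rel P r : In r (rels P) -> wev CG (cgen P) r = 1.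
Proof.
  intros h. assert (X := @N_rel T (map (map lcode) (rels P)) (map lcode r) (in_map _ _ _ h)).
  fold (pcode P) in X. rewrite map_map in X. apply ncls_one in X. rewrite <- X, <- nev_cg.
  clear h X. induction r as [|a r IH]; simpl; auto. now rewrite IH, cg_lev.
Qed.

Section Retraction.
Variables (A : Z -> Prop) (P : pres).
Hypothesis TA : T = absset A.
Hypothesis wfP : wf_pres P.
Hypothesis tfP : torsion_free A P.

Definition nuw (k : nat) : word :=
  if (c1 k =? pcode P) && (c2 k / 2 <? ngen P) then [(c2 k / 2, Nat.even (c2 k))] else [].

Lemma nuw_code a : fst a < ngen P -> nuw (cp (pcode P) (lcode a)) = [a].
Proof.
  intros h. unfold nuw. rewrite c1_cp, c2_cp, Nat.eqb_refl. destruct a as [i []]; unfold lcode; simpl fst in *; simpl snd; cbv iota.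
  - rewrite div2_even, (proj2 (Nat.ltb_lt _ _) h), Nat.even_mul. reflexivity.
  - rewrite div2_odd, (proj2 (Nat.ltb_lt _ _) h), Nat.even_succ, Nat.odd_mul. reflexivity.
Qed.

Lemma nuw_wf w : wf_word P (flat_map nuw w).
Proof.
  induction w as [|k w IH]; simpl; [constructor|]. apply Forall_app; split; auto.
  unfold nuw. destruct (c1 k =? pcode P); [|constructor].
  destruct (Nat.ltb_spec (c2 k / 2) (ngen P)); constructor; auto.
Qed.

Lemma nev_nuw w : nev (pg P) (fun k => pcls P (nuw k)) w = pcls P (flat_map nuw w).
Proof. induction w; simpl; [reflexivity|]. now rewrite IHw, pcls_app. Qed.

(** Every constructor of [Ntriv] must remain valid after killing all letters foreign to [P].
    Relators of other factors become empty, and torsion-freeness of [P] enters for [N_root]. *)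
Lemma nu_trivial w : Nw w -> nev (pg P) (fun k => pcls P (nuw k)) w = 1.
Proof.
  induction 1 as [|j i|L w h|x y _ IHx _ IHy|a u _ IH|x z _ IHx _ IHz|w n Tn n0 _ IH].
  - reflexivity.
  - cbn [nev]. rewrite mulg1. rewrite <- pcls_app. unfold nuw. rewrite !c1_cp, !c2_cp.
    rewrite div2_even, div2_odd, Nat.even_succ, Nat.odd_mul, Nat.even_mul.
    destruct (_ && _); [|reflexivity]. simpl.
    change 1 with (pcls P []). apply pcls_eq. apply rst_step.
    apply (step_free P [] [] (_, true)).
  - rewrite nev_nuw. destruct (Nat.eq_dec (lenc (map lenc L)) (pcode P)) as [E|E].
    + rewrite E. apply lenc_inj in E.
      assert (EL : L = map (map lcode) (rels P)).
      { clear - E. revert E. generalize (map (map lcode) (rels P)). induction L as [|x L IH]; intros [|y L'] E; try discriminate; auto.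
        injection E as E1 E2. apply lenc_inj in E1. subst. f_equal; auto. }
      subst L. apply in_map_iff in h as [r [<- h]].
      assert (Er : flat_map nuw (map (cp (pcode P)) (map lcode r)) = r).
      { assert (wr := proj1 (Forall_forall _ _) wfP r h). clear - wr.
        induction wr as [|a r ha _ IH]; auto. simpl. rewrite nuw_code by auto. simpl. congruence. }
      rewrite Er. change 1 with (pcls P []). apply pcls_eq. apply rst_step.
      generalize (step_rel P [] [] r h). now rewrite app_nil_r.
    + replace (flat_map nuw _) with (@nil letter); [reflexivity|].
      clear h. induction w as [|k w IH]; auto. simpl. rewrite <- IH. unfold nuw.
      rewrite c1_cp, (proj2 (Nat.eqb_neq _ _) E). reflexivity.
  - rewrite nev_app, IHx, IHy. now grp.
  - rewrite nev_app. simpl in *. rewrite mulg1. apply (mulgI _ (pcls P (nuw a))).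
    rewrite <- mulA, IH. now grp.
  - rewrite nev_app, IHx in IHz. now rewrite mul1g in IHz.
  - rewrite nev_pow, nev_nuw in IH. rewrite nev_nuw. rewrite TA in Tn. destruct Tn as [z [Az Ez]].
    change 1 with (pcls P []). apply pcls_eq. apply tfP with z; auto; [apply nuw_wf|].
    apply wzpow_one. now rewrite Ez.
Qed.

Lemma cgen_inj w : wf_word P w -> wev CG (cgen P) w = 1 -> weq P w [].
Proof.
  intros h E. apply pcls_inj.
  apply (f_equal (clift (pg P) (fun k => pcls P (nuw k)))) in E.
  rewrite (wev_ghom _ _ _ _ _ (clift_hom _ _ nu_trivial)) in E.
  rewrite (ghom1 _ _ _ (clift_hom _ _ nu_trivial)) in E.
  change (pcls P []) with (@one (pg P)). rewrite <- E. rewrite <- wev_pgn.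
  apply wev_ext with P; auto. intros i hi. unfold cgen, cg. rewrite clift_cls by apply nu_trivial.
  cbn [nev]. rewrite mulg1. assert (X := nuw_code (i, true) hi).
  change (nuw (cp (pcode P) (2 * i)) = [(i, true)]) in X. rewrite X. reflexivity.
Qed.
End Retraction.
End Universal.

(** * A three-generator group *)

(* The unrestricted wreath product of [H] by [X]. *)
Definition wr (X H : group) : group.
Proof.
  refine (Group ((X -> H) * X)%type
    (fun a b => (fun i => fst a i * fst b (i * snd a), snd a * snd b)) (fun _ => 1, 1)
    (fun a => (fun i => (fst a (i * (snd a)^-1))^-1, (snd a)^-1)) _ _ _).
  - intros [f m] [g n] [h k]; simpl. f_equal; [apply functional_extensionality; intros i|]; grp.
  - intros [f m]; simpl. f_equal; [apply functional_extensionality; intros i|]; grp.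
  - intros [f m]; simpl. f_equal; [apply functional_extensionality; intros i|]; grp.
Defined.

Lemma wr_mul1 X H (a b : wr X H) i : fst (a * b) i = fst a i * fst b (i * snd a).
Proof. reflexivity. Qed.
Lemma wr_mul2 X H (a b : wr X H) : snd (a * b) = snd a * snd b.
Proof. reflexivity. Qed.
Lemma wr_inv1 X H (a : wr X H) i : fst a^-1 i = (fst a (i * (snd a)^-1))^-1.
Proof. reflexivity. Qed.
Lemma wr_inv2 X H (a : wr X H) : snd a^-1 = (snd a)^-1.
Proof. reflexivity. Qed.
Definition Zg : group.
Proof. refine (Group Z Z.add 0%Z Z.opp _ _ _); intros; lia. Defined.

Section Spelling.
Variables (H : group) (f : nat -> H).

Definition ak (k : nat) : H := f 0 ^ gpow (f 1%nat) k.
(** The commutator of [a_k] and [s], equal to [c_k] as soon as [a_k ^ s = a_k c_k]. *)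
Definition spellv (k : nat) : H := (ak k)^-1 * (ak k) ^ (f 2).

Lemma wev_repeat (a : letter) k : wev H f (repeat a k) = gpow (lev H f a) k.
Proof. induction k; simpl; congruence. Qed.

Lemma wev_spell k : wev H f (spell k) = spellv k.
Proof.
  unfold spell, spellv, ak. rewrite !wev_app, !wev_repeat. unfold lev; simpl. unfold lev; simpl.
  rewrite gpow_inv. unfold conj. grp.
Qed.

Lemma wev_spells w : wev H f (flat_map spell w) = nev H spellv w.
Proof. induction w; simpl; auto. now rewrite wev_app, wev_spell, IHw. Qed.
End Spelling.

Lemma ak_ghom (G H : group) (p : G -> H) f k : ghom p -> p (ak G f k) = ak H (fun i => p (f i)) k.
Proof. intros h. unfold ak. now rewrite ghomJ, ghomX by auto. Qed.

(* The countable group [CG T] embeds into a group with three generators [a], [y], [s]: adjoin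
   [s] with [a_k ^ s = a_k c_k] to the free product of [CG T] and the free group on [a], [y]. *)
Section ThreeGenerators.
Variable T : nat -> Prop.

Definition DG : group := fprod (CG T) bool.
Definition dlet (i : nat) : DG := match i with 0 => ht true | _ => ht false end.
Definition dak (k : nat) : DG := ak DG dlet k.
Definition dc (k : nat) : DG := hb (cg T k).
Definition srel (_ : unit) : DG -> DG -> Prop :=
  pgen (fun a b => exists k, a = dak k /\ b = dak k * dc k).

Definition dkill : DG -> DG := hlift (fun _ => 1) (fun b => ht b).
Lemma const1_hom (G H : group) : ghom (fun _ : G => 1 : H).
Proof. intros x y. now grp. Qed.

(** Killing [CG T] recovers [a_k] from [a_k c_k], so nothing but 1 is sent to 1. *)
Lemma srel_kill i a b : srel i a b -> dkill b = a.
Proof.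
  assert (hk : ghom dkill) by (apply hlift_hom; [apply const1_hom|apply triv_lift, const1_hom]).
  apply (pgen_min _ _ _ (fun a b => dkill b = a)).
  - split; [now apply ghom1|split].
    + intros x y z t <- <-. apply hk.
    + intros x y <-. now apply ghomV.
  - intros x y [k [-> ->]]. rewrite hk. unfold dc, dkill at 2.
    rewrite hlift_b by (try apply triv_lift; apply const1_hom). rewrite mulg1.
    unfold dak. rewrite ak_ghom by exact hk. unfold ak, dkill, dlet.
    now rewrite !hlift_t by (try apply triv_lift; apply const1_hom).
Qed.

(** Freeness of the [a_k] in wreath product form: [y] is the shift of the integers and [a] a
    function with the value prescribed for [a_k] at [-k], so [a_k = y^-k a y^k] takes this value at
    0. Prescribing [a_k c_k] shows that the left side of [srel] determines the right one. *)
Definition zhom (x : bool) : wr Zg DG :=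
  if x then (fun z : Zg => let k := Z.to_nat (- z) in dak k * dc k, 0%Z)
  else (fun _ => 1, 1%Z).
Definition dwr : DG -> wr Zg DG := hlift (fun _ => 1) zhom.

Lemma dwr_y k : gpow (zhom false) k = (fun _ => 1, Z.of_nat k) :> wr Zg DG.
Proof.
  induction k as [|k IH]; [reflexivity|]. cbn [gpow]. rewrite IH. unfold mul; simpl. f_equal.
  - apply functional_extensionality; intros i. now grp.
  - change (1 + Z.of_nat k = Z.of_nat (S k))%Z. lia.
Qed.

Lemma srel_wr i a b : srel i a b -> snd (dwr a) = 1 /\ fst (dwr a) 1 = b.
Proof.
  assert (hk : ghom dwr) by (apply hlift_hom; [apply const1_hom|apply triv_lift, const1_hom]).
  apply (pgen_min _ _ _ (fun a b => snd (dwr a) = 1 /\ fst (dwr a) 1 = b)).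
  - split; [|split].
    + rewrite (ghom1 _ _ _ hk). split; reflexivity.
    + intros x y z t [E1 <-] [E2 <-]. rewrite hk, wr_mul1, wr_mul2, E1, E2. split; now grp.
    + intros x y [E1 <-]. rewrite (ghomV _ _ _ _ hk), wr_inv1, wr_inv2, E1. split; now grp.
  - intros x y [k [-> ->]]. unfold dak at 1 2. rewrite ak_ghom by exact hk.
    unfold ak, dwr, dlet. rewrite !hlift_t by (try apply triv_lift; apply const1_hom).
    rewrite dwr_y. unfold conj. rewrite !wr_mul1, !wr_mul2, !wr_inv1, !wr_inv2. cbn [fst snd zhom].
    split.
    + unfold mul, inv, one; simpl. lia.
    + assert (Ek : forall z : Zg, z = (- Z.of_nat k)%Z -> Z.to_nat (- z) = k)
        by (intros z Ez; simpl in *; lia).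
      rewrite Ek by reflexivity. now grp.
Qed.

Lemma srel_ok : assoc_ok srel.
Proof.
  intros i. split; [apply subrel_pgen|split].
  - intros b h. apply srel_wr in h as [_ <-].
    rewrite (ghom1 _ _ dwr); [reflexivity|]. apply hlift_hom; [apply const1_hom|apply triv_lift, const1_hom].
  - intros b h. apply srel_kill in h as <-. apply ghom1.
    apply hlift_hom; [apply const1_hom|apply triv_lift, const1_hom].
Qed.

Definition CP : group := hnn DG unit srel srel_ok.
Definition cpl (i : nat) : CP := match i with 0 | 1 => hb (dlet i) | _ => ht tt end.
Definition cpemb (c : CG T) : CP := hb (hb c : DG).

Lemma cpemb_hom : ghom cpemb.
Proof. intros x y. unfold cpemb. now rewrite !hb_hom. Qed.

Lemma cpemb_inj c : cpemb c = 1 -> c = 1.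
Proof. intros h. now apply hb_inj, hb_inj in h. Qed.

Lemma tfree_CP : tfree T CP.
Proof. apply tfree_hnn, tfree_hnn, tfree_CG. Qed.

Lemma cp_ak k : ak CP cpl k = hb (dak k).
Proof. unfold dak. rewrite ak_ghom by apply hb_hom. reflexivity. Qed.

Lemma cp_spellv k : spellv CP cpl k = cpemb (cg T k).
Proof.
  assert (E : (hb (dak k) : CP) ^ (ht tt : CP) = hb (dak k * dc k)).
  { apply (ht_rel tt). apply pg_in. now exists k. }
  unfold spellv. rewrite cp_ak. cbn [cpl]. rewrite E.
  apply (mulgI CP (hb (dak k))). rewrite mulKVg. apply hb_hom.
Qed.

Lemma cp_word w : wev CP cpl (flat_map spell w) = cpemb (ncls T w).
Proof.
  rewrite wev_spells, <- nev_cg, nev_ghom by apply cpemb_hom.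
  induction w; simpl; auto. now rewrite IHw, cp_spellv.
Qed.

Section CPLift.
Variables (H : group) (f : nat -> H).
Hypothesis fN : forall w, Ntriv T w -> nev H (spellv H f) w = 1.

(** Universal property of [CP]: its three generators may go to any [f] for which the spellings of
    trivial words vanish. The image of [c_k] has to be the commutator [spellv], and with this choice
    the relation of the stable letter holds. *)
Definition dlift : DG -> H :=
  hlift (clift T H (spellv H f)) (fun b : bool => if b then f 0 else f 1%nat).
Definition cplift : CP -> H := hlift dlift (fun _ => f 2).

Lemma dlift_hom : ghom dlift.
Proof. apply hlift_hom; [|apply triv_lift]; now apply clift_hom. Qed.

Lemma dlift_c c : dlift (hb c) = clift T H (spellv H f) c.
Proof. apply hlift_b; [|apply triv_lift]; now apply clift_hom. Qed.

Lemma dlift_dlet i : i < 2 -> dlift (dlet i) = f i.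
Proof.
  intros h. destruct i as [|[|i]]; [| |lia]; unfold dlift, dlet;
    rewrite hlift_t; auto; try apply triv_lift; now apply clift_hom.
Qed.

Lemma dlift_rel i a b : srel i a b -> (dlift a) ^ (f 2) = dlift b.
Proof.
  assert (hk := dlift_hom). apply pgen_conj; auto. intros x y [k [-> ->]].
  rewrite hk. unfold dc, cg. rewrite dlift_c, clift_cls by exact fN.
  simpl. rewrite mulg1. unfold spellv.
  replace (dlift (dak k)) with (ak H f k); [now grp|].
  unfold dak. rewrite ak_ghom by exact hk. unfold ak. now rewrite !dlift_dlet by lia.
Qed.

Lemma cplift_hom : ghom cplift.
Proof. apply hlift_hom; [apply dlift_hom|apply dlift_rel]. Qed.

Lemma cplift_cpl i : i < 3 -> cplift (cpl i) = f i.
Proof.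
  intros h. unfold cplift, cpl.
  destruct i as [|[|[|i]]]; [| | |lia].
  - rewrite hlift_b; [apply dlift_dlet; lia|apply dlift_hom|apply dlift_rel].
  - rewrite hlift_b; [apply dlift_dlet; lia|apply dlift_hom|apply dlift_rel].
  - rewrite hlift_t; [reflexivity|apply dlift_hom|apply dlift_rel].
Qed.
End CPLift.

(** The three letters generate, since each [c_k] is the value of [spell k]. *)
Lemma CP_ind (P : CP -> Prop) : P 1 -> (forall i, i < 3 -> P (cpl i)) ->
  (forall x y, P x -> P y -> P (x * y)) -> (forall x, P x -> P x^-1) -> forall c, P c.
Proof.
  intros P1 Pl PM PV. apply hnn_ind; auto.
  - intros b. pattern b. apply hnn_ind.
    + rewrite (ghom1 _ _ _ hb_hom). auto.
    + intros c. destruct (ncls_surj T c) as [w ->]. fold (cpemb (ncls T w)). rewrite <- cp_word.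
      assert (L : forall u, Forall (fun a : letter => fst a < 3) u -> P (wev CP cpl u)).
      { induction 1 as [|[i x] u h _ IH]; simpl; auto. apply PM; auto. unfold lev; simpl in *.
        destruct x; auto. }
      apply L. apply Forall_flat_map, Forall_forall. intros k _. unfold spell.
      repeat (apply Forall_app; split); auto; apply Forall_forall;
        intros x hx; try apply repeat_spec in hx; simpl in *; intuition subst; simpl; lia.
    + intros [|]; [apply (Pl 0)|apply (Pl 1%nat)]; lia.
    + intros x y hx hy. rewrite hb_hom. auto.
    + intros x hx. rewrite (ghomV _ _ _ _ hb_hom). auto.
  - intros []. apply (Pl 2). lia.
Qed.
End ThreeGenerators.

(** * Configurations as group elements *)

Section IntegerPowers.
Variables (H : group).

Definition zp (h : H) (z : Z) : H :=
  if (0 <=? z)%Z then gpow h (Z.abs_nat z) else (gpow h (Z.abs_nat z))^-1.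

Lemma zp_nat h n : zp h (Z.of_nat n) = gpow h n.
Proof. unfold zp. destruct (Z.leb_spec 0 (Z.of_nat n)); [|lia]. f_equal. lia. Qed.

Lemma gpow_Sr (h : H) n : gpow h (S n) = gpow h n * h.
Proof. simpl. symmetry. apply comm_gpow. reflexivity. Qed.

Lemma zp_succ h z : zp h (Z.succ z) = zp h z * h.
Proof.
  unfold zp. destruct (Z.leb_spec 0 z).
  - destruct (Z.leb_spec 0 (Z.succ z)); [|lia].
    replace (Z.abs_nat (Z.succ z)) with (S (Z.abs_nat z)) by lia. apply gpow_Sr.
  - replace (Z.abs_nat z) with (S (Z.abs_nat (Z.succ z))) by lia. cbn [gpow].
    destruct (Z.leb_spec 0 (Z.succ z)).
    + replace (Z.abs_nat (Z.succ z)) with 0 by lia. simpl. now grp.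
    + now grp.
Qed.

Lemma zp_pred h z : zp h (Z.pred z) = zp h z * h^-1.
Proof. rewrite <- (Z.succ_pred z) at 2. rewrite zp_succ. now grp. Qed.

Lemma zp_add h a b : zp h (a + b) = zp h a * zp h b.
Proof.
  induction b as [|b IH|b IH] using Z.peano_ind.
  - rewrite Z.add_0_r. change (zp h 0) with (1 : H). now grp.
  - rewrite Z.add_succ_r, !zp_succ, IH. now grp.
  - rewrite Z.add_pred_r, !zp_pred, IH. now grp.
Qed.

Lemma zp_mul h m k : zp h (Z.of_nat m * k) = zp (gpow h m) k.
Proof.
  induction k as [|k IH|k IH] using Z.peano_ind.
  - now rewrite Z.mul_0_r.
  - now rewrite Z.mul_succ_r, zp_add, zp_succ, IH, zp_nat.
  - rewrite Z.mul_pred_r, zp_pred, <- IH, <- Z.add_opp_r, zp_add. f_equal.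
    rewrite <- zp_nat. apply (mulgI H (zp h (Z.of_nat m))). rewrite <- zp_add, Z.add_opp_diag_r.
    now rewrite mulgV.
Qed.

Lemma comm_zp x y a : comm x y -> comm (zp x a) y.
Proof.
  intros h. unfold zp. destruct (0 <=? a)%Z; [|apply comm_inv]; now apply comm_gpow.
Qed.

Lemma zp_conj x y a : (zp x a) ^ y = zp (x ^ y) a.
Proof. unfold zp. destruct (0 <=? a)%Z; rewrite ?conj_inv, gpow_conj; reflexivity. Qed.
End IntegerPowers.
Arguments zp {H}.

(** * The free abelian group of rank [n] *)

Section Lattice.
Variable n : nat.

Definition lat_car := {f : nat -> Z | forall i, n <= i -> f i = 0%Z}.
Lemma lat_eq (x y : lat_car) : (forall i, i < n -> proj1_sig x i = proj1_sig y i) -> x = y.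
Proof.
  intros h. destruct x as [f hf], y as [g hg]; simpl in h.
  assert (f = g).
  { apply functional_extensionality; intros i. destruct (lt_dec i n); auto.
    rewrite hf, hg; auto; lia. }
  subst g. f_equal. apply proof_irrelevance.
Qed.

Definition mkl (f : nat -> Z) : lat_car.
Proof.
  exists (fun i => if i <? n then f i else 0%Z). intros i h.
  now rewrite (proj2 (Nat.ltb_ge _ _) h).
Defined.

Definition Lat : group.
Proof.
  refine (Group lat_car (fun x y => mkl (fun i => proj1_sig x i + proj1_sig y i)%Z)
            (mkl (fun _ => 0%Z)) (fun x => mkl (fun i => - proj1_sig x i)%Z) _ _ _);
    intros; apply lat_eq; intros i h; simpl; rewrite (proj2 (Nat.ltb_lt _ _) h); lia.
Defined.

Definition lx (x : Lat) (i : nat) : Z := proj1_sig x i.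
Definition mkL (f : nat -> Z) : Lat := mkl f.

Lemma lx_mul x y i : lx (x * y) i = (lx x i + lx y i)%Z.
Proof.
  unfold lx, mul; simpl. destruct (Nat.ltb_spec i n); auto.
  destruct x as [f hf], y as [g hg]; simpl. rewrite hf, hg; auto.
Qed.
Lemma lx_inv x i : lx x^-1 i = (- lx x i)%Z.
Proof.
  unfold lx, inv; simpl. destruct (Nat.ltb_spec i n); auto.
  destruct x as [f hf]; simpl. rewrite hf; auto.
Qed.
Lemma lx_one i : lx 1 i = 0%Z.
Proof. unfold lx, one; simpl. now destruct (i <? n). Qed.
Lemma lx_mk f i : i < n -> lx (mkL f) i = f i.
Proof. intros h. unfold lx; simpl. now rewrite (proj2 (Nat.ltb_lt _ _) h). Qed.
Lemma lx_eq (x y : Lat) : (forall i, i < n -> lx x i = lx y i) -> x = y.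
Proof. apply lat_eq. Qed.

Lemma Lat_comm (x y : Lat) : x * y = y * x.
Proof. apply lx_eq. intros i _. rewrite !lx_mul. lia. Qed.

Lemma lx_pow x k i : lx (gpow x k) i = (Z.of_nat k * lx x i)%Z.
Proof. induction k; cbn [gpow]; [apply lx_one|]. rewrite lx_mul, IHk. lia. Qed.

Lemma tfree_Lat T : tfree T Lat.
Proof.
  intros x k _ k0 E. apply lx_eq. intros i _. rewrite lx_one.
  apply (f_equal (fun y => lx y i)) in E. rewrite lx_pow, lx_one in E. nia.
Qed.

Section Lift.
Variables (H : group) (xi : nat -> H).
Fixpoint latp (f : nat -> Z) (i : nat) : H :=
  match i with 0 => 1 | S j => latp f j * zp (xi j) (f j) end.
Definition latlift (x : Lat) : H := latp (lx x) n.

Lemma latp_comm f k z : (forall i, i < k -> comm (xi i) z) -> comm (latp f k) z.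
Proof.
  induction k as [|k IH]; intros h; simpl; [apply comm_one|].
  apply comm_mul; [apply IH; auto|]. apply comm_zp. apply h. lia.
Qed.

Lemma latlift_comm x z : (forall i, i < n -> comm (xi i) z) -> comm (latlift x) z.
Proof. apply latp_comm. Qed.

Hypothesis xi_comm : forall i j, i < n -> j < n -> comm (xi i) (xi j).

Lemma latlift_hom : ghom latlift.
Proof.
  intros x y. unfold latlift.
  assert (X : forall k, k <= n -> latp (lx (x * y)) k = latp (lx x) k * latp (lx y) k); [|now apply X].
  induction k as [|k IH]; intros h; cbn [latp]; [now grp|].
  rewrite IH by lia. rewrite lx_mul, zp_add.
  assert (C : comm (latp (lx y) k) (zp (xi k) (lx x k))).
  { apply latp_comm. intros i hi. apply comm_sym, comm_zp. apply xi_comm; lia. }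
  unfold comm in C. rewrite !mulA. f_equal. rewrite <- !mulA. f_equal. exact C.
Qed.
End Lift.
End Lattice.
Arguments lx {n}.
Arguments mkL {n}.

(* [bt ^ bx x] plays the role of the configuration [x], and [bf u * bt ^ bx x] of the
   configuration [x] reached with output [u].  A rule sends [a * u] to [a' * u'], for
   [theta u u'], with output [z]. *)
Section Configurations.
Variables X F : group.
Hypothesis Xab : forall x y : X, x * y = y * x.

Definition YG : group := prodg X F.
Definition BG : group := fprod YG unit.
Definition bx (x : X) : BG := hin1 X F unit _ (triv_ok YG unit) x.
Definition bf (f : F) : BG := hin2 X F unit _ (triv_ok YG unit) f.
Definition bt : BG := ht tt.

Lemma bx_hom : ghom bx.
Proof. apply hin1_hom. Qed.
Lemma bf_hom : ghom bf.
Proof. apply hin2_hom. Qed.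
Lemma bf_snd1 : bf (snd (1 : YG)) = 1.
Proof. exact (ghom1 _ _ _ bf_hom). Qed.
Lemma hb_bxf (x : X) (f : F) : (hb ((x, f) : YG) : BG) = bx x * bf f.
Proof. apply hb_pair. Qed.
Lemma bxf_comm x f : comm (bx x) (bf f).
Proof. apply hin_comm. Qed.
Lemma bx_comm x y : comm (bx x) (bx y).
Proof. unfold comm. now rewrite <- !bx_hom, Xab. Qed.

Lemma bx_conj x y : (bx x) ^ (bx y)^-1 = bx x.
Proof. apply conj_comm, comm_sym, comm_inv, bx_comm. Qed.
Lemma bf_conj f y : (bf f) ^ (bx y)^-1 = bf f.
Proof. apply conj_comm, comm_sym, comm_inv, bxf_comm. Qed.

Section Rule.
Variables (theta : X -> X -> Prop) (a a' : X) (z : F).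
Hypothesis theta_sub : subrel theta.
Hypothesis theta_l : forall x, theta 1 x -> x = 1.
Hypothesis theta_r : forall x, theta x 1 -> x = 1.

Inductive rpair : BG -> BG -> Prop :=
| rp_x x x' : theta x x' -> rpair (bx x) (bx x')
| rp_f f : rpair (bf f) (bf f)
| rp_t : rpair (bt ^ bx a) (bf z * bt ^ bx a').

(** The associated subgroups of a free product are trivial, so [extension] asks no more than that
    [M] be a well-defined homomorphism. *)
Lemma ext_triv (G : group) (M : YG -> G -> Prop) (tau : unit -> G) :
  subrel M -> (forall h, M 1 h -> h = 1) ->
  forall k g, pgen (ext_gen YG unit _ (triv_ok YG unit) G M tau) k g -> k = 1 -> g = 1.
Proof.
  intros sM fM. apply (extension M tau sM fM).
  - intros i b b' h m [-> ->]. apply fM in m as ->. rewrite conj_one. apply sM.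
  - intros i b b' h m [-> ->]. apply fM in m as ->. rewrite conj_one. apply sM.
Qed.

Definition graphM (t : X -> X -> Prop) (y : YG) (g : BG) :=
  exists x', t (fst y) x' /\ g = bx x' * bf (snd y).

Lemma graphM_sub (t : X -> X -> Prop) : subrel t -> subrel (graphM t).
Proof.
  intros [t1 [tm tv]]. split; [|split].
  - exists 1. split; auto. rewrite (ghom1 _ _ _ bx_hom), bf_snd1. now grp.
  - intros y g y' g' [x [h ->]] [x' [h' ->]]. exists (x * x'). split; [now apply tm|].
    rewrite bx_hom. change (snd (y * y')) with (snd y * snd y'). rewrite bf_hom.
    assert (C := bxf_comm x' (snd y)). unfold comm in C. rewrite !mulA. f_equal.
    rewrite <- !mulA. now rewrite C.
  - intros y g [x [h ->]]. exists (x^-1). split; [now apply tv|].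
    rewrite (ghomV _ _ _ _ bx_hom). change (snd y^-1) with (snd y)^-1.
    rewrite (ghomV _ _ _ _ bf_hom), invMg. assert (C := bxf_comm x (snd y)).
    unfold comm in C. rewrite <- !invMg. f_equal. now symmetry.
Qed.

Lemma graphM_fun (t : X -> X -> Prop) : (forall x, t 1 x -> x = 1) ->
  forall g, graphM t 1 g -> g = 1.
Proof.
  intros h g [x' [hx ->]]. apply h in hx as ->.
  rewrite (ghom1 _ _ _ bx_hom), bf_snd1. now grp.
Qed.

(** Conjugation by [(bx a)^-1] fixes lattice and output elements and turns [bt ^ bx a] into the free
    letter [bt], which may be sent anywhere; [extension] then yields the map prescribed by the
    rule. *)
Lemma rule_l b b' : pgen rpair b b' -> b = 1 -> b' = 1.
Proof.
  intros p. assert (E : pgen (ext_gen YG unit _ (triv_ok YG unit) BG (graphM theta)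
              (fun _ => bf z * bt ^ bx a')) (b ^ (bx a)^-1) b').
  { revert b b' p. apply pgen_min with (R := fun b b' => pgen _ (b ^ (bx a)^-1) b').
    - split; [|split].
      + rewrite conj_one. apply pg_1.
      + intros. rewrite conj_mul. now apply pg_mul.
      + intros. rewrite conj_inv. now apply pg_inv.
    - intros b b' [x x' h|f|]; apply pg_in.
      + rewrite bx_conj. apply eg_b.
        exists x'. split; auto. simpl. rewrite (ghom1 _ _ _ bf_hom). now grp.
      + rewrite bf_conj. apply eg_b.
        exists 1. split; [apply theta_sub|]. rewrite (ghom1 _ _ _ bx_hom). simpl. now grp.
      + rewrite conj_conj, mulgV, conjg1.
        exact (eg_t YG unit _ (triv_ok YG unit) BG (graphM theta) (fun _ => bf z * bt ^ bx a') tt). }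
  intros ->. rewrite conj_one in E. eapply ext_triv; [| |exact E|reflexivity].
  - now apply graphM_sub.
  - now apply graphM_fun.
Qed.

(** Removes the output [z]: after conjugation by [(bx a')^-1] it sends the right side of a rule to
    the free letter [bt], and the argument of [rule_l] works backwards. *)
Definition untwist : BG -> BG := hlift (fun y : YG => hb y) (fun _ => (bf z)^-1 * bt).

Lemma untwist_hom : ghom untwist.
Proof. apply hlift_hom; [apply hb_hom|apply triv_lift, hb_hom]. Qed.
Lemma untwist_b y : untwist (hb y) = hb y.
Proof. apply hlift_b; [apply hb_hom|apply triv_lift, hb_hom]. Qed.
Lemma untwist_t : untwist bt = (bf z)^-1 * bt.
Proof.
  exact (hlift_t (Rok := triv_ok YG unit) (fun y : YG => hb y) (fun _ => (bf z)^-1 * bt) hb_hom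
           (triv_lift _ _ hb_hom) tt).
Qed.

Lemma rule_r b b' : pgen rpair b b' -> b' = 1 -> b = 1.
Proof.
  set (th := fun x x' => theta x' x).
  assert (th_sub : subrel th).
  { destruct theta_sub as [h1 [h2 h3]]. unfold th. split; [|split]; auto. }
  intros p. assert (E : pgen (ext_gen YG unit _ (triv_ok YG unit) BG (graphM th)
              (fun _ => bt ^ bx a)) (untwist (b' ^ (bx a')^-1)) b).
  { revert b b' p. apply pgen_min with (R := fun b b' => pgen _ (untwist (b' ^ (bx a')^-1)) b).
    - split; [|split].
      + rewrite conj_one, (ghom1 _ _ _ untwist_hom). apply pg_1.
      + intros. rewrite conj_mul, untwist_hom. now apply pg_mul.
      + intros. rewrite conj_inv, (ghomV _ _ _ _ untwist_hom). now apply pg_inv.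
    - intros b b' [x x' h|f|]; apply pg_in.
      + rewrite bx_conj.
        rewrite (untwist_b (x', 1) : untwist (bx x') = bx x'). apply eg_b.
        exists x. split; auto. simpl. rewrite (ghom1 _ _ _ bf_hom). now grp.
      + rewrite bf_conj.
        rewrite (untwist_b (1, f) : untwist (bf f) = bf f). apply eg_b.
        exists 1. split; [apply th_sub|]. rewrite (ghom1 _ _ _ bx_hom). simpl. now grp.
      + rewrite conj_mul, conj_conj, mulgV, conjg1.
        rewrite bf_conj.
        rewrite untwist_hom, untwist_t. rewrite (untwist_b (1, z) : untwist (bf z) = bf z).
        rewrite mulKVg.
        exact (eg_t YG unit _ (triv_ok YG unit) BG (graphM th) (fun _ => bt ^ bx a) tt). }
  intros ->. rewrite conj_one, (ghom1 _ _ _ untwist_hom) in E.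
  eapply ext_triv; [| |exact E|reflexivity].
  - now apply graphM_sub.
  - apply graphM_fun. exact theta_r.
Qed.

Lemma rule_ok : subrel (pgen rpair) /\ (forall b, pgen rpair 1 b -> b = 1) /\
  (forall b, pgen rpair b 1 -> b = 1).
Proof.
  split; [apply subrel_pgen|split]; intros b h.
  - now apply (rule_l _ _ h).
  - now apply (rule_r _ _ h).
Qed.

Section Value.
Variables (C : group) (phi : F -> C).
Hypothesis phi_hom : ghom phi.

(* The homomorphism with [bf f] mapped to the constant [phi f] and [bt ^ bx x] to a function
   with value [h x] at [1]. *)
Definition Tbase (y : YG) : wr X C := (fun _ => phi (snd y), fst y).
Definition Theta (h : X -> C) : BG -> wr X C :=
  hlift Tbase (fun _ => (fun i => h i^-1, 1) : wr X C).

Lemma Theta_base : ghom Tbase.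
Proof.
  intros x y.
  transitivity ((fun _ => phi (snd x * snd y), fst x * fst y) : wr X C); [reflexivity|].
  rewrite phi_hom. reflexivity.
Qed.
Lemma Theta_hom h : ghom (Theta h).
Proof. apply hlift_hom; [apply Theta_base|apply triv_lift, Theta_base]. Qed.
Lemma Theta_x h x : Theta h (bx x) = ((fun _ => 1, x) : wr X C).
Proof.
  unfold Theta, bx, hin1. rewrite hlift_b by (try apply triv_lift; apply Theta_base).
  unfold Tbase; simpl. now rewrite (ghom1 _ _ _ phi_hom).
Qed.
Lemma Theta_f h f : Theta h (bf f) = ((fun _ => phi f, 1) : wr X C).
Proof. unfold Theta, bf, hin2. now rewrite hlift_b by (try apply triv_lift; apply Theta_base). Qed.
Lemma Theta_t h x : Theta h (bt ^ bx x) = ((fun i => h (x * i^-1), 1) : wr X C).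
Proof.
  rewrite (ghomJ _ _ _ _ _ (Theta_hom h)), Theta_x.
  unfold Theta at 1. unfold bt. rewrite hlift_t by (try apply triv_lift; apply Theta_base).
  unfold conj. apply injective_projections; [apply functional_extensionality; intros i|];
    rewrite ?wr_mul1, ?wr_mul2, ?wr_inv1, ?wr_inv2; cbn [fst snd]; now grp.
Qed.

(** Values at 1 alone do not multiply, because the lattice part shifts arguments. The invariant
    therefore compares the functions at all arguments related by [theta]. *)
Lemma Theta_rule h1 h2 : (forall u u', theta u u' -> h1 (a * u) = phi z * h2 (a' * u')) ->
  forall b b', pgen rpair b b' -> theta (snd (Theta h1 b)) (snd (Theta h2 b')) /\
   forall u u', theta u u' -> fst (Theta h1 b) u = fst (Theta h2 b') u'.
Proof.
  intros hh. assert (theta_sub' := theta_sub). destruct theta_sub' as [t1 [tm tv]].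
  assert (H1 := Theta_hom h1). assert (H2 := Theta_hom h2).
  apply pgen_min with (R := fun b b' => theta (snd (Theta h1 b)) (snd (Theta h2 b')) /\
   forall u u', theta u u' -> fst (Theta h1 b) u = fst (Theta h2 b') u').
  - split; [|split].
    + rewrite (ghom1 _ _ _ H1), (ghom1 _ _ _ H2). split; auto.
    + intros b b' c c' [e1 e2] [e3 e4]. rewrite H1, H2. rewrite !wr_mul2. split; [now apply tm|].
      intros u u' t. rewrite H1, H2, !wr_mul1. f_equal; auto.
    + intros b b' [e1 e2]. rewrite (ghomV _ _ _ _ H1), (ghomV _ _ _ _ H2), !wr_inv2.
      split; [now apply tv|]. intros u u' t. rewrite ?(ghomV _ _ _ _ H1), ?(ghomV _ _ _ _ H2), !wr_inv1. f_equal; auto.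
  - intros b b' [x x' h|f|].
    + rewrite !Theta_x. simpl. auto.
    + rewrite !Theta_f. simpl. auto.
    + split.
      * rewrite H2, Theta_f, !Theta_t, wr_mul2. cbn [snd]. now rewrite mul1g.
      * intros u u' t. rewrite H2, Theta_f, !Theta_t, wr_mul1. cbn [fst snd].
        rewrite mulg1. apply hh. now apply tv.
Qed.

Variable V : X -> C -> Prop.
Hypothesis Vfun : forall x g g', V x g -> V x g' -> g = g'.
Hypothesis Vrule : forall u u' g, theta u u' -> (V (a * u) (phi z * g) <-> V (a' * u') g).

Definition extends (h : X -> C) := forall x g, V x g -> h x = g.
(* The value of [b] at [1], if it depends on valid configurations only. *)
Definition valM (b : BG) (g : C) := forall h, extends h -> snd (Theta h b) = 1 /\ fst (Theta h b) 1 = g.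

Lemma theta_fun x y y' : theta x y -> theta x y' -> y = y'.
Proof. apply subrel_fun; auto. Qed.

Lemma theta_fun' x x' y : theta x y -> theta x' y -> x = x'.
Proof.
  apply (subrel_fun (fun x y => theta y x)); auto.
  destruct theta_sub as [h1 [h2 h3]]. split; [|split]; auto.
Qed.

(** A given extension [h2] is pulled back along the rule: [h1] is forced on the source coset of the
    rule and copied from [h2] elsewhere. [Vrule] ensures that [h1] extends [V] again, and
    [Theta_rule] compares the two. *)
Lemma valM_fwd b b' g : valM b g -> pgen rpair b b' -> valM b' g.
Proof.
  intros m p h2 e2.
  set (h1 := fun x => epsilon (inhabits 1) (fun y =>
     (exists u u', theta u u' /\ x = a * u /\ y = phi z * h2 (a' * u')) \/
     (~ (exists u u', theta u u' /\ x = a * u) /\ y = h2 x))).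
  assert (s1 : forall x, (exists u u', theta u u' /\ x = a * u /\ h1 x = phi z * h2 (a' * u')) \/
     (~ (exists u u', theta u u' /\ x = a * u) /\ h1 x = h2 x)).
  { intros x. unfold h1. apply epsilon_spec.
    destruct (classic (exists u u', theta u u' /\ x = a * u)) as [[u [u' [t ->]]]|n].
    - eexists. left. exists u, u'. auto.
    - exists (h2 x). auto. }
  clearbody h1.
  assert (c1 : forall u u', theta u u' -> h1 (a * u) = phi z * h2 (a' * u')).
  { intros u u' t. destruct (s1 (a * u)) as [[v [v' [t' [E E']]]]|[n _]].
    - apply mulgI in E. subst v. rewrite E'. now rewrite (theta_fun _ _ _ t t').
    - destruct n. now exists u, u'. }
  assert (e1 : extends h1).
  { intros x d v. destruct (s1 x) as [[u [u' [t [-> E]]]]|[_ ->]]; [|now apply e2].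
    rewrite E. rewrite <- (mulKVg _ (phi z) d). f_equal. apply e2.
    apply (Vrule u u' _ t). now rewrite mulKVg. }
  destruct (m h1 e1) as [m1 m2]. destruct (Theta_rule h1 h2 c1 b b' p) as [p1 p2].
  rewrite m1 in p1. split; [now apply theta_l|].
  rewrite <- (p2 1 1); auto. apply theta_sub.
Qed.

Lemma valM_bwd b b' g : valM b' g -> pgen rpair b b' -> valM b g.
Proof.
  intros m p h1 e1.
  set (h2 := fun x => epsilon (inhabits 1) (fun y =>
     (exists u u', theta u u' /\ x = a' * u' /\ y = (phi z)^-1 * h1 (a * u)) \/
     (~ (exists u u', theta u u' /\ x = a' * u') /\ y = h1 x))).
  assert (s2 : forall x, (exists u u', theta u u' /\ x = a' * u' /\ h2 x = (phi z)^-1 * h1 (a * u)) \/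
     (~ (exists u u', theta u u' /\ x = a' * u') /\ h2 x = h1 x)).
  { intros x. unfold h2. apply epsilon_spec.
    destruct (classic (exists u u', theta u u' /\ x = a' * u')) as [[u [u' [t ->]]]|n].
    - eexists. left. exists u, u'. auto.
    - exists (h1 x). auto. }
  clearbody h2.
  assert (c1 : forall u u', theta u u' -> h1 (a * u) = phi z * h2 (a' * u')).
  { intros u u' t. destruct (s2 (a' * u')) as [[v [v' [t' [E E']]]]|[n _]].
    - apply mulgI in E. subst v'. rewrite E', mulKVg. now rewrite (theta_fun' _ _ _ t t').
    - destruct n. now exists u, u'. }
  assert (e2 : extends h2).
  { intros x d v. destruct (s2 x) as [[u [u' [t [-> E]]]]|[_ ->]]; [|now apply e1].
    rewrite E. rewrite (e1 (a * u) (phi z * d)); [now rewrite mulKg|]. now apply (Vrule u u' _ t). }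
  destruct (m h2 e2) as [m1 m2]. destruct (Theta_rule h1 h2 c1 b b' p) as [p1 p2].
  rewrite m1 in p1. split; [now apply theta_r|].
  rewrite (p2 1 1); auto. apply theta_sub.
Qed.

Lemma valM_sub : subrel valM.
Proof.
  split; [|split].
  - intros h _. rewrite (ghom1 _ _ _ (Theta_hom h)). split; reflexivity.
  - intros b g b' g' m m' h e. destruct (m h e) as [m1 m2], (m' h e) as [m3 m4].
    rewrite (Theta_hom h), wr_mul1, wr_mul2, m1, m2, m3, mulg1, m4. split; now grp.
  - intros b g m h e. destruct (m h e) as [m1 m2].
    rewrite (ghomV _ _ _ _ (Theta_hom h)), wr_inv1, wr_inv2, m1, invg1, mulg1, m2. split; now grp.
Qed.

Lemma extends_exists : exists h, extends h.
Proof.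
  exists (fun x => epsilon (inhabits 1) (V x)). intros x g v.
  apply (Vfun x); auto. apply epsilon_spec. now exists g.
Qed.

Lemma valM_fun g : valM 1 g -> g = 1.
Proof.
  intros m. destruct extends_exists as [h e]. destruct (m h e) as [_ <-].
  now rewrite (ghom1 _ _ _ (Theta_hom h)).
Qed.

Lemma valM_f f : valM (bf f) (phi f).
Proof. intros h _. rewrite Theta_f. split; reflexivity. Qed.

Lemma valM_t x g : V x g -> valM (bt ^ bx x) g.
Proof.
  intros v h e. rewrite Theta_t. cbn [fst snd]. split; auto. rewrite invg1, mulg1. now apply e.
Qed.
End Value.
End Rule.
End Configurations.

(** * The tower of extensions *)

Definition opr (p : op) : nat := match p with OInc r | ODec r | OZero r => r | _ => 0 end.
(** The coordinate of the register goes from [opb + opm * k] to [opb + opm' * k]. On powers of 2,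
    incrementing doubles, decrementing halves, and a zero test is the identity on odd numbers, among
    which 1 is the only power of 2. *)
Definition opm (p : op) : nat := match p with ODec _ | OZero _ => 2 | _ => 1%nat end.
Definition opm' (p : op) : nat := match p with OInc _ | OZero _ => 2 | _ => 1%nat end.
Definition opb (p : op) : Z := match p with OZero _ => 1%Z | _ => 0%Z end.
Definition opo (p : op) : word := match p with OEmit a => [a] | _ => [] end.

Definition zero : st := fun _ => 0.

(* Coordinate 0 of a configuration is the state, and coordinate [S r] is [2 ^ s r]. *)
Section Encoding.
Variable R : nat.
Notation X := (Lat (S R)).

Definition theta (p : op) (x x' : X) : Prop :=
  lx x 0 = 0%Z /\ lx x' 0 = 0%Z /\ (forall j, j <> S (opr p) -> lx x j = lx x' j) /\
  exists k, lx x (S (opr p)) = (Z.of_nat (opm p) * k)%Z /\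
            lx x' (S (opr p)) = (Z.of_nat (opm' p) * k)%Z.

Lemma theta_sub p : subrel (theta p).
Proof.
  split; [|split].
  - split; [apply lx_one|split; [apply lx_one|split]].
    + intros; now rewrite !lx_one.
    + exists 0%Z. rewrite !lx_one. lia.
  - intros a b c d [h1 [h2 [h3 [k [h4 h5]]]]] [h1' [h2' [h3' [k' [h4' h5']]]]].
    split; [|split; [|split]].
    + rewrite lx_mul. lia.
    + rewrite lx_mul. lia.
    + intros j hj. rewrite !lx_mul, h3, h3'; auto.
    + exists (k + k')%Z. rewrite !lx_mul. lia.
  - intros a b [h1 [h2 [h3 [k [h4 h5]]]]].
    split; [|split; [|split]].
    + rewrite lx_inv. lia.
    + rewrite lx_inv. lia.
    + intros j hj. rewrite !lx_inv, h3; auto.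
    + exists (- k)%Z. rewrite !lx_inv. lia.
Qed.

Lemma op_pos p : (0 < Z.of_nat (opm p))%Z /\ (0 < Z.of_nat (opm' p))%Z.
Proof. destruct p; simpl; lia. Qed.

Lemma theta_l p x : theta p 1 x -> x = 1.
Proof.
  intros [h1 [h2 [h3 [k [h4 h5]]]]]. apply lx_eq. intros i _. rewrite lx_one in *.
  destruct (Nat.eq_dec i (S (opr p))) as [->|h].
  - assert (H := op_pos p). assert (k = 0%Z) by nia. subst k. lia.
  - rewrite <- h3 by auto. apply lx_one.
Qed.

Lemma theta_r p x : theta p x 1 -> x = 1.
Proof.
  intros [h1 [h2 [h3 [k [h4 h5]]]]]. apply lx_eq. intros i _. rewrite lx_one in *.
  destruct (Nat.eq_dec i (S (opr p))) as [->|h].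
  - assert (H := op_pos p). assert (k = 0%Z) by nia. subst k. lia.
  - rewrite h3 by auto. apply lx_one.
Qed.

(** The base point of the coset on which a rule acts. As [theta] has coordinate 0 equal to 0, the
    rule applies in state [q] only. *)
Definition av (q : nat) (p : op) : X :=
  mkL (fun j => if j =? 0 then Z.of_nat q else if j =? S (opr p) then opb p else 0%Z).
Definition cfgx (q : nat) (s : st) : X :=
  mkL (fun j => match j with 0 => Z.of_nat q | S r => (2 ^ Z.of_nat (s r))%Z end).

Definition Cfg (x : X) (q : nat) (s : st) : Prop :=
  lx x 0 = Z.of_nat q /\ (forall r, r < R -> lx x (S r) = (2 ^ Z.of_nat (s r))%Z) /\
  (forall r, R <= r -> s r = 0).

Lemma Cfg_cfgx q s : (forall r, R <= r -> s r = 0) -> Cfg (cfgx q s) q s.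
Proof.
  intros h. split; [|split; [|exact h]].
  - unfold cfgx. now rewrite lx_mk by lia.
  - intros r hr. unfold cfgx. now rewrite lx_mk by lia.
Qed.

Lemma cfgx_Cfg x q s : Cfg x q s -> x = cfgx q s.
Proof.
  intros [h1 [h2 _]]. apply lx_eq. intros [|r] hr; unfold cfgx; rewrite lx_mk by lia; auto.
  apply h2. lia.
Qed.

Lemma Cfg_fun x q s q' s' : Cfg x q s -> Cfg x q' s' -> q = q' /\ s = s'.
Proof.
  intros [h1 [h2 h3]] [h1' [h2' h3']]. split; [lia|].
  apply functional_extensionality; intros r. destruct (lt_dec r R) as [h|h].
  - assert (E : (2 ^ Z.of_nat (s r) = 2 ^ Z.of_nat (s' r))%Z) by (rewrite <- h2, <- h2'; auto).
    apply Z.pow_inj_r in E; lia.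
  - rewrite h3, h3'; auto; lia.
Qed.

Lemma pow2_S n : (2 ^ Z.of_nat (S n) = 2 * 2 ^ Z.of_nat n)%Z.
Proof. rewrite Nat2Z.inj_succ, Z.pow_succ_r; lia. Qed.

Lemma opstep_theta q q' o s s' : opr o < R -> opstep o s (opo o) s' ->
  theta o ((av q o)^-1 * cfgx q s) ((av q' o)^-1 * cfgx q' s').
Proof.
  intros hR st.
  assert (L : forall q s j, j < S R -> lx ((av q o)^-1 * cfgx q s) j =
    (match j with O => Z.of_nat q | S r => 2 ^ Z.of_nat (s r) end -
     (if (j =? 0)%nat then Z.of_nat q else if (j =? S (opr o))%nat then opb o else 0))%Z).
  { intros q0 s0 j hj. rewrite lx_mul, lx_inv. unfold av, cfgx. rewrite !lx_mk by auto. lia. }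
  assert (L' : forall (x : Lat (S R)) j, S R <= j -> lx x j = 0%Z) by (intros [f hf] j hj; now apply hf).
  split; [|split; [|split]].
  - rewrite L by lia. simpl. lia.
  - rewrite L by lia. simpl. lia.
  - intros [|j] hj.
    + rewrite !L by lia. simpl. lia.
    + destruct (lt_dec (S j) (S R)) as [h|h]; [|now rewrite !L' by lia].
      rewrite !L by lia. f_equal. f_equal. f_equal.
      inversion st; subst; simpl in hj; auto; upd.
  - rewrite !L by lia. cbn [Nat.eqb]. rewrite Nat.eqb_refl.
    inversion st; subst; cbn [opr opb opm opm' opo].
    + exists (2 ^ Z.of_nat (s r))%Z. replace (upd s r (S (s r)) r) with (S (s r)) by upd.
      rewrite pow2_S. lia.
    + exists (2 ^ Z.of_nat n)%Z. replace (upd s r n r) with n by upd.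
      rewrite H, pow2_S. lia.
    + exists 0%Z. rewrite H. simpl. lia.
    + eexists; split; [symmetry; apply Z.mul_1_l|]. lia.
    + eexists; split; [symmetry; apply Z.mul_1_l|]. lia.
Qed.

Lemma opstep_other o s w s' r : opstep o s w s' -> r <> opr o -> s' r = s r.
Proof. intros st h. inversion st; subst; simpl in h; auto; upd. Qed.

Lemma Cfg_state q o u q0 s : lx u 0 = 0%Z -> Cfg (av q o * u) q0 s -> q0 = q.
Proof.
  intros h [c _]. rewrite lx_mul, h in c. unfold av in c. rewrite lx_mk in c by lia. simpl in c. lia.
Qed.

Lemma Cfg_reg q o u q0 s : opr o < R -> Cfg (av q o * u) q0 s ->
  (opb o + lx u (S (opr o)) = 2 ^ Z.of_nat (s (opr o)))%Z.
Proof.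
  intros h [_ [c _]]. rewrite <- (c _ h), lx_mul. unfold av. rewrite lx_mk by lia. simpl.
  now rewrite Nat.eqb_refl.
Qed.

Lemma Cfg_coset q o u s : Cfg (av q o * u) q s -> u = (av q o)^-1 * cfgx q s.
Proof. intros c. rewrite <- (cfgx_Cfg _ _ _ c). now rewrite mulKg. Qed.

(** A configuration in the source coset really admits the operation: an even power of 2 belongs to a
    positive register, an odd one to an empty register. The linear map then has to agree with the
    machine step. *)
Lemma Cfg_fwd p q q' q0 u u' s : opr p < R -> theta p u u' -> Cfg (av q p * u) q0 s ->
  q0 = q /\ exists s', opstep p s (opo p) s' /\ Cfg (av q' p * u') q' s'.
Proof.
  intros hR t c. assert (q0 = q) as -> by exact (Cfg_state _ _ _ _ _ (proj1 t) c). split; auto.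
  assert (X : exists s', opstep p s (opo p) s').
  { assert (E := Cfg_reg _ _ _ _ _ hR c). destruct t as [_ [_ [_ [k [h4 _]]]]]. rewrite h4 in E.
    destruct p as [r|r|r|a|]; cbn [opr opb opm opo] in *; try (eexists; constructor; fail).
    - destruct (s r) as [|x] eqn:Ex; [change (2 ^ Z.of_nat 0)%Z with 1%Z in E; lia|].
      exists (upd s r x). now constructor.
    - destruct (s r) as [|x] eqn:Ex; [eexists; now constructor|rewrite pow2_S in E; lia]. }
  destruct X as [s' st]. exists s'. split; auto.
  assert (t' := opstep_theta q q' p s s' hR st). rewrite <- (Cfg_coset _ _ _ _ c) in t'.
  rewrite (subrel_fun _ (theta_sub p) (theta_l p) _ _ _ t t'), mulKVg. apply Cfg_cfgx.
  intros r hr. rewrite (opstep_other _ _ _ _ r st) by lia. now apply c.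
Qed.

(** Operations are injective, and the same parity argument shows that a configuration in the target
    coset comes from a configuration. *)
Lemma Cfg_bwd p q q' q0 u u' s' : opr p < R -> theta p u u' -> Cfg (av q' p * u') q0 s' ->
  q0 = q' /\ exists s, opstep p s (opo p) s' /\ Cfg (av q p * u) q s.
Proof.
  intros hR t c. assert (q0 = q') as -> by exact (Cfg_state _ _ _ _ _ (proj1 (proj2 t)) c). split; auto.
  assert (X : exists s, opstep p s (opo p) s').
  { assert (E := Cfg_reg _ _ _ _ _ hR c). destruct t as [_ [_ [_ [k [_ h5]]]]]. rewrite h5 in E.
    destruct p as [r|r|r|a|]; cbn [opr opb opm' opo] in *; try (eexists; constructor; fail).
    - destruct (s' r) as [|x] eqn:Ex; [change (2 ^ Z.of_nat 0)%Z with 1%Z in E; lia|].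
      exists (upd s' r x). replace s' with (upd (upd s' r x) r (S (upd s' r x r))) at 2; [constructor|].
      apply functional_extensionality; upd.
    - exists (upd s' r (S (s' r))).
      replace s' with (upd (upd s' r (S (s' r))) r (s' r)) at 3; [constructor; upd|].
      apply functional_extensionality; upd.
    - destruct (s' r) as [|x] eqn:Ex; [eexists; now constructor|rewrite pow2_S in E; lia]. }
  destruct X as [s st]. exists s. split; auto.
  assert (t' := opstep_theta q q' p s s' hR st). rewrite <- (Cfg_coset _ _ _ _ c) in t'.
  assert (Eu : u = (av q p)^-1 * cfgx q s).
  { apply (subrel_fun (fun x y => theta p y x)) with u'; auto.
    - destruct (theta_sub p) as [h1 [h2 h3]]. split; [|split]; auto.
    - apply theta_r. }
  rewrite Eu, mulKVg. apply Cfg_cfgx.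
  intros r hr. rewrite <- (opstep_other _ _ _ _ r st) by lia. now apply c.
Qed.
End Encoding.
Arguments theta {R}.

Lemma msteps_asrt l k s o s' : (forall r, In r l -> s r = 0) -> msteps k s o [] s' ->
  msteps (map Asrt l ++ k) s o [] s'.
Proof.
  induction l as [|r l IH]; intros h hk; simpl; auto. change o with ([] ++ o).
  econstructor; [constructor; apply h; simpl; auto|]. apply IH; auto. intros; apply h; simpl; auto.
Qed.

Lemma msteps_asrt_inv l k s o s' : msteps (map Asrt l ++ k) s o [] s' ->
  (forall r, In r l -> s r = 0) /\ msteps k s o [] s'.
Proof.
  induction l as [|r l IH]; simpl; intros h; [split; [tauto|auto]|].
  inversion h as [|? ? ? ? ? ? ? ? h1 h2]; subst. inversion h1; subst. simpl.
  apply IH in h2 as [h2 h3]. split; auto. intros r' [<-|h']; auto.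
Qed.

Inductive three : Type := La | Ly | Ls.
Definition to3 (i : nat) : three := match i with 0 => La | 1 => Ly | _ => Ls end.
Definition of3 (a : three) : nat := match a with La => 0 | Ly => 1%nat | Ls => 2 end.

Definition unitg : group.
Proof. refine (Group unit (fun _ _ => tt) tt (fun _ => tt) _ _ _); auto. intros []; auto. Defined.

Definition F3 : group := fprod unitg three.
Definition flet (i : nat) : F3 := ht (to3 i).

Section F3Lift.
Variables (H : group) (f : nat -> H).
Definition f3lift : F3 -> H := hlift (fun _ => 1) (fun a => f (of3 a)).
Lemma f3lift_hom : ghom f3lift.
Proof. apply hlift_hom; [|apply triv_lift]; apply const1_hom. Qed.
Lemma f3lift_let i : f3lift (flet i) = f (of3 (to3 i)).
Proof. unfold f3lift, flet. rewrite hlift_t; [reflexivity|apply const1_hom|apply triv_lift, const1_hom]. Qed.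
End F3Lift.

Lemma tfree_F3 T : tfree T F3.
Proof. apply tfree_hnn. intros [] n _ _ _. reflexivity. Qed.

Lemma F3_ind (P : F3 -> Prop) : P 1 -> (forall i, i < 3 -> P (flet i)) ->
  (forall x y, P x -> P y -> P (x * y)) -> (forall x, P x -> P x^-1) -> forall c, P c.
Proof.
  intros P1 Pl PM PV. apply hnn_ind; auto.
  - intros []. change tt with (1 : unitg). rewrite (ghom1 _ _ _ hb_hom). exact P1.
  - intros [| |]; [apply (Pl 0)|apply (Pl 1%nat)|apply (Pl 2)]; lia.
Qed.

Definition fin (N : nat) := {i : nat | i < N}.

Section Tower.
Variables (T : nat -> Prop) (p : cmd).
Hypothesis p_sound : forall m, exists w, Ntriv T w /\
  run p (upd zero 0 m) (flat_map spell w) zero.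

Definition nreg : nat := S (list_max (map (fun ru : mrule => opr (snd (fst ru))) (crules p []))).
(** The assertions block every run that enters the program with a nonzero register besides the
    input. Without them such runs might print nontrivial words, and [VS_rule] would fail from right
    to left at the entry. *)
Definition start : list cmd := map Asrt (seq 1 (nreg - 1)) ++ [p].
Definition srule := (nat * op * nat)%type.
(** In state 0 register 0 is filled with an arbitrary input before control passes to the program,
    whose states are successors of codes of continuations. *)
Definition mrules : list srule :=
  (0, OInc 0, 0) :: (0, ONop, S (kcode start)) ::
  map (fun ru : mrule => (S (kcode (fst (fst ru))), snd (fst ru), S (kcode (snd ru)))) (krules start).

Lemma krules_app k k' ru : In ru (krules (map Asrt k ++ k')) ->
  (exists r k0, In r k /\ ru = (Asrt r :: k0, OZero r, k0)) \/ In ru (krules k').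
Proof.
  induction k as [|r k IH]; simpl; auto. intros [<-|h].
  - left. exists r, (map Asrt k ++ k'). auto.
  - destruct (IH h) as [[r' [k0 [h1 h2]]]|h1]; auto. left. exists r', k0. auto.
Qed.

Lemma mrules_reg q op q' : In (q, op, q') mrules -> opr op < nreg.
Proof.
  intros [[= <- <- <-]|[[= <- <- <-]|h]]; [unfold nreg; simpl; lia..|].
  apply in_map_iff in h as [[[k1 p1] k2] [[= <- <- <-] h]]. simpl.
  unfold start in h. apply krules_app in h as [[r [k0 [h [= -> -> ->]]]]|h].
  - simpl. apply in_seq in h. lia.
  - simpl in h. rewrite app_nil_r in h. unfold nreg.
    assert (H := proj1 (list_max_le (map (fun ru : mrule => opr (snd (fst ru))) (crules p [])) _) (le_n _)).
    rewrite Forall_forall in H. specialize (H (opr p1)).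
    assert (In (opr p1) (map (fun ru : mrule => opr (snd (fst ru))) (crules p [])))
      by (apply in_map_iff; exists (k1, p1, k2); auto).
    apply H in H0. lia.
Qed.

Notation C := (CP T).
Definition phiC : F3 -> C := f3lift C (cpl T).
Lemma phiC_hom : ghom phiC.
Proof. apply f3lift_hom. Qed.
Lemma phiC_let i : phiC (flet i) = cpl T i.
Proof. unfold phiC. rewrite f3lift_let. now destruct i as [|[|i]]. Qed.
Lemma phiC_word o : phiC (wev F3 flet o) = wev C (cpl T) o.
Proof.
  rewrite wev_ghom by apply phiC_hom. induction o as [|a o IH]; simpl; auto. rewrite IH.
  unfold lev. now rewrite phiC_let.
Qed.

(* [VS q s g]: from state [q] and registers [s], the remaining output has value [g]. *)
Definition VS (q : nat) (s : st) (g : C) : Prop :=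
  (q = 0 /\ (forall r, 1 <= r -> s r = 0) /\ g = 1) \/
  (exists k o, q = S (kcode k) /\ msteps k s o [] zero /\ g = wev C (cpl T) o).

Lemma VS_fun q s g g' : VS q s g -> VS q s g' -> g = g'.
Proof.
  intros [[-> [h ->]]|[k [o [-> [h ->]]]]] [[E [h' ->]]|[k' [o' [E [h' ->]]]]]; auto; try discriminate.
  injection E as E. apply kcode_inj in E. subst k'. f_equal. eapply msteps_end; eauto.
Qed.

(** At the passage from state 0 to the program, [p_sound] shows that the word printed from any input
    is trivial in [C], so both sides have value 1. For the other program rules, determinism
    identifies the remaining output after the step. *)
Lemma VS_rule q op q' s s' g : In (q, op, q') mrules -> opstep op s (opo op) s' ->
  (forall r, nreg <= r -> s r = 0) ->
  (VS q s (wev C (cpl T) (opo op) * g) <-> VS q' s' g).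
Proof.
  intros [[= <- <- <-]|[[= <- <- <-]|h]] st hs.
  - simpl. rewrite mul1g. inversion st; subst. unfold VS. split.
    + intros [[_ [h1 h2]]|[k [o [E _]]]]; [|discriminate]. left. repeat split; auto.
      intros [|r] hr; [lia|]. apply (h1 (S r)). lia.
    + intros [[_ [h1 h2]]|[k [o [E _]]]]; [|discriminate]. left. repeat split; auto.
      intros [|r] hr; [lia|]. apply (h1 (S r)). lia.
  - simpl. rewrite mul1g. inversion st; subst.
    assert (X : (forall r, 1 <= r -> s' r = 0) ->
              exists o, msteps start s' o [] zero /\ wev C (cpl T) o = 1).
    { intros h. destruct (p_sound (s' 0)) as [w [Nw r]].
      exists (flat_map spell w). split.
      - apply msteps_asrt.
        + intros i hi. apply in_seq in hi. apply h. lia.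
        + replace s' with (upd zero 0 (s' 0)); [apply r|].
          apply functional_extensionality. intros [|i]; upd. unfold zero. rewrite h; lia.
      - rewrite cp_word. apply ncls_one in Nw. rewrite Nw. apply ghom1, cpemb_hom. }
    split.
    + intros [[_ [h1 ->]]|[k [o [E _]]]]; [|discriminate].
      destruct (X h1) as [o [ho E]]. right. exists start, o. auto.
    + intros [[E _]|[k [o [E [ho ->]]]]]; [discriminate|].
      injection E as E. apply kcode_inj in E. subst k.
      assert (ho' := ho). apply msteps_asrt_inv in ho' as [h1 _].
      assert (h2 : forall r, 1 <= r -> s' r = 0).
      { intros r hr. destruct (lt_dec r nreg); [|apply hs; lia]. apply h1, in_seq. lia. }
      destruct (X h2) as [o' [ho' E]]. left. repeat split; auto.
      rewrite <- E. f_equal. eapply msteps_end; eauto.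
  - apply in_map_iff in h as [[[k1 p1] k2] [[= <- <- <-] h]]. simpl in *.
    assert (ms := krules_mstep _ _ _ _ _ _ _ h st). split.
    + intros [[E _]|[k [o [E [ho Eg]]]]]; [discriminate|]. injection E as E. apply kcode_inj in E. subst k.
      inversion ho as [|? ? ? ? ? ? ? ? m1 m2]; subst; [inversion ms|].
      destruct (mstep_det _ _ _ _ _ _ _ _ ms m1) as [<- [<- <-]].
      right. exists k2, o'. repeat split; auto. rewrite wev_app in Eg. now apply mulgI in Eg.
    + intros [[E _]|[k [o [E [ho ->]]]]]; [discriminate|]. injection E as E. apply kcode_inj in E. subst k.
      right. exists k1, (opo p1 ++ o). repeat split; [|now rewrite wev_app].
      econstructor; eauto.
Qed.

Notation X := (Lat (S nreg)).
Notation B := (BG X F3).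
Notation nrules := (length mrules).
Definition rule_at (i : nat) : srule := nth i mrules (0, ONop, 0).
Definition rq (i : nat) := fst (fst (rule_at i)).
Definition rop (i : nat) := snd (fst (rule_at i)).
Definition rq' (i : nat) := snd (rule_at i).

Lemma rule_in i : i < nrules -> In (rq i, rop i, rq' i) mrules.
Proof.
  intros h. replace (rq i, rop i, rq' i) with (rule_at i); [now apply nth_In|].
  unfold rq, rop, rq'. now destruct (rule_at i) as [[]].
Qed.

Definition krel (i : fin nrules) : B -> B -> Prop :=
  let j := proj1_sig i in
  pgen (rpair X F3 (theta (rop j)) (av _ (rq j) (rop j)) (av _ (rq' j) (rop j)) (wev F3 flet (opo (rop j)))).

Lemma krel_ok : assoc_ok krel.
Proof.
  intros i. apply rule_ok; [apply Lat_comm|apply theta_sub|apply theta_l|apply theta_r].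
Qed.

Definition K : group := hnn B (fin nrules) krel krel_ok.
Definition kf (f : F3) : K := hb (bf X F3 f).
Definition kt (x : X) : K := hb (bt X F3 ^ bx X F3 x).
Definition c0 : X := cfgx _ 0 zero.

Definition Vx (x : X) (g : C) := exists q s, Cfg _ x q s /\ VS q s g.

Lemma Vx_fun x g g' : Vx x g -> Vx x g' -> g = g'.
Proof.
  intros [q [s [c v]]] [q' [s' [c' v']]]. destruct (Cfg_fun _ _ _ _ _ _ c c') as [<- <-].
  eapply VS_fun; eauto.
Qed.

Lemma Vx_rule i u u' g : i < nrules -> theta (rop i) u u' ->
  (Vx (av _ (rq i) (rop i) * u) (phiC (wev F3 flet (opo (rop i))) * g) <->
   Vx (av _ (rq' i) (rop i) * u') g).
Proof.
  intros hi t. rewrite phiC_word. assert (hin := rule_in i hi). assert (hr := mrules_reg _ _ _ hin).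
  split; intros [q [s [c v]]].
  - destruct (Cfg_fwd _ _ _ (rq' i) _ _ _ _ hr t c) as [-> [s' [st c']]].
    exists (rq' i), s'. split; auto. eapply VS_rule; eauto. apply c.
  - destruct (Cfg_bwd _ _ (rq i) _ _ _ _ _ hr t c) as [-> [s' [st c']]].
    exists (rq i), s'. split; auto. eapply VS_rule; eauto. apply c'.
Qed.

Definition KC : group := prodg K C.

Inductive lpair : KC -> KC -> Prop :=
| lp_r i : lpair (ht i : K, 1) (ht i : K, 1)
| lp_c0 : lpair (kt c0, 1) (kt c0, 1)
| lp_f f : lpair (kf f, 1) (kf f, phiC f).

Definition lrel (_ : unit) : KC -> KC -> Prop := pgen lpair.

Notation M := (valM X F3 C phiC Vx).

Definition kgen : K -> C -> Prop :=
  pgen (ext_gen B (fin nrules) krel krel_ok C M (fun _ => 1)).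

(** Every pair has the form of [(k, 1)] and [(k, g)] with [g] a value of [k]. So the right side
    determines the left one, and the converse reduces to uniqueness of values. *)
Lemma lrel_ext i a b : lrel i a b -> snd a = 1 /\ fst b = fst a /\
  kgen (fst a) (snd b).
Proof.
  apply pgen_min with (R := fun a b : KC => snd a = 1 /\ fst b = fst a /\
    kgen (fst a) (snd b)).
  - split; [|split].
    + repeat split. apply pg_1.
    + intros x y x' y' [e1 [e2 e3]] [e1' [e2' e3']].
      cbv beta. change (snd (x * x')) with (snd x * snd x'). change (fst (y * y')) with (fst y * fst y').
      change (fst (x * x')) with (fst x * fst x'). change (snd (y * y')) with (snd y * snd y').
      rewrite e1, e1', e2, e2'. repeat split; [now grp|]. now apply pg_mul.
    + intros x y [e1 [e2 e3]].
      cbv beta. change (snd x^-1) with (snd x)^-1. change (fst y^-1) with (fst y)^-1.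
      change (fst x^-1) with (fst x)^-1. change (snd y^-1) with (snd y)^-1.
      rewrite e1, e2. repeat split; [now grp|]. now apply pg_inv.
  - intros x y [i'| |f]; simpl; repeat split; apply pg_in.
    + exact (eg_t B (fin nrules) krel krel_ok C M (fun _ => 1) i').
    + apply eg_b. apply valM_t; [apply phiC_hom|].
      exists 0, zero. split; [apply Cfg_cfgx; reflexivity|]. left. repeat split.
    + apply eg_b. apply valM_f, phiC_hom.
Qed.

(** Values extend from [B] to the subgroup of [K] in question by giving every rule letter the value
    1; the compatibility asked by [extension] is [valM_fwd] and [valM_bwd]. *)
Lemma M_ext (k : K) g : kgen k g -> k = 1 -> g = 1.
Proof.
  apply (extension (Rok := krel_ok) M (fun _ => 1)).
  - apply valM_sub, phiC_hom.
  - apply valM_fun; [apply phiC_hom|exact Vx_fun].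
  - intros i b b' h m r. rewrite conjg1. unfold krel in r.
    eapply (valM_fwd _ _ (theta (rop (proj1_sig i)))); [apply theta_sub|apply theta_l|apply phiC_hom| |exact m|exact r].
    intros u u' g0 t. apply Vx_rule; auto. apply (proj2_sig i).
  - intros i b b' h m r. rewrite invg1, conjg1. unfold krel in r.
    eapply (valM_bwd _ _ (theta (rop (proj1_sig i)))); [apply theta_sub|apply theta_r|apply phiC_hom| |exact m|exact r].
    intros u u' g0 t. apply Vx_rule; auto. apply (proj2_sig i).
Qed.

Lemma lrel_ok : assoc_ok lrel.
Proof.
  intros i. split; [apply subrel_pgen|split].
  - intros b h. apply lrel_ext in h as [_ [h1 h2]]. apply M_ext in h2; [|reflexivity].
    destruct b as [b1 b2]. simpl in *. now subst.
  - intros b h. apply lrel_ext in h as [h1 [h2 _]].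
    destruct b as [b1 b2]. simpl in *. now subst.
Qed.

Definition GG : group := hnn KC unit lrel lrel_ok.
Definition gk (k : K) : GG := hin1 K C unit lrel lrel_ok k.
Definition gc (c : C) : GG := hin2 K C unit lrel lrel_ok c.
Definition gl : GG := ht tt.

Lemma gk_hom : ghom gk.
Proof. apply hin1_hom. Qed.
Lemma gc_hom : ghom gc.
Proof. apply hin2_hom. Qed.
Lemma hb_kc (k : K) (c : C) : (hb ((k, c) : KC) : GG) = gk k * gc c.
Proof. apply hb_pair. Qed.
Lemma gkc_comm k c : comm (gk k) (gc c).
Proof. apply hin_comm. Qed.
Lemma gc_inj c : gc c = 1 -> c = 1.
Proof. intros h. apply hb_inj in h. now injection h. Qed.

Lemma tfree_GG : tfree T GG.
Proof.
  apply tfree_hnn, tfree_prod; [|apply tfree_CP].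
  apply tfree_hnn, tfree_hnn, tfree_prod; [apply tfree_Lat|apply tfree_F3].
Qed.

Lemma gl_rel a b : lpair a b -> (hb a : GG) ^ gl = hb b.
Proof. intros h. apply (ht_rel (Rok := lrel_ok) tt). now apply pg_in. Qed.
End Tower.

(** * The finite presentation *)

Lemma zp_ghom (G H : group) (f : G -> H) x z : ghom f -> f (zp x z) = zp (f x) z.
Proof.
  intros h. unfold zp. destruct (0 <=? z)%Z; rewrite ?(ghomV _ _ _ _ h), (ghomX _ _ _ _ _ h); reflexivity.
Qed.

Lemma wev_wzpow (H : group) g (w : word) z : wev H g (wzpow w z) = zp (wev H g w) z.
Proof. apply wev_zpow. Qed.

Lemma comm_lev (H : group) g z (a : letter) : (forall i, comm (g i) z) -> comm (lev H g a) z.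
Proof. intros h. destruct a as [i []]; unfold lev; simpl; [apply h|apply comm_inv, h]. Qed.

Lemma comm_wev (H : group) g z (w : word) : (forall i, comm (g i) z) -> comm (wev H g w) z.
Proof.
  intros h; induction w as [|a w IH]; simpl; [apply comm_one|].
  apply comm_mul; auto. now apply comm_lev.
Qed.

Lemma wev_mulc (H : group) (a b : nat -> H) w : (forall i j, comm (b i) (a j)) ->
  wev H (fun i => a i * b i) w = wev H a w * wev H b w.
Proof.
  intros h; induction w as [|[i x] w IH]; simpl; [now grp|]. rewrite IH.
  assert (C : comm (lev H b (i, x)) (wev H a w)).
  { apply comm_sym, comm_wev. intros j. apply comm_sym, comm_lev. auto. }
  assert (E : lev H (fun i => a i * b i) (i, x) = lev H a (i, x) * lev H b (i, x)).
  { unfold lev; simpl. destruct x; auto. rewrite invMg.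
    apply comm_inv, comm_sym, comm_inv, comm_sym, h. }
  rewrite E, !mulA. f_equal. rewrite <- !mulA. f_equal. exact C.
Qed.

Section Basis.
Variables (n : nat) (H : group).
Definition basis (i : nat) : Lat n := mkL (fun j => if j =? i then 1%Z else 0%Z).

Lemma latlift_at_basis (xi : nat -> H) i : i < n -> latlift n H xi (basis i) = xi i.
Proof.
  intros h. unfold latlift.
  assert (X : forall k, k <= n -> latp H xi (lx (basis i)) k = if i <? k then xi i else 1).
  { induction k as [|k IH]; intros hk; cbn [latp]; [reflexivity|]. rewrite IH by lia.
    unfold basis. rewrite lx_mk by lia.
    destruct (Nat.ltb_spec i k), (Nat.ltb_spec i (S k)), (Nat.eqb_spec k i); subst; try lia;
      unfold zp; simpl; now grp. }
  rewrite X by lia. now rewrite (proj2 (Nat.ltb_lt _ _) h).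
Qed.

Variable eta : Lat n -> H.
Hypothesis eta_hom : ghom eta.

Lemma lx_zp (x : Lat n) z i : lx (zp x z) i = (z * lx x i)%Z.
Proof. unfold zp. destruct (Z.leb_spec 0 z); rewrite ?lx_inv, lx_pow; lia. Qed.

Lemma latlift_basis x : latlift n H (fun i => eta (basis i)) x = eta x.
Proof.
  unfold latlift.
  assert (X : forall k, k <= n -> latp H (fun i => eta (basis i)) (lx x) k =
            eta (mkL (fun i => if i <? k then lx x i else 0%Z))).
  { induction k as [|k IH]; intros h; cbn [latp].
    - rewrite <- (ghom1 _ _ _ eta_hom). reflexivity.
    - rewrite IH by lia. rewrite <- (zp_ghom _ _ _ _ _ eta_hom), <- eta_hom. f_equal. apply lx_eq. intros i hi.
      rewrite lx_mul, lx_zp. unfold basis. rewrite !lx_mk by auto.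
      destruct (Nat.ltb_spec i k), (Nat.ltb_spec i (S k)), (Nat.eqb_spec i k); subst; lia. }
  rewrite X by lia. f_equal. apply lx_eq. intros i hi. rewrite lx_mk by auto.
  now rewrite (proj2 (Nat.ltb_lt _ _) hi).
Qed.
End Basis.

Definition ltr (i : nat) : word := [(i, true)].

Lemma wev_ltr (H : group) g i : wev H g (ltr i) = g i.
Proof. simpl. apply mulg1. Qed.

Definition wfw (m : nat) (w : word) : Prop := Forall (fun a : letter => fst a < m) w.

Lemma wfw_app m u v : wfw m u -> wfw m v -> wfw m (u ++ v).
Proof. intros; apply Forall_app; auto. Qed.
Lemma wfw_inv m u : wfw m u -> wfw m (winv u).
Proof.
  intros h. unfold winv. apply Forall_rev, Forall_map. revert h. apply Forall_impl. auto.
Qed.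
Lemma wfw_pow m u k : wfw m u -> wfw m (wpow u k).
Proof. intros h; induction k; simpl; [constructor|now apply wfw_app]. Qed.
Lemma wfw_zpow m u z : wfw m u -> wfw m (wzpow u z).
Proof. intros h. unfold wzpow. destruct (0 <=? z)%Z; apply wfw_pow; auto using wfw_inv. Qed.
Lemma wfw_ltr m i : i < m -> wfw m (ltr i).
Proof. repeat constructor; auto. Qed.

Definition relabel (f : nat -> nat) (o : word) : word := map (fun a => (f (fst a), snd a)) o.

Lemma wev_relabel (H : group) g f o : wev H g (relabel f o) = wev H (fun i => g (f i)) o.
Proof. induction o as [|[i x] o IH]; simpl; auto. now rewrite IH. Qed.
Lemma wfw_relabel m f o : (forall i, f i < m) -> wfw m (relabel f o).
Proof. intros h; induction o; constructor; simpl; auto. Qed.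

Lemma Forall_seq (P : nat -> Prop) a k : Forall P (seq a k) <-> forall i, a <= i < a + k -> P i.
Proof. rewrite Forall_forall. split; intros h i hi; apply h, in_seq || apply in_seq in hi; auto. Qed.

(* Generators: [0 .. n-1] for the lattice, then [f_0, f_1, f_2], [t], the copies of the [f_j] in
   [C], the letter [l], and the rule letters. *)
Section Presentation.
Variable p : cmd.
Notation R := (nreg p).
Notation n := (S R).
Notation N := (length (mrules p)).
Notation X := (Lat n).

(** Indices above 2 are read as 2, as in [to3] and [cpl], so that identities between words need no
    bound on their letters. *)
Definition xf (j : nat) : nat := n + min j 2.
Definition xt : nat := n + 3.
Definition xc (j : nat) : nat := n + 4 + min j 2.
Definition xl : nat := n + 7.
Definition xr (i : nat) : nat := n + 8 + i.
Definition ng : nat := n + 8 + N.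

Fixpoint latword (f : nat -> Z) (k : nat) : word :=
  match k with 0 => [] | S j => latword f j ++ wzpow (ltr j) (f j) end.
Definition tword (x : X) : word :=
  winv (latword (lx x) n) ++ ltr xt ++ latword (lx x) n.

Notation op_ i := (rop p i).
Notation src i := (av R (rq p i) (rop p i)).
Notation dst i := (av R (rq' p i) (rop p i)).

Definition cm (u v : word) : word * word := (u ++ v, v ++ u).

(** The subgroup [theta] is generated by finitely many pairs: the unit vectors of the unaffected
    registers, and the [opm]-fold and [opm']-fold unit vector of the affected one. The state
    coordinate is absent because [theta] requires it to be 0. *)
Definition rule_eqs (i : nat) : list (word * word) :=
  map (fun j => cm (ltr j) (ltr (xr i))) (filter (fun j => negb (j =? S (opr (op_ i)))) (seq 1 R)) ++
  [(wpow (ltr (S (opr (op_ i)))) (opm (op_ i)) ++ ltr (xr i),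
    ltr (xr i) ++ wpow (ltr (S (opr (op_ i)))) (opm' (op_ i)))] ++
  map (fun j => cm (ltr (xf j)) (ltr (xr i))) (seq 0 3) ++
  [(tword (src i) ++ ltr (xr i), ltr (xr i) ++ relabel xf (opo (op_ i)) ++ tword (dst i))].

(** No relator of [C+] is listed; they follow by [relators]. *)
Definition eqs : list (word * word) :=
  flat_map (fun i => map (fun j => cm (ltr i) (ltr j)) (seq 0 n)) (seq 0 n) ++
  flat_map (fun i => map (fun j => cm (ltr i) (ltr (xf j))) (seq 0 3)) (seq 0 n) ++
  flat_map rule_eqs (seq 0 N) ++
  flat_map (fun j => map (fun i => cm (ltr i) (ltr (xc j))) (seq 0 n) ++
                     map (fun i => cm (ltr (xf i)) (ltr (xc j))) (seq 0 3) ++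
                     [cm (ltr xt) (ltr (xc j))] ++
                     map (fun i => cm (ltr (xr i)) (ltr (xc j))) (seq 0 N)) (seq 0 3) ++
  map (fun i => cm (ltr (xr i)) (ltr xl)) (seq 0 N) ++
  [cm (tword (c0 p)) (ltr xl)] ++
  map (fun j => (ltr (xf j) ++ ltr xl, ltr xl ++ ltr (xf j) ++ ltr (xc j))) (seq 0 3).

Definition GP : pres := Pres ng (map (fun e => fst e ++ winv (snd e)) eqs).

Section Satisfaction.
Variables (H : group) (g : nat -> H).

Definition TT (x : X) : H := (g xt) ^ (latlift n H g x).

Lemma wev_latword f k : wev H g (latword f k) = latp H g f k.
Proof.
  induction k as [|k IH]; auto. cbn [latword latp]. now rewrite wev_app, wev_wzpow, wev_ltr, IH.
Qed.

Lemma wev_tword x : wev H g (tword x) = TT x.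
Proof.
  unfold tword, TT, conj. now rewrite !wev_app, wev_inv, !wev_latword, wev_ltr.
Qed.

Record Sat : Prop := {
  sat_xx : forall i, 0 <= i < 0 + n -> forall j, 0 <= j < 0 + n -> comm (g i) (g j);
  sat_xf : forall i, 0 <= i < 0 + n -> forall j, 0 <= j < 0 + 3 -> comm (g i) (g (xf j));
  sat_rx : forall i, 0 <= i < 0 + N -> forall j, 1 <= j < 1 + R -> j <> S (opr (op_ i)) ->
     comm (g j) (g (xr i));
  sat_rr : forall i, 0 <= i < 0 + N ->
     gpow (g (S (opr (op_ i)))) (opm (op_ i)) * g (xr i) =
     g (xr i) * gpow (g (S (opr (op_ i)))) (opm' (op_ i));
  sat_rf : forall i, 0 <= i < 0 + N -> forall j, 0 <= j < 0 + 3 -> comm (g (xf j)) (g (xr i));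
  sat_rt : forall i, 0 <= i < 0 + N -> TT (src i) * g (xr i) =
     g (xr i) * (wev H (fun j => g (xf j)) (opo (op_ i)) * TT (dst i));
  sat_cx : forall j, 0 <= j < 0 + 3 -> forall i, 0 <= i < 0 + n -> comm (g i) (g (xc j));
  sat_cf : forall j, 0 <= j < 0 + 3 -> forall i, 0 <= i < 0 + 3 -> comm (g (xf i)) (g (xc j));
  sat_ct : forall j, 0 <= j < 0 + 3 -> comm (g xt) (g (xc j));
  sat_cr : forall j, 0 <= j < 0 + 3 -> forall i, 0 <= i < 0 + N -> comm (g (xr i)) (g (xc j));
  sat_lr : forall i, 0 <= i < 0 + N -> comm (g (xr i)) (g xl);
  sat_lt : comm (TT (c0 p)) (g xl);
  sat_lf : forall j, 0 <= j < 0 + 3 -> g (xf j) * g xl = g xl * (g (xf j) * g (xc j)) }.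

Definition holds (l : list (word * word)) : Prop :=
  Forall (fun e => wev H g (fst e) = wev H g (snd e)) l.

Lemma holds_app l l' : holds (l ++ l') <-> holds l /\ holds l'.
Proof. apply Forall_app. Qed.
Lemma holds_flat f a k : holds (flat_map f (seq a k)) <-> forall i, a <= i < a + k -> holds (f i).
Proof. unfold holds. rewrite Forall_flat_map. apply Forall_seq. Qed.
Lemma holds_map f a k : holds (map f (seq a k)) <-> forall i, a <= i < a + k -> holds [f i].
Proof.
  unfold holds. rewrite Forall_map, Forall_seq. split; intros h i hi; specialize (h i hi);
    [constructor; auto|now inversion h].
Qed.
Lemma holds_filter f b a k : holds (map f (filter b (seq a k))) <->
  forall i, a <= i < a + k -> b i = true -> holds [f i].
Proof.
  unfold holds. rewrite Forall_map, Forall_forall. split; intros h i hi.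
  - intros hb. constructor; auto. apply h, filter_In. split; auto. now apply in_seq.
  - apply filter_In in hi as [hi hb]. apply in_seq in hi. specialize (h i hi hb). now inversion h.
Qed.
Lemma holds_one u v : holds [(u, v)] <-> wev H g u = wev H g v.
Proof. unfold holds. rewrite Forall_cons_iff. simpl. intuition. Qed.
Lemma holds_cm u v : holds [cm u v] <-> comm (wev H g u) (wev H g v).
Proof. unfold cm. rewrite holds_one, !wev_app. reflexivity. Qed.

Lemma holds_rule i : holds (rule_eqs i) <->
  (forall j, 1 <= j < 1 + R -> j <> S (opr (op_ i)) -> comm (g j) (g (xr i))) /\
  (gpow (g (S (opr (op_ i)))) (opm (op_ i)) * g (xr i) =
     g (xr i) * gpow (g (S (opr (op_ i)))) (opm' (op_ i))) /\
  (forall j, 0 <= j < 0 + 3 -> comm (g (xf j)) (g (xr i))) /\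
  TT (src i) * g (xr i) = g (xr i) * (wev H (fun j => g (xf j)) (opo (op_ i)) * TT (dst i)).
Proof.
  unfold rule_eqs. rewrite !holds_app, holds_filter, holds_map, !holds_one.
  rewrite !wev_app, !wev_pow, !wev_ltr, !wev_tword, wev_relabel.
  split; intros [h1 [h2 [h3 h4]]]; (split; [|split; [exact h2|split; [|exact h4]]]); intros j hj.
  - intros hne. rewrite <- (wev_ltr H g j), <- (wev_ltr H g (xr i)). apply holds_cm, h1; auto.
    now apply negb_true_iff, Nat.eqb_neq.
  - rewrite <- (wev_ltr H g (xf j)), <- (wev_ltr H g (xr i)). apply holds_cm, h3; auto.
  - intros hb. apply holds_cm. rewrite !wev_ltr. apply h1; auto.
    now apply negb_true_iff, Nat.eqb_neq in hb.
  - apply holds_cm. rewrite !wev_ltr. auto.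
Qed.

Lemma Sat_eqs : Sat <-> holds eqs.
Proof.
  unfold eqs. rewrite !holds_app, !holds_flat, !holds_map, holds_cm, wev_tword, wev_ltr.
  split.
  - intros [h1 h2 h3 h4 h5 h6 h7 h8 h9 h10 h11 h12 h13].
    repeat (match goal with |- _ /\ _ => split end); intros.
    + apply holds_map. intros. apply holds_cm. rewrite !wev_ltr. auto.
    + apply holds_map. intros. apply holds_cm. rewrite !wev_ltr. auto.
    + apply holds_rule. repeat split; intros; auto.
    + rewrite !holds_app, !holds_map, holds_cm, !wev_ltr.
      repeat split; intros; try (apply holds_cm; rewrite !wev_ltr); auto.
    + apply holds_cm. rewrite !wev_ltr. auto.
    + auto.
    + apply holds_one. rewrite !wev_app, !wev_ltr. auto.
  - intros [h1 [h2 [h3 [h4 [h5 [h6 h7]]]]]].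
    assert (h4' : forall j, 0 <= j < 0 + 3 ->
      (forall i, 0 <= i < 0 + n -> comm (g i) (g (xc j))) /\
      (forall i, 0 <= i < 0 + 3 -> comm (g (xf i)) (g (xc j))) /\ comm (g xt) (g (xc j)) /\
      (forall i, 0 <= i < 0 + N -> comm (g (xr i)) (g (xc j)))).
    { intros j hj. specialize (h4 j hj). rewrite !holds_app, !holds_map, holds_cm, !wev_ltr in h4.
      destruct h4 as [k1 [k2 [k3 k4]]]. repeat split; auto; intros i hi.
      - specialize (k1 i hi). now rewrite holds_cm, !wev_ltr in k1.
      - specialize (k2 i hi). now rewrite holds_cm, !wev_ltr in k2.
      - specialize (k4 i hi). now rewrite holds_cm, !wev_ltr in k4. }
    assert (h3' := fun i hi => proj1 (holds_rule i) (h3 i hi)).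
    split; auto; try (intros j hj; apply (h4' j hj)); try (intros i hi; apply (h3' i hi)).
    + intros i hi j hj. specialize (h1 i hi). rewrite holds_map in h1. specialize (h1 j hj).
      now rewrite holds_cm, !wev_ltr in h1.
    + intros i hi j hj. specialize (h2 i hi). rewrite holds_map in h2. specialize (h2 j hj).
      now rewrite holds_cm, !wev_ltr in h2.
    + intros i hi. specialize (h5 i hi). now rewrite holds_cm, !wev_ltr in h5.
    + intros j hj. specialize (h7 j hj). now rewrite holds_one, !wev_app, !wev_ltr in h7.
Qed.

Lemma Sat_rels : Sat <-> forall r, In r (rels GP) -> wev H g r = 1.
Proof.
  rewrite Sat_eqs. unfold holds. rewrite Forall_forall. cbn [rels GP]. split.
  - intros h r hr. apply in_map_iff in hr as [[u v] [<- he]]. apply h in he. simpl in he |- *. rewrite wev_app, wev_inv, he.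
    apply mulgV.
  - intros h e he. apply eq_divg1. rewrite <- wev_inv, <- wev_app. apply h, in_map_iff. now exists e.
Qed.
End Satisfaction.

Lemma wfw_latword f k : k <= n -> wfw ng (latword f k).
Proof.
  induction k as [|k IH]; intros h; [constructor|]. cbn [latword].
  apply wfw_app; [apply IH; lia|]. apply wfw_zpow, wfw_ltr. unfold ng. lia.
Qed.

Lemma wfw_tword x : wfw ng (tword x).
Proof.
  assert (L := wfw_latword (lx x) n (le_n n)).
  unfold tword. apply wfw_app; [now apply wfw_inv|]. apply wfw_app; [|exact L].
  apply wfw_ltr. unfold xt, ng. lia.
Qed.

Lemma opr_rop i : 0 <= i < 0 + N -> opr (op_ i) < R.
Proof. intros h. apply (mrules_reg p (rq p i) (op_ i) (rq' p i)), rule_in. lia. Qed.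

Lemma wf_GP : wf_pres GP.
Proof.
  unfold wf_pres. cbn [rels GP]. apply Forall_map.
  assert (X : Forall (fun e => wfw ng (fst e) /\ wfw ng (snd e)) eqs).
  2:{ revert X. apply Forall_impl. intros e [h1 h2]. now apply wfw_app; [|apply wfw_inv]. }
  assert (xf_lt : forall j, xf j < ng) by (intros; unfold xf, ng; lia).
  assert (xc_lt : forall j, xc j < ng) by (intros; unfold xc, ng; lia).
  assert (xt_lt : xt < ng) by (unfold xt, ng; lia).
  assert (xl_lt : xl < ng) by (unfold xl, ng; lia).
  assert (xr_lt : forall i, 0 <= i < 0 + N -> xr i < ng) by (intros; unfold xr, ng; lia).
  assert (x_lt : forall i, i < n -> i < ng) by (intros; unfold ng; lia).
  assert (CM : forall u v, wfw ng u -> wfw ng v -> wfw ng (fst (cm u v)) /\ wfw ng (snd (cm u v)))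
    by (intros; unfold cm; simpl; split; now apply wfw_app).
  unfold eqs. apply Forall_app; split; [|apply Forall_app; split; [|apply Forall_app; split; [|apply Forall_app; split; [|apply Forall_app; split; [|apply Forall_app; split]]]]].
  - apply Forall_flat_map, Forall_seq. intros i hi. apply Forall_map, Forall_seq. intros j hj.
    apply CM; apply wfw_ltr; apply x_lt; lia.
  - apply Forall_flat_map, Forall_seq. intros i hi. apply Forall_map, Forall_seq. intros j hj.
    apply CM; apply wfw_ltr; auto. apply x_lt; lia.
  - apply Forall_flat_map, Forall_seq. intros i hi. assert (ho := opr_rop i hi).
    unfold rule_eqs. apply Forall_app; split; [|apply Forall_app; split; [|apply Forall_app; split]].
    + apply Forall_map, Forall_forall. intros j hj. apply filter_In in hj as [hj _].
      apply in_seq in hj. apply CM; apply wfw_ltr; auto. apply x_lt; lia.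
    + constructor; [|constructor]. cbn [fst snd].
      split; apply wfw_app; try apply wfw_pow; apply wfw_ltr; auto; apply x_lt; lia.
    + apply Forall_map, Forall_seq. intros j hj. apply CM; apply wfw_ltr; auto.
    + constructor; [|constructor]. cbn [fst snd].
      split; apply wfw_app; auto using wfw_tword, wfw_ltr.
      apply wfw_app; auto using wfw_tword, wfw_relabel.
  - apply Forall_flat_map, Forall_seq. intros j hj. apply Forall_app; split; [|apply Forall_app; split; [|apply Forall_app; split]].
    + apply Forall_map, Forall_seq. intros i hi. apply CM; apply wfw_ltr; auto. apply x_lt; lia.
    + apply Forall_map, Forall_seq. intros i hi. apply CM; apply wfw_ltr; auto.
    + constructor; [|constructor]. apply CM; apply wfw_ltr; auto.
    + apply Forall_map, Forall_seq. intros i hi. apply CM; apply wfw_ltr; auto.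
  - apply Forall_map, Forall_seq. intros i hi. apply CM; apply wfw_ltr; auto.
  - constructor; [|constructor]. apply CM; [apply wfw_tword|apply wfw_ltr; auto].
  - apply Forall_map, Forall_seq. intros j hj. cbn [fst snd].
    split; repeat apply wfw_app; apply wfw_ltr; auto.
Qed.
End Presentation.

(** * Homomorphisms out of the tower *)

Lemma conj_centralizes (G : group) (x y z : G) : comm x z -> comm y z -> comm (x ^ y) z.
Proof. intros hx hy. apply comm_mul; [now apply comm_inv|now apply comm_mul]. Qed.

Lemma BG_ind (X F : group) (P : BG X F -> Prop) : P 1 -> (forall x, P (bx X F x)) ->
  (forall f, P (bf X F f)) -> P (bt X F) -> (forall x y, P x -> P y -> P (x * y)) ->
  (forall x, P x -> P x^-1) -> forall b, P b.
Proof.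
  intros P1 Px Pf Pt PM PV. apply hnn_ind; auto.
  - intros [x f]. change (P (hb ((x, f) : YG X F))). rewrite hb_bxf. auto.
  - intros []. exact Pt.
Qed.

Lemma K_ind p (P : K p -> Prop) : P 1 -> (forall b : BG _ F3, P (hb b)) -> (forall i, P (ht i)) ->
  (forall x y, P x -> P y -> P (x * y)) -> (forall x, P x -> P x^-1) -> forall k, P k.
Proof. apply hnn_ind. Qed.

Section LiftGG.
Variables (T : nat -> Prop) (p : cmd).
Hypothesis p_sound : forall m, exists w, Ntriv T w /\
  run p (upd zero 0 m) (flat_map spell w) zero.
Hypothesis p_complete : forall w, Ntriv T w ->
  exists m, run p (upd zero 0 m) (flat_map spell w) zero.
Variables (H : group) (g : nat -> H).
Hypothesis sat : Sat p H g.

Notation R := (nreg p).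
Notation n := (S R).
Notation N := (length (mrules p)).
Notation X := (Lat n).
Notation B := (BG X F3).
Notation op_ i := (rop p i).
Notation src i := (av R (rq p i) (rop p i)).
Notation dst i := (av R (rq' p i) (rop p i)).
Notation fg := (fun j => g (xf p j)).
Notation cg' := (fun j => g (xc p j)).
Notation l := (g (xl p)).

Lemma min2 j : exists j', j' < 3 /\ min j 2 = min j' 2.
Proof. exists (min j 2). lia. Qed.

Lemma cf_comm i j : comm (fg i) (cg' j).
Proof.
  destruct (min2 i) as [i' [hi Ei]], (min2 j) as [j' [hj Ej]].
  unfold xf, xc. rewrite Ei, Ej. apply (sat_cf _ _ _ sat); lia.
Qed.

Definition pX : X -> H := latlift n H g.
Lemma pX_hom : ghom pX.
Proof. apply latlift_hom. intros i j hi hj. apply (sat_xx _ _ _ sat); lia. Qed.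

Definition pF : F3 -> H := f3lift H fg.
Lemma pF_hom : ghom pF.
Proof. apply f3lift_hom. Qed.
Lemma pF_let i : pF (flet i) = fg i.
Proof. unfold pF. rewrite f3lift_let. destruct i as [|[|i]]; auto. unfold xf. f_equal. simpl. lia. Qed.
Lemma pF_word o : pF (wev F3 flet o) = wev H fg o.
Proof.
  rewrite wev_ghom by apply pF_hom. induction o as [|a o IH]; simpl; auto. rewrite IH.
  unfold lev. now rewrite pF_let.
Qed.

Lemma pF_comm f z : (forall j, j < 3 -> comm (fg j) z) -> comm (pF f) z.
Proof.
  intros h. pattern f. apply F3_ind.
  - rewrite (ghom1 _ _ _ pF_hom). apply comm_one.
  - intros i hi. rewrite pF_let. auto.
  - intros x y hx hy. rewrite pF_hom. now apply comm_mul.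
  - intros x hx. rewrite (ghomV _ _ _ _ pF_hom). now apply comm_inv.
Qed.

Lemma pXF_comm x f : comm (pX x) (pF f).
Proof.
  apply latlift_comm. intros i hi. apply comm_sym, pF_comm. intros j hj. apply comm_sym.
  apply (sat_xf _ _ _ sat); lia.
Qed.

Definition pY (y : YG X F3) : H := pX (fst y) * pF (snd y).
Lemma pY_hom : ghom pY.
Proof.
  apply ghom_pair; [apply pX_hom|apply pF_hom|exact pXF_comm].
Qed.

Definition pB : B -> H := hlift pY (fun _ => g (xt p)).
Lemma pB_hom : ghom pB.
Proof. apply hlift_hom; [apply pY_hom|apply triv_lift, pY_hom]. Qed.
Lemma pB_x x : pB (bx _ _ x) = pX x.
Proof.
  unfold pB, bx, hin1. rewrite hlift_b by (try apply triv_lift; apply pY_hom).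
  unfold pY; simpl. rewrite (ghom1 _ _ _ pF_hom). apply mulg1.
Qed.
Lemma pB_f f : pB (bf _ _ f) = pF f.
Proof.
  unfold pB, bf, hin2. rewrite hlift_b by (try apply triv_lift; apply pY_hom).
  unfold pY; simpl. rewrite (ghom1 _ _ _ pX_hom). apply mul1g.
Qed.
Lemma pB_t : pB (bt _ _) = g (xt p).
Proof. exact (hlift_t (Rok := triv_ok _ unit) pY _ pY_hom (triv_lift _ _ pY_hom) tt). Qed.
Lemma pB_tx x : pB (bt _ _ ^ bx _ _ x) = TT p H g x.
Proof. rewrite (ghomJ _ _ _ _ _ pB_hom), pB_x, pB_t. reflexivity. Qed.

Lemma conj_rel x y z : x * z = z * y -> x ^ z = y :> H.
Proof. intros E. unfold conj. now rewrite E, mulKg. Qed.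

Lemma pX_rule i x x' : i < N -> theta (op_ i) x x' -> (pX x) ^ (g (xr p i)) = pX x'.
Proof.
  intros hi [h1 [h2 [h3 [k [h4 h5]]]]].
  assert (L : forall m, m <= n -> (latp H g (lx x) m) ^ (g (xr p i)) = latp H g (lx x') m).
  { induction m as [|m IH]; intros hm; cbn [latp]; [apply conj_one|].
    rewrite conj_mul, IH by lia. f_equal.
    destruct m as [|m]; [rewrite h1, h2; apply conj_one|].
    destruct (Nat.eq_dec (S m) (S (opr (op_ i)))) as [E|E].
    (* The coordinate [m * k] contributes the [k]-th power of an [m]-th power, so the single
       relation between the [opm]-th and [opm']-th powers suffices. *)
    - rewrite E, h4, h5, !zp_mul, zp_conj. f_equal. apply conj_rel, (sat_rr _ _ _ sat). lia.
    - rewrite h3 by auto. apply conj_comm, comm_zp, (sat_rx _ _ _ sat); auto; lia. }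
  apply L. lia.
Qed.

Lemma pF_rule i f : i < N -> (pF f) ^ (g (xr p i)) = pF f.
Proof.
  intros hi. apply conj_comm, pF_comm. intros j hj. apply (sat_rf _ _ _ sat); lia.
Qed.

Lemma TT_rule i : i < N -> (TT p H g (src i)) ^ (g (xr p i)) = wev H fg (opo (op_ i)) * TT p H g (dst i).
Proof. intros hi. apply conj_rel, (sat_rt _ _ _ sat). lia. Qed.

Definition pr (i : fin N) : H := g (xr p (proj1_sig i)).
Lemma pB_rel i b b' : krel p i b b' -> (pB b) ^ (pr i) = pB b'.
Proof.
  assert (hi := proj2_sig i). cbv beta in hi.
  apply pgen_conj; [apply pB_hom|].
  intros x y [u u' t|f|]; unfold pr.
  - rewrite !pB_x. now apply pX_rule.
  - rewrite pB_f. now apply pF_rule.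
  - rewrite pB_hom, !pB_tx, pB_f, pF_word. now apply TT_rule.
Qed.

Definition pK : K p -> H := hlift pB pr.
Lemma pK_hom : ghom pK.
Proof. apply hlift_hom; [apply pB_hom|apply pB_rel]. Qed.
Lemma pK_b b : pK (hb b) = pB b.
Proof. apply hlift_b; [apply pB_hom|apply pB_rel]. Qed.
Lemma pK_r i : pK (ht i) = pr i.
Proof. apply hlift_t; [apply pB_hom|apply pB_rel]. Qed.

(* Configuration [(q, s)] reached with output [o]: since [l] commutes with the rule letters,
   the property propagates along the run of the machine. *)
Definition reach (q : nat) (s : st) (o : word) : Prop :=
  comm (wev H fg o * TT p H g (cfgx R q s)) l.

Lemma TT_mul a u : TT p H g (a * u) = (TT p H g a) ^ (pX u).
Proof. unfold TT. fold (pX (a * u)). now rewrite pX_hom, conj_conj. Qed.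

Lemma reach_rule q op q' s s' o : In (q, op, q') (mrules p) -> opstep op s (opo op) s' ->
  reach q s o -> reach q' s' (o ++ opo op).
Proof.
  intros h st hr. assert (hreg := mrules_reg _ _ _ _ h).
  destruct (In_nth _ _ (0, ONop, 0) h) as [i [hi E]]. change (i < N) in hi.
  assert (Eq : rq p i = q /\ rop p i = op /\ rq' p i = q').
  { change (rule_at p i = (q, op, q')) in E. unfold rq, rop, rq'. now rewrite E. }
  destruct Eq as [<- [<- <-]]. clear E.
  assert (t := opstep_theta R (rq p i) (rq' p i) _ _ _ hreg st).
  set (u := (src i)^-1 * cfgx R (rq p i) s) in *.
  set (u' := (dst i)^-1 * cfgx R (rq' p i) s') in *.
  assert (E : cfgx R (rq p i) s = src i * u) by (unfold u; now rewrite mulKVg).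
  assert (E' : cfgx R (rq' p i) s' = dst i * u') by (unfold u'; now rewrite mulKVg).
  clearbody u u'. unfold reach in *. rewrite E in hr. rewrite E'.
  (* Conjugation by the rule letter carries the element of the old configuration to that of the new
     one; as this letter commutes with [l], so does the result. *)
  assert (Y : (wev H fg o * TT p H g (src i * u)) ^ (g (xr p i)) =
              wev H fg (o ++ opo (op_ i)) * TT p H g (dst i * u')).
  { rewrite conj_mul. rewrite <- pF_word, pF_rule, pF_word by auto.
    rewrite TT_mul. rewrite conj_conj.
    replace (pX u * g (xr p i)) with (g (xr p i) * pX u')
      by (rewrite <- (pX_rule i u u') by auto; unfold conj; now rewrite mulKVg).
    rewrite <- conj_conj, TT_rule, conj_mul by auto.
    rewrite (conj_comm _ (wev _ _ _)) by (rewrite <- pF_word; apply comm_sym, pXF_comm).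
    now rewrite <- TT_mul, wev_app, mulA. }
  rewrite <- Y.
  assert (C := sat_lr _ _ _ sat i ltac:(lia)).
  now apply conj_centralizes.
Qed.

Lemma reach_steps k s o k' s' : msteps k s o k' s' -> incl (krules k) (krules (start p)) ->
  forall o0, reach (S (kcode k)) s o0 -> reach (S (kcode k')) s' (o0 ++ o).
Proof.
  induction 1 as [k s|k s o k1 s1 o' k2 s2 st _ IH]; intros hk o0 h.
  - now rewrite app_nil_r.
  - destruct (krules_step _ _ _ _ _ st) as [op [h1 [h2 h3]]].
    assert (Eo : o = opo op) by now inversion h2. subst o.
    rewrite app_assoc. apply IH.
    + intros x hx. auto.
    + eapply reach_rule; eauto. right; right. apply in_map_iff. exists (k, op, k1). auto.
Qed.

Lemma reach_input m : reach 0 (upd zero 0 m) [].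
Proof.
  induction m as [|m IH].
  - replace (upd zero 0 0) with zero by (apply functional_extensionality; unfold zero; upd).
    unfold reach. cbn [wev]. rewrite mul1g. apply (sat_lt _ _ _ sat).
  - assert (X : opstep (OInc 0) (upd zero 0 m) [] (upd zero 0 (S m))).
    { replace (upd zero 0 (S m)) with (upd (upd zero 0 m) 0 (S (upd zero 0 m 0))); [constructor|].
      apply functional_extensionality; upd. }
    apply (reach_rule 0 (OInc 0) 0 _ _ [] (or_introl eq_refl) X IH).
Qed.

Lemma reach_output w : Ntriv T w -> reach (S (kcode [])) zero (flat_map spell w).
Proof.
  intros h. destruct (p_complete w h) as [m r].
  assert (S1 : reach (S (kcode (start p))) (upd zero 0 m) []).
  { apply (reach_rule 0 ONop _ _ _ [] (or_intror (or_introl eq_refl)) (os_nop _) (reach_input m)). }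
  apply (fun st => reach_steps _ _ _ _ _ st (incl_refl _) [] S1).
  apply msteps_asrt; [|apply r]. intros i hi. apply in_seq in hi. upd.
Qed.

(** The runs printing [w] and the empty word end in the same configuration. The quotient of the two
    elements commuting with [l] is the bare output. *)
Lemma output_comm w : Ntriv T w -> comm (wev H fg (flat_map spell w)) l.
Proof.
  intros h. assert (h1 := reach_output w h). assert (h2 := reach_output [] N_nil).
  unfold reach in *. simpl in h2. rewrite mul1g in h2. apply comm_inv in h2.
  assert (h3 := comm_mul _ _ _ _ h1 h2). rewrite mulA, mulgV, mulg1 in h3. exact h3.
Qed.

Lemma relators w : Ntriv T w -> nev H (spellv H cg') w = 1.
Proof.
  intros h. rewrite <- wev_spells. set (o := flat_map spell w).
  assert (C := output_comm w h). fold o in C. apply conj_comm in C.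
  assert (E : (wev H fg o) ^ l = wev H (fun j => fg j * cg' j) o).
  { rewrite (wev_ghom H H (fun x => x ^ l)) by (intros x y; apply conj_mul).
    f_equal. apply functional_extensionality; intros j. apply conj_rel.
    destruct (min2 j) as [j' [hj Ej]]. unfold xf, xc. rewrite Ej. apply (sat_lf _ _ _ sat). lia. }
  rewrite C, wev_mulc in E by (intros; apply comm_sym, cf_comm).
  symmetry. apply (mulgI H (wev H fg o)). now rewrite mulg1.
Qed.

Definition pC : CP T -> H := cplift T H cg'.
Lemma pC_hom : ghom pC.
Proof. apply cplift_hom, relators. Qed.
Lemma pC_let i : pC (cpl T i) = cg' i.
Proof.
  destruct (lt_dec i 3) as [h|h]; [exact (cplift_cpl T H cg' relators i h)|].
  replace (cpl T i) with (cpl T 2) by (destruct i as [|[|i]]; [lia|lia|reflexivity]).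
  unfold pC. rewrite (cplift_cpl T H cg' relators 2) by lia. unfold xc. f_equal. lia.
Qed.

Lemma pC_comm c z : (forall j, j < 3 -> comm z (cg' j)) -> comm z (pC c).
Proof.
  intros h. apply comm_sym. pattern c. apply CP_ind.
  - rewrite (ghom1 _ _ _ pC_hom). apply comm_one.
  - intros i hi. rewrite pC_let. apply comm_sym. auto.
  - intros x y hx hy. rewrite pC_hom. now apply comm_mul.
  - intros x hx. rewrite (ghomV _ _ _ _ pC_hom). now apply comm_inv.
Qed.

Lemma pKC_comm k c : comm (pK k) (pC c).
Proof.
  apply pC_comm. intros j hj. pattern k. apply K_ind.
  - rewrite (ghom1 _ _ _ pK_hom). apply comm_one.
  - intros b. rewrite pK_b. pattern b. apply BG_ind.
    + rewrite (ghom1 _ _ _ pB_hom). apply comm_one.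
    + intros x. rewrite pB_x. apply latlift_comm. intros i hi. apply (sat_cx _ _ _ sat); lia.
    + intros f. rewrite pB_f. apply pF_comm. intros i hi. apply cf_comm.
    + rewrite pB_t. apply (sat_ct _ _ _ sat). lia.
    + intros x y hx hy. rewrite pB_hom. now apply comm_mul.
    + intros x hx. rewrite (ghomV _ _ _ _ pB_hom). now apply comm_inv.
  - intros i. rewrite pK_r. unfold pr. assert (hi := proj2_sig i). cbv beta in hi.
    apply (sat_cr _ _ _ sat); lia.
  - intros x y hx hy. rewrite pK_hom. now apply comm_mul.
  - intros x hx. rewrite (ghomV _ _ _ _ pK_hom). now apply comm_inv.
Qed.

Definition pKC (a : KC T p) : H := pK (fst a) * pC (snd a).
Lemma pKC_hom : ghom pKC.
Proof.
  apply ghom_pair; [apply pK_hom|apply pC_hom|exact pKC_comm].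
Qed.

Lemma pFC_l f : (pF f) ^ l = pF f * pC (phiC T f).
Proof.
  pattern f. apply F3_ind.
  - rewrite (ghom1 _ _ _ pF_hom), (ghom1 _ _ _ (phiC_hom T)), (ghom1 _ _ _ pC_hom), conj_one. now grp.
  - intros i hi. rewrite pF_let, phiC_let, pC_let. apply conj_rel, (sat_lf _ _ _ sat). lia.
  - intros x y hx hy. rewrite pF_hom, conj_mul, hx, hy, (phiC_hom T), pC_hom.
    assert (C : comm (pF y) (pC (phiC T x))).
    { apply pC_comm. intros j hj. apply pF_comm. intros i hi. apply cf_comm. }
    unfold comm in C. rewrite !mulA. f_equal. rewrite <- !mulA. now rewrite C.
  - intros x hx. rewrite (ghomV _ _ _ _ pF_hom), conj_inv, hx, (ghomV _ _ _ _ (phiC_hom T)), (ghomV _ _ _ _ pC_hom).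
    assert (C : comm (pF x) (pC (phiC T x))).
    { apply pC_comm. intros j hj. apply pF_comm. intros i hi. apply cf_comm. }
    rewrite <- invMg. f_equal. exact C.
Qed.

Lemma pKC_rel i a b : lrel T p i a b -> (pKC a) ^ l = pKC b.
Proof.
  apply pgen_conj; [apply pKC_hom|].
  intros x y [j| |f]; unfold pKC; cbn [fst snd]; rewrite ?(ghom1 _ _ _ pC_hom), ?mulg1.
  - rewrite pK_r. unfold pr. assert (hj := proj2_sig j). cbv beta in hj.
    apply conj_comm, (sat_lr _ _ _ sat). lia.
  - unfold kt. rewrite pK_b, pB_tx. apply conj_comm, (sat_lt _ _ _ sat).
  - unfold kf. rewrite pK_b, pB_f. apply pFC_l.
Qed.

Notation GG := (GG T p p_sound).
Definition pG : GG -> H := hlift pKC (fun _ => l).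
Lemma pG_hom : ghom pG.
Proof. apply hlift_hom; [apply pKC_hom|apply pKC_rel]. Qed.
Lemma pG_k k : pG (gk T p p_sound k) = pK k.
Proof.
  unfold pG, gk, hin1. rewrite hlift_b by (apply pKC_hom || apply pKC_rel).
  unfold pKC; simpl. rewrite (ghom1 _ _ _ pC_hom). apply mulg1.
Qed.
Lemma pG_c c : pG (gc T p p_sound c) = pC c.
Proof.
  unfold pG, gc, hin2. rewrite hlift_b by (apply pKC_hom || apply pKC_rel).
  unfold pKC; simpl. rewrite (ghom1 _ _ _ pK_hom). apply mul1g.
Qed.
Lemma pG_l : pG (gl T p p_sound) = l.
Proof. exact (hlift_t (Rok := lrel_ok T p p_sound) pKC (fun _ => l) pKC_hom pKC_rel tt). Qed.
End LiftGG.

(** * The universal group *)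

Section Generators.
Variables (T : nat -> Prop) (p : cmd).
Hypothesis p_sound : forall m, exists w, Ntriv T w /\
  run p (upd zero 0 m) (flat_map spell w) zero.
Hypothesis p_complete : forall w, Ntriv T w ->
  exists m, run p (upd zero 0 m) (flat_map spell w) zero.

Notation R := (nreg p).
Notation n := (S R).
Notation N := (length (mrules p)).
Notation X := (Lat n).
Notation B := (BG X F3).
Notation GG := (GG T p p_sound).
Notation gk := (gk T p p_sound).
Notation gc := (gc T p p_sound).
Notation gl := (gl T p p_sound).

Definition gx (x : X) : GG := gk (hb (bx X F3 x)).
Definition gf (f : F3) : GG := gk (kf p f).
Definition gt : GG := gk (hb (bt X F3)).
Definition gr (i : nat) : GG :=
  match lt_dec i N with left h => gk (ht (exist _ i h)) | right _ => 1 end.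

Definition gval (i : nat) : GG :=
  if i <? n then gx (basis n i)
  else if i <? n + 3 then gf (flet (i - n))
  else if i <? n + 4 then gt
  else if i <? n + 7 then gc (cpl T (i - (n + 4)))
  else if i <? n + 8 then gl
  else gr (i - (n + 8)).

Ltac gv := unfold gval; repeat (match goal with |- context [?a <? ?b] =>
  destruct (Nat.ltb_spec a b); try lia end).

Lemma gval_x i : i < n -> gval i = gx (basis n i).
Proof. intros h. gv. reflexivity. Qed.
Lemma gval_f j : gval (xf p j) = gf (flet j).
Proof. unfold xf. gv. replace (n + min j 2 - n) with (min j 2) by lia. now destruct j as [|[|j]]. Qed.
Lemma gval_t : gval (xt p) = gt.
Proof. unfold xt. gv. reflexivity. Qed.
Lemma gval_c j : gval (xc p j) = gc (cpl T j).
Proof.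
  unfold xc. gv. replace (n + 4 + min j 2 - (n + 4)) with (min j 2) by lia.
  now destruct j as [|[|j]].
Qed.
Lemma gval_l : gval (xl p) = gl.
Proof. unfold xl. gv. reflexivity. Qed.
Lemma gval_r i (h : i < N) : gval (xr p i) = gk (ht (exist _ i h)).
Proof.
  unfold xr. gv. replace (n + 8 + i - (n + 8)) with i by lia. unfold gr.
  destruct (lt_dec i N) as [h'|h']; [|contradiction]. do 3 f_equal. apply proof_irrelevance.
Qed.

Lemma gx_hom : ghom gx.
Proof. intros x y. unfold gx, K. rewrite bx_hom, hb_hom. apply gk_hom. Qed.
Lemma gf_hom : ghom gf.
Proof. intros x y. unfold gf, kf, K. rewrite bf_hom, hb_hom. apply gk_hom. Qed.

Lemma gk_comm a b : comm a b -> comm (gk a) (gk b).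
Proof. unfold comm. intros E. now rewrite <- !gk_hom, E. Qed.
Lemma hb_comm (a b : B) : comm a b -> comm (hb a : K p) (hb b : K p).
Proof.
  unfold comm. intros E. unfold K. rewrite <- !hb_hom. now rewrite E.
Qed.

Lemma latlift_gval x : latlift n GG gval x = gx x.
Proof.
  rewrite <- (latlift_basis n GG gx gx_hom). unfold latlift.
  assert (L : forall k, k <= n -> latp GG gval (lx x) k = latp GG (fun i => gx (basis n i)) (lx x) k).
  { induction k as [|k IH]; intros h; cbn [latp]; auto. now rewrite IH, gval_x by lia. }
  apply L. lia.
Qed.

Lemma TT_gval x : TT p GG gval x = gk (kt p x).
Proof.
  unfold TT. rewrite latlift_gval, gval_t. unfold gt, gx. rewrite <- (ghomJ _ _ _ _ _ (gk_hom T p p_sound)).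
  f_equal. unfold kt. symmetry. apply ghomJ, hb_hom.
Qed.

Lemma wev_gf o : wev GG (fun j => gval (xf p j)) o = gf (wev F3 flet o).
Proof.
  rewrite (wev_ghom _ _ gf) by apply gf_hom. f_equal. apply functional_extensionality; intros j.
  apply gval_f.
Qed.

Lemma rule_conj (i : fin N) b b' :
  rpair X F3 (theta (rop p (proj1_sig i))) (av _ (rq p (proj1_sig i)) (rop p (proj1_sig i)))
    (av _ (rq' p (proj1_sig i)) (rop p (proj1_sig i))) (wev F3 flet (opo (rop p (proj1_sig i)))) b b' ->
  gk (hb b) * gk (ht i) = gk (ht i) * gk (hb b').
Proof.
  intros h. rewrite <- !gk_hom. f_equal.
  assert (E : (hb b : K p) ^ (ht i : K p) = hb b') by (apply (ht_rel i); now apply pg_in).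
  rewrite <- E. unfold conj. now rewrite mulKVg.
Qed.

Lemma l_conj a b : lpair T p a b -> (hb a : GG) * gl = gl * hb b.
Proof. intros h. rewrite <- (gl_rel T p p_sound a b h). unfold conj. now rewrite mulKVg. Qed.

Lemma theta_basis o j : j < n -> j <> 0 -> j <> S (opr o) -> theta o (basis n j) (basis n j).
Proof.
  intros h0 h1 h2. unfold theta.
  assert (E : forall i, i < n -> i <> j -> lx (basis n j) i = 0%Z).
  { intros i h h'. unfold basis. rewrite lx_mk by auto. now rewrite (proj2 (Nat.eqb_neq _ _) h'). }
  assert (Eo : lx (basis n j) (S (opr o)) = 0%Z).
  { destruct (lt_dec (S (opr o)) n) as [h|h]; [apply E; auto|].
    destruct (basis n j) as [f hf]. apply hf. lia. }
  split; [apply E; lia|split; [apply E; lia|split; [reflexivity|]]]. exists 0%Z. rewrite Eo. lia.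
Qed.

Lemma theta_pow o : opr o < R ->
  theta o (gpow (basis n (S (opr o))) (opm o)) (gpow (basis n (S (opr o))) (opm' o)).
Proof.
  intros h.
  assert (E : forall i, i <> S (opr o) -> lx (basis n (S (opr o))) i = 0%Z).
  { intros i h'. destruct (lt_dec i n) as [hi|hi].
    - unfold basis. rewrite lx_mk by auto. now rewrite (proj2 (Nat.eqb_neq _ _) h').
    - destruct (basis n (S (opr o))) as [f hf]. apply hf. lia. }
  assert (E1 : lx (basis n (S (opr o))) (S (opr o)) = 1%Z).
  { unfold basis. rewrite lx_mk by lia. now rewrite Nat.eqb_refl. }
  unfold theta. rewrite !lx_pow, !(E 0), E1 by lia.
  split; [lia|split; [lia|split]].
  - intros j hj. rewrite !lx_pow, E by auto. lia.
  - exists 1%Z. lia.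
Qed.

Lemma gf_kt f x : gf f * gk (kt p x) = gk (hb (bf X F3 f * (bt X F3 ^ bx X F3 x))).
Proof.
  transitivity (gk (kf p f * kt p x)); [symmetry; apply gk_hom|].
  f_equal. symmetry. apply hb_hom.
Qed.

Lemma Sat_gval : Sat p GG gval.
Proof.
  split.
  - intros i hi j hj. rewrite !gval_x by lia. apply gk_comm, hb_comm, bx_comm, Lat_comm.
  - intros i hi j hj. rewrite gval_x, gval_f by lia. apply gk_comm, hb_comm, bxf_comm.
  - intros i hi j hj hne. assert (h : i < N) by lia. rewrite gval_x, (gval_r i h) by lia.
    apply (rule_conj (exist _ i h)), rp_x, theta_basis; auto; lia.
  - intros i hi. assert (h : i < N) by lia. assert (ho := opr_rop p i hi).
    rewrite gval_x, (gval_r i h) by lia. rewrite <- !(ghomX _ _ gx) by apply gx_hom.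
    apply (rule_conj (exist _ i h)), rp_x, theta_pow. exact ho.
  - intros i hi j hj. assert (h : i < N) by lia. rewrite gval_f, (gval_r i h).
    apply (rule_conj (exist _ i h)), rp_f.
  - intros i hi. assert (h : i < N) by lia. rewrite !TT_gval, (gval_r i h), wev_gf.
    rewrite gf_kt. apply (rule_conj (exist _ i h)), rp_t.
  - intros j hj i hi. rewrite gval_x, gval_c by lia. apply gkc_comm.
  - intros j hj i hi. rewrite gval_f, gval_c. apply gkc_comm.
  - intros j hj. rewrite gval_t, gval_c. apply gkc_comm.
  - intros j hj i hi. assert (h : i < N) by lia. rewrite (gval_r i h), gval_c. apply gkc_comm.
  - intros i hi. assert (h : i < N) by lia. rewrite (gval_r i h), gval_l. apply l_conj, lp_r.
  - rewrite TT_gval, gval_l. apply l_conj, lp_c0.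
  - intros j hj. rewrite gval_f, gval_l, gval_c.
    replace (gf (flet j) * gc (cpl T j)) with (hb ((kf p (flet j), cpl T j) : KC T p) : GG) by apply hb_kc.
    rewrite <- (phiC_let T j). apply l_conj, lp_f.
Qed.

Lemma wev_gval_trivial w : weq (GP p) w [] -> wev GG gval w = 1.
Proof.
  intros h. apply (wev_step GG gval (GP p) w []); auto.
  apply (Sat_rels p GG gval), Sat_gval.
Qed.

Lemma pG_gval (H : group) (g : nat -> H) (sat : Sat p H g) i : i < ng p ->
  pG T p p_sound H g (gval i) = g i.
Proof.
  intros hi. assert (hc := pG_c T p p_sound p_complete H g sat).
  assert (hk := pG_k T p p_sound p_complete H g sat).
  assert (hl := pG_l T p p_sound p_complete H g sat).
  unfold ng in hi.
  destruct (lt_dec i n) as [h1|h1].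
  { rewrite gval_x by auto. unfold gx. rewrite hk, pK_b, pB_x by auto.
    now apply latlift_at_basis. }
  destruct (lt_dec i (n + 3)) as [h2|h2].
  { replace i with (xf p (i - n)) by (unfold xf; lia). rewrite gval_f. unfold gf, kf.
    rewrite hk, pK_b, pB_f by auto. apply pF_let. }
  destruct (lt_dec i (n + 4)) as [h3|h3].
  { replace i with (xt p) by (unfold xt; lia). rewrite gval_t. unfold gt.
    now rewrite hk, pK_b, pB_t by auto. }
  destruct (lt_dec i (n + 7)) as [h4|h4].
  { replace i with (xc p (i - (n + 4))) by (unfold xc; lia). rewrite gval_c, hc.
    now apply pC_let. }
  destruct (lt_dec i (n + 8)) as [h5|h5].
  { replace i with (xl p) by (unfold xl; lia). now rewrite gval_l, hl. }
  assert (h : i - (n + 8) < N) by lia.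
  replace i with (xr p (i - (n + 8))) by (unfold xr; lia). rewrite (gval_r _ h), hk.
  now rewrite pK_r.
Qed.

(** The presented group satisfies its own equations, so [pG] maps [GG] to it and inverts [gval] on
    generators; hence nothing that is trivial in [GG] is nontrivial in the presentation. *)
Lemma GP_faithful w : wf_word (GP p) w -> wev GG gval w = 1 -> weq (GP p) w [].
Proof.
  intros hw E. apply pcls_inj. rewrite <- wev_pgn.
  assert (sat : Sat p (pg (GP p)) (pgn (GP p))).
  { apply Sat_rels. intros r hr. rewrite wev_pgn. change 1 with (pcls (GP p) []).
    apply pcls_eq, rst_step. generalize (step_rel (GP p) [] [] r hr). now rewrite app_nil_r. }
  assert (hG := pG_hom T p p_sound p_complete _ _ sat).
  apply (f_equal (pG T p p_sound _ (pgn (GP p)))) in E.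
  rewrite (wev_ghom _ _ _ _ _ hG), (ghom1 _ _ _ hG) in E.
  change (pcls (GP p) []) with (1 : pg (GP p)). rewrite <- E.
  apply wev_ext with (GP p); auto. intros i hi. symmetry. now apply pG_gval.
Qed.

Lemma GP_torsion_free A : T = absset A -> ~ A 0%Z -> torsion_free A (GP p).
Proof.
  intros hT h0 w z hw hz E. apply GP_faithful; auto. apply wev_gval_trivial in E.
  rewrite wev_zpow in E.
  assert (E' : gpow (wev GG gval w) (Z.abs_nat z) = 1).
  { destruct (0 <=? z)%Z; auto. rewrite <- (invgK _ (gpow _ _)), E. apply invg1. }
  apply (tfree_GG T p p_sound _ (Z.abs_nat z)); auto.
  - rewrite hT. now exists z.
  - destruct (Z.eq_dec z 0) as [->|]; [contradiction|lia].
Qed.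

Definition image (H : pres) (i : nat) : word :=
  relabel (xc p) (flat_map spell [cp (pcode H) (2 * i)]).

Lemma wev_image H i : wev GG gval (image H i) = gc (cpemb T (cgen T H i)).
Proof.
  unfold image. rewrite wev_relabel.
  replace (fun j => gval (xc p j)) with (fun j => gc (cpl T j))
    by (apply functional_extensionality; intros; symmetry; apply gval_c).
  rewrite <- (wev_ghom _ _ gc) by apply gc_hom. f_equal. apply cp_word.
Qed.

Lemma image_wf H i : wf_word (GP p) (image H i).
Proof. apply wfw_relabel. intros j. unfold xc, ng. cbn [ngen GP]. unfold ng. lia. Qed.

Lemma wmap_wf (H : pres) (phi : nat -> word) w : (forall i, wf_word (GP p) (phi i)) ->
  wf_word (GP p) (wmap phi w).
Proof.
  intros h. apply Forall_flat_map, Forall_forall. intros [i []] _; simpl; [apply h|].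
  apply wfw_inv, h.
Qed.

Lemma wev_image_word H w : wev GG gval (wmap (image H) w) = gc (cpemb T (wev (CG T) (cgen T H) w)).
Proof.
  rewrite wev_wmap.
  assert (h : ghom (fun c => gc (cpemb T c))) by (intros x y; now rewrite cpemb_hom, gc_hom).
  rewrite (wev_ghom _ _ (fun c => gc (cpemb T c)) _ _ h). f_equal.
  apply functional_extensionality; intros i. apply wev_image.
Qed.

Lemma GP_universal A H : T = absset A -> wf_pres H -> torsion_free A H -> embeds H (GP p).
Proof.
  intros hT wH tH. exists (image H). split; [split|].
  - intros i _. apply image_wf.
  - intros r hr. apply GP_faithful; [apply wmap_wf; auto; apply image_wf|].
    rewrite wev_image_word, cgen_rel by auto.
    rewrite (ghom1 _ _ _ (cpemb_hom T)). apply ghom1, gc_hom.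
  - intros w hw E. apply wev_gval_trivial in E. rewrite wev_image_word in E.
    apply gc_inj, cpemb_inj in E. now apply (cgen_inj T A H hT wH tH).
Qed.
End Generators.

Lemma embeds_torsion_free A H G : torsion_free A G -> embeds H G -> torsion_free A H.
Proof.
  intros tG [phi [[h1 h2] h3]] w z hw hz E. apply h3; auto.
  apply tG with z; auto.
  - apply Forall_flat_map. revert hw. apply Forall_impl. intros [i []] hi; simpl in *; [now apply h1|].
    apply wfw_inv. now apply h1.
  - apply wzpow_one.
    assert (hp : forall u, wev (pg G) (fun i => pcls G (phi i)) u = pcls G (wmap phi u)).
    { intros u. rewrite <- wev_pgn, wev_wmap. f_equal. apply functional_extensionality; intros i.
      now rewrite wev_pgn. }
    assert (E' := wev_step (pg G) (fun i => pcls G (phi i)) H (wzpow w z) [] (fun r hr => eq_trans (hp r) (pcls_eq _ _ _ (h2 r hr))) E).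
    rewrite wev_zpow, hp in E'. simpl in E'.
    destruct (0 <=? z)%Z; auto. rewrite <- (invgK _ (gpow _ _)), E'. apply invg1.
Qed.

Theorem theorem2p12 (A : Z -> Prop) (hA : re_set A) :
  exists G : pres, wf_pres G /\ torsion_free A G /\
    forall H : pres, wf_pres H -> (embeds H G <-> torsion_free A H).
Proof.
  destruct (classic (A 0%Z)) as [h0|h0].
  - assert (t0 : torsion_free A (Pres 0 [])).
    { intros w z hw _ _. destruct w as [|a w]; [apply rst_refl|].
      now apply Forall_inv, Nat.nlt_0_r in hw. }
    exists (Pres 0 []). split; [constructor|]. split; [exact t0|].
    intros H wH. split; [now apply embeds_torsion_free|]. intros tH.
    exists (fun _ => []). split; [split; [intros; constructor|]|].
    + intros r _. replace (wmap (fun _ => []) r) with (@nil letter); [apply rst_refl|].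
      induction r as [|[i []] r IH]; auto.
    + intros w hw _. apply tH with 0%Z; auto. apply rst_refl.
  - destruct (Ntriv_enumerable A (absset A) hA) as [E [pE [E0 [E1 E2]]]]; [reflexivity|].
    destruct (emitter E pE) as [p hp].
    assert (p_sound : forall m, exists w, Ntriv (absset A) w /\
              run p (upd zero 0 m) (flat_map spell w) zero).
    { intros m. destruct (E1 m) as [w [Nw Ew]]. exists w. split; [exact Nw|now apply hp]. }
    assert (p_complete : forall w, Ntriv (absset A) w ->
              exists m, run p (upd zero 0 m) (flat_map spell w) zero).
    { intros w Nw. destruct (E2 w Nw) as [m Em]. exists m. now apply hp. }
    assert (tG := GP_torsion_free _ p p_sound p_complete A eq_refl h0).
    exists (GP p). split; [apply wf_GP|]. split; [exact tG|].
    intros H wH. split; [now apply embeds_torsion_free|].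
    now apply (GP_universal _ p p_sound p_complete A H eq_refl).
Qed.
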